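(* Hamiltonian-ML-Subgraph is NP-hard and W[1]-hard when parameterized by $k$ for all $\ell\ge 2$ and $t\ge\ell$.
   Context: For a graph property $\Pi$, $\Pi$-ML-Subgraph is: given graphs $G_1,\ldots,G_t$ all on the same vertex set $V$ and positive integers $k$ and $\ell$, decide whether there is $X\subseteq V$ with $|X|\ge k$ such that $G_i[X]\in\Pi$ for at least $\ell$ of the graphs $G_i$. In this paper a graph is called Hamiltonian if it contains a simple path visiting every vertex exactly once (a Hamiltonian path). *)

(* Defs.v *)
From mathcomp Require Import all_boot.
Set Implicit Arguments.
Unset Strict Implicit.
Unset Printing Implicit Defensive.

(** * Deterministic multi-tape Turing machines *)

Definition word := seq bool.

Inductive move := MoveL | Stay | MoveR.

(* [None] is the blank; [E] holds the work symbols other than the two bits. *)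
Definition symbol (E : finType) : finType := option (bool + E)%type.

(* A two-way infinite tape: the cells left of the head (nearest first), the
   scanned cell, the cells right of the head; all other cells are blank. *)
Record tape (E : finType) := Tape {
  tape_left : seq (symbol E);
  tape_head : symbol E;
  tape_right : seq (symbol E)
}.

Definition tape_of_word (E : finType) (w : word) : tape E :=
  let cells := [seq Some (inl b) : symbol E | b <- w] in
  Tape [::] (head None cells) (behead cells).

Fixpoint leading_bits (E : finType) (s : seq (symbol E)) : word :=
  if s is Some (inl b) :: s' then b :: leading_bits s' else [::].

(* The bits from the scanned cell rightwards, up to the first non-bit cell. *)
Definition word_of_tape (E : finType) (tp : tape E) : word :=
  leading_bits (tape_head tp :: tape_right tp).

Definition tape_step (E : finType) (tp : tape E) (a : symbol E * move) : tape E :=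
  let: Tape l _ r := tp in
  match a.2 with
  | MoveL => Tape (behead l) (head None l) (a.1 :: r)
  | Stay => Tape l a.1 r
  | MoveR => Tape (a.1 :: l) (head None r) (behead r)
  end.

Record tm := TM {
  tm_tapes : nat;
  tm_extra : finType;
  tm_state : finType;
  tm_start : tm_state;
  tm_halt : pred tm_state;
  tm_trans : tm_state -> {ffun 'I_tm_tapes -> symbol tm_extra} ->
    tm_state * {ffun 'I_tm_tapes -> symbol tm_extra * move}
}.

Definition config (M : tm) : Type :=
  (tm_state M * {ffun 'I_(tm_tapes M) -> tape (tm_extra M)})%type.

Definition tm_step (M : tm) (c : config M) : config M :=
  if tm_halt c.1 then c else
  let qa := tm_trans c.1 [ffun i => tape_head (c.2 i)] in
  (qa.1, [ffun i => tape_step (c.2 i) (qa.2 i)]).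

(* The arguments are placed on the first tapes, one word per tape. *)
Definition tm_init (M : tm) (ins : seq word) : config M :=
  (tm_start M, [ffun i : 'I_(tm_tapes M) => tape_of_word _ (nth [::] ins i)]).

(* Halting configurations are fixed by [tm_step], so the machine halts after at
   most [T] steps. The results are read off the first tapes. *)
Definition computes_within (M : tm) (ins outs : seq word) (T : nat) : Prop :=
  let c := iter T (@tm_step M) (tm_init M ins) in
  tm_halt c.1 /\
  take (size outs) [seq word_of_tape (c.2 i) | i <- enum 'I_(tm_tapes M)] = outs.

(** * NP-hardness *)

(* Every polynomial is bounded by [n ^ c + c] for some [c]. *)
Definition polybound (c n : nat) : nat := n ^ c + c.

Definition problem := word -> Prop.

Definition polytime_fun (f : word -> word) : Prop :=
  exists (M : tm) (c : nat), forall x,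
    computes_within M [:: x] [:: f x] (polybound c (size x)).

Definition polytime_verifier (V : word -> word -> bool) : Prop :=
  exists (M : tm) (c : nat), forall x y,
    computes_within M [:: x; y] [:: [:: V x y]]
      (polybound c (size x + size y)).

Definition NP (L : problem) : Prop :=
  exists V : word -> word -> bool, polytime_verifier V /\
  exists c : nat, forall x,
    L x <-> exists y, size y <= polybound c (size x) /\ V x y.

Definition polytime_reducible (L L' : problem) : Prop :=
  exists f : word -> word, polytime_fun f /\ forall x, L x <-> L' (f x).

Definition NP_hard (L : problem) : Prop :=
  forall L', NP L' -> polytime_reducible L' L.

(** * Parameterized problems and reductions *)

Definition param_problem := word -> nat -> Prop.

Definition unary (n : nat) : word := nseq n true.

Definition computable (f : nat -> nat) : Prop :=
  exists M : tm, forall n, exists T : nat,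
    computes_within M [:: unary n] [:: unary (f n)] T.

Definition fpt_reducible (P Q : param_problem) : Prop :=
  exists (r : word -> nat -> word) (s : word -> nat -> nat),
  [/\ forall x k, P x k <-> Q (r x k) (s x k),
      exists2 g : nat -> nat, computable g & forall x k, s x k <= g k
    & exists (M : tm) (h : nat -> nat) (c : nat), computable h /\
        forall x k, computes_within M [:: x; unary k] [:: r x k; unary (s x k)]
                      (h k * polybound c (size x))].

(* Unary, self-delimiting code. It is used below for wire numbers of circuits,
   for vertex and layer counts, and for the thresholds of subgraph problems;
   thresholds exceeding these counts only give trivial no-instances. *)
Definition code_nats (s : seq nat) : word :=
  flatten [seq rcons (unary n) false | n <- s].

(** * The W-hierarchy *)

Inductive gate_kind := GAnd | GOr | GNot.

(* The wires [0 .. c_inputs - 1] are the inputs and wire [c_inputs + j] is the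
   j-th gate; a gate is given with the list of the wires feeding it. *)
Record circuit := Circuit {
  c_inputs : nat;
  c_gates : seq (gate_kind * seq nat);
  c_output : nat
}.

Definition fanin_ok (g : gate_kind * seq nat) : bool :=
  if g.1 is GNot then size g.2 == 1 else 2 <= size g.2.

Definition circuit_wf (C : circuit) : Prop :=
  (forall j, j < size (c_gates C) ->
    let g := nth (GAnd, [::]) (c_gates C) j in
    [/\ fanin_ok g, uniq g.2 & all (fun i => i < c_inputs C + j) g.2]) /\
  c_output C < c_inputs C + size (c_gates C).

(* Propagates the data [ini] on the inputs through the gates, in order, and
   returns what reaches the output. *)
Definition propagate (T : Type) (x0 : T) (op : gate_kind -> seq T -> T)
    (C : circuit) (ini : seq T) : T :=
  nth x0 (foldl (fun vs g => rcons vs (op g.1 [seq nth x0 vs i | i <- g.2]))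
                ini (c_gates C)) (c_output C).

Definition gate_val (g : gate_kind) (vs : seq bool) : bool :=
  match g with
  | GAnd => all id vs
  | GOr => has id vs
  | GNot => ~~ head false vs
  end.

Definition circuit_eval (C : circuit) (a : seq bool) : bool :=
  propagate false gate_val C a.

Definition depth (C : circuit) : nat :=
  propagate 0 (fun _ ds => (\max_(d <- ds) d).+1) C (nseq (c_inputs C) 0).

(* The maximal number of large gates (fan-in more than 2) on a path from an
   input to the output. *)
Definition weft (C : circuit) : nat :=
  propagate 0 (fun _ ds => (2 < size ds) + \max_(d <- ds) d) C
    (nseq (c_inputs C) 0).

Definition code_gate_kind (g : gate_kind) : nat :=
  match g with GAnd => 0 | GOr => 1 | GNot => 2 end.

Definition code_circuit (C : circuit) : word :=
  code_nats [:: c_inputs C, c_output C, size (c_gates C)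
    & flatten [seq [:: code_gate_kind g.1, size g.2 & g.2] | g <- c_gates C]].

(* Weighted circuit satisfiability for circuits of weft at most [t] and depth
   at most [d], parameterized by the weight. *)
Definition weighted_circuit_sat (t d : nat) : param_problem := fun w k =>
  exists C : circuit,
    [/\ w = code_circuit C, circuit_wf C, weft C <= t, depth C <= d
      & exists a : seq bool,
          [/\ size a = c_inputs C, count id a = k & circuit_eval C a]].

Definition W (t : nat) (P : param_problem) : Prop :=
  exists d : nat, fpt_reducible P (weighted_circuit_sat t d).

Definition W_hard (t : nat) (Q : param_problem) : Prop :=
  forall P, W t P -> fpt_reducible P Q.

(** * Multi-layer subgraph problems *)

Record sgraph (V : finType) := SGraph {
  adj :> rel V;
  adj_sym : symmetric adj;
  adj_irr : irreflexive adj
}.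

Section Induced.
Variables (V : finType) (G : sgraph V) (X : {set V}).

Definition induced_adj : rel {x : V | x \in X} :=
  fun u v => adj G (val u) (val v).

Lemma induced_sym : symmetric induced_adj.
Proof. by move=> u v; apply: adj_sym. Qed.

Lemma induced_irr : irreflexive induced_adj.
Proof. by move=> u; apply: adj_irr. Qed.

Definition induced : sgraph {x : V | x \in X} := SGraph induced_sym induced_irr.

End Induced.

Definition graph_property := forall V : finType, sgraph V -> Prop.

(* "Hamiltonian" asks for a Hamiltonian path, not for a Hamiltonian cycle. *)
Definition Hamiltonian : graph_property := fun V G =>
  exists (x : V) (p : seq V),
    [/\ path (adj G) x p, uniq (x :: p) & forall v, v \in x :: p].

Record ml_instance := MLInstance {
  ml_n : nat;
  ml_t : nat;
  ml_layer : 'I_ml_t -> sgraph 'I_ml_n;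
  ml_k : nat;
  ml_l : nat
}.

Definition ml_yes (Pi : graph_property) (I : ml_instance) : Prop :=
  exists2 X : {set 'I_(ml_n I)}, ml_k I <= #|X| &
  exists2 S : {set 'I_(ml_t I)}, ml_l I <= #|S| &
    forall i, i \in S -> Pi _ (induced (ml_layer i) X).

(* The layers are given by their adjacency matrices. *)
Definition code_ml (I : ml_instance) : word :=
  code_nats [:: ml_n I, ml_t I, ml_k I, ml_l I
    & flatten [seq flatten [seq [seq nat_of_bool (ml_layer i u v)
                                | v <- enum 'I_(ml_n I)]
                           | u <- enum 'I_(ml_n I)]
              | i <- enum 'I_(ml_t I)]].

(* Pi-ML-Subgraph restricted to inputs with [t] layers and threshold [l],
   parameterized by [k]. *)
Definition ml_subgraph_by_k (Pi : graph_property) (l t : nat) : param_problem :=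
  fun w k => exists I : ml_instance,
    [/\ w = code_ml I, ml_t I = t /\ ml_l I = l, ml_k I = k,
        0 < ml_k I /\ 0 < ml_l I & ml_yes Pi I].

Definition ml_subgraph (Pi : graph_property) (l t : nat) : problem :=
  fun w => exists k, ml_subgraph_by_k Pi l t w k.

(* Main.v *)
(** Both reductions go through binary constraint satisfaction: [K] variables
    with values below [D] and a relation between every two of them.

    A constraint instance becomes two layers on the same vertices, which are
    arranged in levels. For each pair [p = (i, j)] of variables there are two
    levels of vertices carrying a pair of values, placed between separator
    levels with a single usable vertex. In the first layer consecutive levels
    are joined, and the two levels of [p] by a perfect matching of the admitted
    pairs of values; a path with as many vertices as there are levels then
    visits each level once. Given this, the second layer, which visits the
    levels in another order, is connected only if the pairs agree along the
    rows [i] and along the columns [j], i.e. come from one assignment.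

    NP-hardness: the tableau of the verifier is such an instance, one variable
    for each time and position, with all constraints between two cells.

    W[1]-hardness: a weight-[k] assignment of the inputs of a circuit is given
    by [k + 1] segments between consecutive true inputs. Below a large gate a
    wire depends on at most [2 ^ d] inputs, so a false claim about it is refuted
    by some [2 ^ d] segments. The variables are the tuples of [2 ^ d] segment
    numbers; a value holds the end points of these segments and a guess of the
    existential choices at and above the large gates.

    All functions involved are built by bounded iteration from the reading of
    input bits, and have values polynomial in the length of the input and in
    [k]; such functions are computed by programs on unary counters, which are
    compiled to Turing machines. *)
Require Import Defs.
From mathcomp Require Import all_boot zify.
From Stdlib Require Import FunctionalExtensionality.
Set Implicit Arguments.
Unset Strict Implicit.
Unset Printing Implicit Defensive.

(** * Programs on stacks and their compilation to Turing machines *)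

(** Both hardness results share one graph construction because the new parameter, the number of
    levels, depends on [K] alone. NP-hardness takes [D] constant and [K] polynomial; W[1]-hardness
    takes [K] bounded in the old parameter and lets [D] grow with the input. The obstacle in the
    first layer is a path that turns back at a separator. It then runs down through a second copy of
    the preceding pair of levels and is stuck, since the separator below is already used. For this
    the path must have started low and must be long enough to be followed to the dead end. Four
    single levels at the top give the length. With [h] levels at the top, a path avoiding the bottom
    ones has at most [3 * (K * K + h) + 2] vertices, so more than [2 * h + 2] bottom levels are
    needed; 12 is the first multiple of 3 above 10. Segments are used instead of the true inputs
    themselves because a claim may rest on inputs being false, and a segment shows this for every
    input strictly inside it. One guess is shared by all variables, so that refutations by different
    small sets of inputs concern the same claims. *)

Definition store := nat -> word.
Definition upd (s : store) r w : store := fun i => if i == r then w else s i.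

Inductive cmd :=
  | Skip
  | Push of nat & bool
  | Pop of nat
  | Seq of cmd & cmd
  | Ite of nat & pred (option bool) & cmd & cmd
  | While of nat & pred (option bool) & cmd.

(** The counter is the exact number of machine steps after compilation: a push first moves off the
    scanned cell and then writes, and every test costs one step. *)
Inductive exec : cmd -> store -> nat -> store -> Prop :=
  | ExSkip s : exec Skip s 1 s
  | ExPush r b s : exec (Push r b) s 2 (upd s r (b :: s r))
  | ExPop r s : exec (Pop r) s 1 (upd s r (behead (s r)))
  | ExSeq c1 c2 s n1 s1 n2 s2 :
      exec c1 s n1 s1 -> exec c2 s1 n2 s2 -> exec (Seq c1 c2) s (n1 + n2) s2
  | ExIteT r (p : pred (option bool)) c1 c2 s n s' :
      p (ohead (s r)) -> exec c1 s n s' -> exec (Ite r p c1 c2) s n.+1 s'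
  | ExIteF r (p : pred (option bool)) c1 c2 s n s' :
      ~~ p (ohead (s r)) -> exec c2 s n s' -> exec (Ite r p c1 c2) s n.+1 s'
  | ExWhileF r (p : pred (option bool)) c s :
      ~~ p (ohead (s r)) -> exec (While r p c) s 1 s
  | ExWhileT r (p : pred (option bool)) c s n1 s1 n2 s2 :
      p (ohead (s r)) -> exec c s n1 s1 -> exec (While r p c) s1 n2 s2 ->
      exec (While r p c) s (n1 + n2).+1 s2.

Fixpoint reg_bound (c : cmd) : nat :=
  match c with
  | Skip => 0
  | Push r _ => r.+1
  | Pop r => r.+1
  | Seq c1 c2 => maxn (reg_bound c1) (reg_bound c2)
  | Ite r _ c1 c2 => maxn r.+1 (maxn (reg_bound c1) (reg_bound c2))
  | While r _ c => maxn r.+1 (reg_bound c)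
  end.

(** * Compilation of stack programs into control graphs on tapes *)

Section Compile.
Variables (N : nat) (E : finType).

Local Notation heads_t := {ffun 'I_N -> symbol E}.
Local Notation acts_t := {ffun 'I_N -> symbol E * move}.
Local Notation tapes_t := {ffun 'I_N -> tape E}.

(* A flow machine leaves its control graph with the target state [None]. *)
Record flow := Flow {
  flow_state : finType;
  flow_entry : flow_state;
  flow_trans : flow_state -> heads_t -> option flow_state * acts_t
}.

Definition bit_of (x : symbol E) : option bool :=
  if x is Some (inl b) then Some b else None.

Definition head_at (h : heads_t) r : symbol E :=
  if insub r is Some i then h i else None.

Definition idle (h : heads_t) : acts_t := [ffun i => (h i, Stay)].

Definition act_at r (a : symbol E -> symbol E * move) (h : heads_t) : acts_t :=
  [ffun i => if val i == r then a (h i) else (h i, Stay)].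

(** The popped cell is blanked, so that the cells left of the head stay blank. Popping an empty
    stack leaves the head in place. *)
Definition pop_act (x : symbol E) : symbol E * move :=
  if x is Some (inl _) then (None, MoveR) else (x, Stay).

Definition seq_trans (f1 f2 : flow) (q : flow_state f1 + flow_state f2)
    (h : heads_t) : option (flow_state f1 + flow_state f2) * acts_t :=
  match q with
  | inl q1 => let oa := flow_trans q1 h in
      (Some (if oa.1 is Some q' then inl q' else inr (flow_entry f2)), oa.2)
  | inr q2 => let oa := flow_trans q2 h in (omap inr oa.1, oa.2)
  end.

Definition ite_trans r (p : pred (option bool)) (f1 f2 : flow)
    (q : unit + (flow_state f1 + flow_state f2)) (h : heads_t) :
    option (unit + (flow_state f1 + flow_state f2)) * acts_t :=
  match q with
  | inl _ => (Some (inr (if p (bit_of (head_at h r)) then inl (flow_entry f1)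
                         else inr (flow_entry f2))), idle h)
  | inr (inl q1) => let oa := flow_trans q1 h in
      (omap (fun q => inr (inl q)) oa.1, oa.2)
  | inr (inr q2) => let oa := flow_trans q2 h in
      (omap (fun q => inr (inr q)) oa.1, oa.2)
  end.

Definition while_trans r (p : pred (option bool)) (f : flow)
    (q : option (flow_state f)) (h : heads_t) :
    option (option (flow_state f)) * acts_t :=
  match q with
  | None => (if p (bit_of (head_at h r)) then Some (Some (flow_entry f))
             else None, idle h)
  | Some q1 => let oa := flow_trans q1 h in (Some oa.1, oa.2)
  end.

Fixpoint compile (c : cmd) : flow :=
  match c with
  | Skip => @Flow unit tt (fun _ h => (None, idle h))
  | Push r b => @Flow bool false (fun q h =>
      if q then (None, act_at r (fun=> (Some (inl b), Stay)) h)
      else (Some true, act_at r (fun x => (x, MoveL)) h))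
  | Pop r => @Flow unit tt (fun _ h => (None, act_at r pop_act h))
  | Seq c1 c2 => @Flow (flow_state (compile c1) + flow_state (compile c2))%type
      (inl (flow_entry (compile c1))) (@seq_trans _ _)
  | Ite r p c1 c2 =>
      @Flow (unit + (flow_state (compile c1) + flow_state (compile c2)))%type
      (inl tt) (@ite_trans r p _ _)
  | While r p c => @Flow (option (flow_state (compile c))) None
      (@while_trans r p _)
  end.

Definition heads (tp : tapes_t) : heads_t := [ffun i => tape_head (tp i)].
Definition act (a : acts_t) (tp : tapes_t) : tapes_t :=
  [ffun i => tape_step (tp i) (a i)].

Inductive flow_run (f : flow) : flow_state f -> tapes_t -> nat -> tapes_t -> Prop :=
  | FlowExit q tp a :
      flow_trans q (heads tp) = (None, a) -> flow_run q tp 1 (act a tp)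
  | FlowStep q tp q' a n tp' :
      flow_trans q (heads tp) = (Some q', a) ->
      flow_run q' (act a tp) n tp' -> flow_run q tp n.+1 tp'.

Lemma act_idle tp : act (idle (heads tp)) tp = tp.
Proof. by apply/ffunP => i; rewrite !ffunE /=; case: (tp i). Qed.

Lemma flow_run_seql c1 c2 (q : flow_state (compile c1)) tp n1 tp1 n2 tp2 :
  flow_run q tp n1 tp1 ->
  @flow_run (compile (Seq c1 c2)) (inr (flow_entry (compile c2))) tp1 n2 tp2 ->
  @flow_run (compile (Seq c1 c2)) (inl q) tp (n1 + n2) tp2.
Proof.
elim=> {q tp n1 tp1} [q tp a E1|q tp q' a n tp' E1 _ IH] H2; rewrite addSn.
  by rewrite add0n; apply: FlowStep H2; rewrite /= E1.
by apply: FlowStep (IH H2); rewrite /= E1.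
Qed.

Lemma flow_run_map (f g : flow) (j : flow_state f -> flow_state g) :
  (forall q h, flow_trans (j q) h =
     (omap j (flow_trans q h).1, (flow_trans q h).2)) ->
  forall q tp n tp', flow_run q tp n tp' -> flow_run (j q) tp n tp'.
Proof.
move=> Ej q tp n tp'; elim=> {q tp n tp'} [q tp a E1|q tp q' a n tp' E1 _ IH].
  by apply: FlowExit; rewrite Ej E1.
by apply: FlowStep IH; rewrite Ej E1.
Qed.

Lemma flow_run_while r p c (q : flow_state (compile c)) tp n1 tp1 n2 tp2 :
  flow_run q tp n1 tp1 ->
  @flow_run (compile (While r p c)) None tp1 n2 tp2 ->
  @flow_run (compile (While r p c)) (Some q) tp (n1 + n2) tp2.
Proof.
elim=> {q tp n1 tp1} [q tp a E1|q tp q' a n tp' E1 _ IH] H2; rewrite addSn.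
  by rewrite add0n; apply: FlowStep H2; rewrite /= E1.
by apply: FlowStep (IH H2); rewrite /= E1.
Qed.

Variable rho : tape E -> word -> Prop.
Hypothesis rho_head : forall tp w, rho tp w -> bit_of (tape_head tp) = ohead w.
Hypothesis rho_push : forall tp w b, rho tp w ->
  rho (tape_step (tape_step tp (tape_head tp, MoveL)) (Some (inl b), Stay)) (b :: w).
Hypothesis rho_pop : forall tp w, rho tp w ->
  rho (tape_step tp (pop_act (tape_head tp))) (behead w).

Definition represents (s : store) (tp : tapes_t) :=
  forall i : 'I_N, rho (tp i) (s i).

Lemma bit_of_head_at s tp r : represents s tp -> r < N ->
  bit_of (head_at (heads tp) r) = ohead (s r).
Proof.
move=> H lt; rewrite /head_at insubT ffunE.
exact: (rho_head (H (Ordinal lt))).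
Qed.

(** The relation [rho] between tapes and stacks is kept abstract because the result is needed twice:
    for tapes blank outside their word, and for tapes on which another machine has left symbols
    behind. *)
Lemma compile_correct c s n s' : exec c s n s' -> reg_bound c <= N ->
  forall tp, represents s tp ->
  exists2 tp', represents s' tp' & flow_run (flow_entry (compile c)) tp n tp'.
Proof.
elim=> {c s n s'}.
- move=> s _ tp H; exists tp => //.
  by rewrite -{2}(act_idle tp); apply: FlowExit.
- move=> r b s /= lt tp H.
  set tp1 := act (act_at r (fun x => (x, MoveL)) (heads tp)) tp.
  exists (act (act_at r (fun=> (Some (inl b), Stay)) (heads tp1)) tp1).
    move=> i; rewrite !ffunE /upd; case: (val i =P r) => [<-|_].
      exact: rho_push.
    have -> : forall t : tape E, tape_step t (tape_head t, Stay) = t by case.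
    by case: (tp i) (H i).
  by apply: FlowStep; [|apply: FlowExit].
- move=> r s /= lt tp H; exists (act (act_at r pop_act (heads tp)) tp); last first.
    exact: FlowExit.
  move=> i; rewrite !ffunE /upd; case: (val i =P r) => [<-|_]; first exact: rho_pop.
  by case: (tp i) (H i).
- move=> c1 c2 s n1 s1 n2 s2 _ IH1 _ IH2 /=; rewrite geq_max => /andP[b1 b2] tp H.
  have [tp1 H1 R1] := IH1 b1 _ H; have [tp2 H2 R2] := IH2 b2 _ H1.
  exists tp2 => //; apply: flow_run_seql R1 _.
  exact: (@flow_run_map (compile c2) (compile (Seq c1 c2)) inr).
- move=> r p c1 c2 s n s' pr _ IH /=; rewrite !geq_max => /and3P[lt b1 b2] tp H.
  have [tp1 H1 R1] := IH b1 _ H; exists tp1 => //.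
  apply: (@FlowStep (compile (Ite r p c1 c2)) (inl tt) tp
            (inr (inl (flow_entry (compile c1)))) (idle (heads tp))).
    by rewrite /= (bit_of_head_at H) // pr.
  rewrite act_idle.
  exact: (@flow_run_map (compile c1) (compile (Ite r p c1 c2)) (fun q => inr (inl q))).
- move=> r p c1 c2 s n s' pr _ IH /=; rewrite !geq_max => /and3P[lt b1 b2] tp H.
  have [tp1 H1 R1] := IH b2 _ H; exists tp1 => //.
  apply: (@FlowStep (compile (Ite r p c1 c2)) (inl tt) tp
            (inr (inr (flow_entry (compile c2)))) (idle (heads tp))).
    by rewrite /= (bit_of_head_at H) // (negbTE pr).
  rewrite act_idle.
  exact: (@flow_run_map (compile c2) (compile (Ite r p c1 c2)) (fun q => inr (inr q))).
- move=> r p c s pr /=; rewrite geq_max => /andP[lt b1] tp H; exists tp => //.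
  rewrite -{2}(act_idle tp).
  apply: (@FlowExit (compile (While r p c)) None tp).
  by rewrite /= (bit_of_head_at H) // (negbTE pr).
- move=> r p c s n1 s1 n2 s2 pr _ IH1 _ IH2 /= b.
  have /andP[lt b1] : (r < N) && (reg_bound c <= N) by rewrite -geq_max.
  move=> tp H; have [tp1 H1 R1] := IH1 b1 _ H; have [tp2 H2 R2] := IH2 b _ H1.
  exists tp2 => //.
  apply: (@FlowStep (compile (While r p c)) None tp
            (Some (flow_entry (compile c))) (idle (heads tp))).
    by rewrite /= (bit_of_head_at H) // pr.
  by rewrite act_idle; apply: flow_run_while R1 R2.
Qed.

End Compile.

(** * Two ways in which a tape holds a stack *)

Section TapeRelations.
Variable E : finType.
Implicit Types (tp : tape E) (w : word).

(** Arbitrary symbols may remain left of the head and after the word; this is all that is known of a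
    tape once a given machine has halted. *)
Definition shows tp w := word_of_tape tp = w.

Lemma shows_head tp w : shows tp w -> bit_of (tape_head tp) = ohead w.
Proof. by rewrite /shows /word_of_tape => <-; case: tp => l [[b|e]|] r. Qed.

Lemma shows_push tp w b : shows tp w ->
  shows (tape_step (tape_step tp (tape_head tp, MoveL)) (Some (inl b), Stay)) (b :: w).
Proof. by rewrite /shows => <-; case: tp => l h r. Qed.

Lemma shows_pop tp w : shows tp w ->
  shows (tape_step tp (pop_act (tape_head tp))) (behead w).
Proof. by rewrite /shows => <-; case: tp => l [[b|e]|] [|h r]. Qed.

Definition cell_bit (b : bool) : symbol E := Some (inl b).

(** Everything outside the word is blank, as a machine expects of its input tapes. *)
Definition clean tp w :=
  (forall i, nth None (tape_left tp) i = None) /\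
  (forall i, nth None (tape_head tp :: tape_right tp) i =
             nth None (map cell_bit w) i).

Lemma clean_of_word w : clean (tape_of_word E w) w.
Proof. by split=> [i|i]; [rewrite nth_nil|case: w => [|b w]; case: i => //= i; rewrite nth_nil]. Qed.

Lemma clean_head tp w : clean tp w -> bit_of (tape_head tp) = ohead w.
Proof. by case=> _ /(_ 0) /= ->; case: w. Qed.

Lemma clean_push tp w b : clean tp w ->
  clean (tape_step (tape_step tp (tape_head tp, MoveL)) (Some (inl b), Stay)) (b :: w).
Proof.
case: tp => l h r [/= H1 H2]; split=> /= i; first by rewrite nth_behead.
by case: i => //= i; apply: H2.
Qed.

Lemma clean_pop tp w : clean tp w ->
  clean (tape_step tp (pop_act (tape_head tp))) (behead w).
Proof.
case: tp => l h r [/= H1 H2]; case: w H2 => [|b w] H2.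
  by have /= -> := H2 0; split=> //= i; have := H2 i; case: i => //=; rewrite (H2 0).
have /= -> := H2 0; split=> /= i; first by case: i.
by have := H2 i.+1; case: (r) => [|y r'] /= <-; case: i => //= i; rewrite nth_nil.
Qed.

(** Equality up to trailing blanks, which the lists of a tape distinguish although no machine
    can. *)
Definition tape_eqv tp1 tp2 :=
  (forall i, nth None (tape_left tp1) i = nth None (tape_left tp2) i) /\
  (forall i, nth None (tape_head tp1 :: tape_right tp1) i =
             nth None (tape_head tp2 :: tape_right tp2) i).

Lemma clean_eqv tp1 tp2 w : clean tp1 w -> clean tp2 w -> tape_eqv tp1 tp2.
Proof. by case=> a b [c d]; split=> i; rewrite ?a ?c ?b ?d. Qed.

Lemma tape_eqv_step tp1 tp2 a : tape_eqv tp1 tp2 ->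
  tape_eqv (tape_step tp1 a) (tape_step tp2 a).
Proof.
case: tp1 tp2 a => l h r [l' h' r'] [x []] [/= H1 H2]; split=> /= i.
- by rewrite !nth_behead.
- case: i => [|[|i]] //=; first by rewrite -!nth0.
  by have := H2 i.+1.
- exact: H1.
- by case: i => [|i] //; have := H2 i.+1.
- by case: i => [|i] /=.
- case: i => [|i] /=; first by rewrite -!nth0; have := H2 1.
  by rewrite !nth_behead; have := H2 i.+2.
Qed.

Lemma leading_bits_eqv (s1 s2 : seq (symbol E)) :
  (forall i, nth None s1 i = nth None s2 i) -> leading_bits s1 = leading_bits s2.
Proof.
elim: s1 s2 => [|x s1 IH] [|y s2] H //=.
- by have /= <- := H 0.
- by have /= -> := H 0.
have /= <- := H 0; case: x H => [[b|e]|] H //.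
by rewrite (IH s2) // => i; have := H i.+1.
Qed.

Lemma word_of_tape_eqv tp1 tp2 : tape_eqv tp1 tp2 ->
  word_of_tape tp1 = word_of_tape tp2.
Proof. by case=> _; apply: leading_bits_eqv. Qed.

Lemma word_of_tape_clean tp w : clean tp w -> word_of_tape tp = w.
Proof.
move=> H; rewrite (word_of_tape_eqv (clean_eqv H (clean_of_word w))).
by rewrite /word_of_tape /=; case: w {H} => //= b w; congr cons; elim: w => //= c w ->.
Qed.

End TapeRelations.

Lemma iter_halted (M : tm) n (c : config M) :
  tm_halt c.1 -> iter n (@tm_step M) c = c.
Proof. by move=> h; elim: n => //= n ->; rewrite /tm_step h. Qed.

Lemma computes_withinP (M : tm) ins outs T :
  let c := iter T (@tm_step M) (tm_init M ins) in
  computes_within M ins outs T <->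
  [/\ tm_halt c.1, size outs <= tm_tapes M &
      forall i : 'I_(tm_tapes M), i < size outs ->
        word_of_tape (c.2 i) = nth [::] outs i].
Proof.
rewrite /computes_within; set c := iter _ _ _; set s := [seq _ | _ <- _].
have szs : size s = tm_tapes M by rewrite size_map size_enum_ord.
have nths (i : 'I_(tm_tapes M)) : nth [::] s i = word_of_tape (c.2 i).
  by rewrite (nth_map i) ?size_enum_ord // nth_ord_enum.
split=> [[h e]|[h le e]]; split=> //.
- by move: (congr1 size e); rewrite size_take szs; case: ltnP; lia.
- by move=> i lt; rewrite -nths -e nth_take.
- apply: (@eq_from_nth _ [::]) => [|i].
    by rewrite size_takel ?szs.
  rewrite size_takel ?szs // => lti.
  rewrite nth_take //; have ltt : i < tm_tapes M by lia.
  by rewrite (nths (Ordinal ltt)) e.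
Qed.

Lemma computes_within_le (M : tm) ins outs T T' :
  T <= T' -> computes_within M ins outs T -> computes_within M ins outs T'.
Proof.
move=> le [h e]; rewrite -(subnK le) /computes_within iterD.
by rewrite iter_halted.
Qed.

Lemma computes_within_prefix (M : tm) ins outs T m :
  computes_within M ins outs T -> computes_within M ins (take m outs) T.
Proof.
move=> /computes_withinP[h le e]; apply/computes_withinP; split=> //.
  by rewrite (leq_trans _ le) // size_take_min geq_minr.
move=> i; rewrite size_take_min leq_min => /andP[lt1 lt2].
by rewrite nth_take ?e.
Qed.

(** * Running a given machine between two compiled programs *)

Section Sequence.
Variables (M : tm) (N : nat) (c0 c1 : cmd).
Local Notation E := (tm_extra M).
Local Notation mt := (tm_tapes M).
Hypothesis le_N : mt.+2 <= N.

(** The tapes of [M] are shifted by two: tapes 0 and 1 carry the inputs and outputs of the combined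
    machine. *)
Definition sub_tape (i : 'I_N) : option 'I_mt :=
  if 2 <= i then insub (i - 2) else None.

Definition seqtm_state : finType :=
  (flow_state (compile N E c0) +
    (tm_state M + option (flow_state (compile N E c1))))%type.

Definition seqtm_trans (q : seqtm_state) (h : {ffun 'I_N -> symbol E}) :
    seqtm_state * {ffun 'I_N -> symbol E * move} :=
  match q with
  | inl q0 => let oa := flow_trans q0 h in
      (if oa.1 is Some q' then inl q' else inr (inl (tm_start M)), oa.2)
  | inr (inl qm) =>
      if tm_halt qm then (inr (inr (Some (flow_entry _))), idle h) else
      let qa := tm_trans qm [ffun j : 'I_mt => head_at h j.+2] in
      (inr (inl qa.1),
       [ffun i => if sub_tape i is Some j then qa.2 j else (h i, Stay)])
  | inr (inr (Some q1)) => let oa := flow_trans q1 h in (inr (inr oa.1), oa.2)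
  | inr (inr None) => (q, idle h)
  end.

Definition seqtm : tm :=
  @TM N E seqtm_state (inl (flow_entry _))
    (fun q => if q is inr (inr None) then true else false) seqtm_trans.

Lemma seqtm_phase0 (q : flow_state (compile N E c0)) tp n tp' :
  flow_run q tp n tp' ->
  iter n (@tm_step seqtm) (inl q, tp) = (inr (inl (tm_start M)), tp').
Proof.
elim=> {q tp n tp'} [q tp a e|q tp q' a n tp' e _ IH].
  by rewrite /= /tm_step /= -/(heads tp) e.
by rewrite iterSr /tm_step /= -/(heads tp) e.
Qed.

Lemma seqtm_phase2 (q : flow_state (compile N E c1)) tp n tp' :
  flow_run q tp n tp' ->
  iter n (@tm_step seqtm) (inr (inr (Some q)), tp) = (inr (inr None), tp').
Proof.
elim=> {q tp n tp'} [q tp a e|q tp q' a n tp' e _ IH].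
  by rewrite /= /tm_step /= -/(heads tp) e.
by rewrite iterSr /tm_step /= -/(heads tp) e.
Qed.

Definition mirrors (tp : {ffun 'I_N -> tape E}) (c : config M) :=
  forall (i : 'I_N) (j : 'I_mt), val i = j.+2 -> tape_eqv (tp i) (c.2 j).

Lemma sub_tapeE (i : 'I_N) (j : 'I_mt) : val i = j.+2 -> sub_tape i = Some j.
Proof.
move=> e; rewrite /sub_tape /= e /= subn2 /= insubT //= => lt.
by congr Some; apply: val_inj.
Qed.

(** [M] may halt before time [T], hence only a bound on [n]; the additional step switches to the
    last program with all tapes idle. *)
Lemma seqtm_phase1 T (c : config M) tp :
  mirrors tp c -> tm_halt (iter T (@tm_step M) c).1 ->
  exists n tp', [/\ n <= T.+1,
    iter n (@tm_step seqtm) (inr (inl c.1), tp) =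
      (inr (inr (Some (flow_entry _))), tp'),
    mirrors tp' (iter T (@tm_step M) c) &
    forall i, sub_tape i = None -> tp' i = tp i].
Proof.
elim: T c tp => [|T IH] c tp Hm h.
  exists 1, tp; split=> //=; rewrite /tm_step /= h /=; congr pair.
  exact: (act_idle tp).
case hc : (tm_halt c.1).
  exists 1, tp; split=> //; last by rewrite iter_halted.
  rewrite /tm_step /= hc /=; congr pair; exact: (act_idle tp).
pose c' := tm_step c.
pose tp' := (tm_step (M := seqtm) (inr (inl c.1), tp)).2.
have Ehd : [ffun j : 'I_mt => head_at (heads tp) j.+2] =
           [ffun j => tape_head (c.2 j)].
  apply/ffunP => j; rewrite !ffunE /head_at.
  have lt : j.+2 < N by have := ltn_ord j; lia.
  rewrite insubT ffunE; have [_ /(_ 0)] := Hm (Ordinal lt) j erefl; exact.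
have E1 : tm_step (M := seqtm) (inr (inl c.1), tp) = (inr (inl c'.1), tp').
  by rewrite /tp' /c' /tm_step /= hc /= -/(heads tp) Ehd.
have Hm' : mirrors tp' c'.
  move=> i j e; rewrite /tp' /c' /tm_step /= hc /= !ffunE (sub_tapeE e).
  rewrite -/(heads tp) Ehd; apply: tape_eqv_step; exact: Hm.
rewrite iterSr -/c' in h *.
have [n [tp2 [le e2 m2 k2]]] := IH c' tp' Hm' h.
exists n.+1, tp2; split=> //.
  by rewrite iterSr E1.
move=> i ei; rewrite k2 // /tp' /tm_step /= hc /= !ffunE ei /=.
by case: (tp i).
Qed.

(** The first program keeps the tapes [clean], so [M] runs as on genuine input tapes. Afterwards
    only [shows] is available, and the last program is correct under that weaker relation. *)
Lemma seqtm_correct ins ins' outs' outs T t0 t1 s1 :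
  reg_bound c0 <= N -> reg_bound c1 <= N -> size outs <= N ->
  exec c0 (nth [::] ins) t0 s1 ->
  (forall j, j < mt -> s1 j.+2 = nth [::] ins' j) ->
  computes_within M ins' outs' T ->
  (forall s2 : store,
    (forall r, (r < 2) || (mt.+2 <= r) -> s2 r = s1 r) ->
    (forall j, j < size outs' -> s2 j.+2 = nth [::] outs' j) ->
    exists n s3, [/\ n <= t1, exec c1 s2 n s3 &
      forall i, i < size outs -> s3 i = nth [::] outs i]) ->
  computes_within seqtm ins outs (t0 + T.+1 + t1).
Proof.
move=> b0 b1 leo X0 E1 /computes_withinP[hM sM oM] X1.
have R0 : represents (@clean E) (nth [::] ins) (tm_init seqtm ins).2.
  by move=> i; rewrite ffunE; apply: clean_of_word.
have [tp1 R1 F1] := compile_correct (@clean_head E) (@clean_push E) (@clean_pop E) X0 b0 R0.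
have Hm : mirrors tp1 (tm_init M ins').
  move=> i j e; rewrite ffunE; apply: (clean_eqv (R1 i)).
  by rewrite e E1 //; apply: clean_of_word.
have [n1 [tp2 [le1 e2 m2 k2]]] := seqtm_phase1 Hm hM.
pose s2 : store := fun r => if insub r is Some i then word_of_tape (tp2 i) else s1 r.
have R2 : represents (@shows E) s2 tp2.
  by move=> i; rewrite /shows /s2 valK.
have [r hr|j lt|n3 [s3 [le3 X3 o3]]] := X1 s2.
- rewrite /s2; case: insubP => // i ltr er; rewrite k2.
    by rewrite (word_of_tape_clean (R1 i)) er.
  rewrite /sub_tape er; case: leqP => // le2; apply: insubN.
  by rewrite -leqNgt; lia.
- have ltm : j < mt by lia.
  have ltN : j.+2 < N by lia.
  rewrite /s2 insubT (word_of_tape_eqv (m2 (Ordinal ltN) (Ordinal ltm) erefl)).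
  by rewrite oM.
have [tp3 R3 F3] := compile_correct (@shows_head E) (@shows_push E) (@shows_pop E) X3 b1 R2.
have Ei : iter (n3 + (n1 + t0)) (@tm_step seqtm) (tm_init seqtm ins) = (inr (inr None), tp3).
  rewrite !iterD [tm_init _ _]surjective_pairing /= (seqtm_phase0 F1).
  by rewrite e2 (seqtm_phase2 F3).
apply: (@computes_within_le _ _ _ (n3 + (n1 + t0))); first lia.
apply/computes_withinP; rewrite Ei; split=> // i lt /=.
by rewrite -o3 //; apply: R3.
Qed.

End Sequence.

(** * Output length against running time *)

Section OutputSize.
Variable E : finType.

Definition nonblank (tp : tape E) : nat :=
  count isSome (tape_left tp) + isSome (tape_head tp) + count isSome (tape_right tp).

Lemma nonblank_step tp a : nonblank (tape_step tp a) <= (nonblank tp).+1.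
Proof.
case: tp a => l h r [x []]; rewrite /nonblank /=.
- by case: l => [|y l] /=; case: x => [z|] /=; lia.
- by case: x => [z|] /=; lia.
- by case: r => [|y r] /=; case: x => [z|] /=; lia.
Qed.

Lemma size_word_of_tape (tp : tape E) : size (word_of_tape tp) <= nonblank tp.
Proof.
have H (s : seq (symbol E)) : size (leading_bits s) <= count isSome s.
  by elim: s => [|[[b|e]|] s IH] //=; lia.
by have := H (tape_head tp :: tape_right tp); rewrite /word_of_tape /nonblank /=; lia.
Qed.

Lemma nonblank_of_word w : nonblank (tape_of_word E w) = size w.
Proof.
rewrite /nonblank; case: w => [|b w] //=; rewrite count_map add0n add1n.
by congr S; apply/eqP; rewrite -all_count; apply/allP.
Qed.
End OutputSize.

(** A step creates at most one nonblank cell. The bound is needed when a second computation runs on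
    the output of a parameterized reduction. *)
Lemma size_output M ins outs T j : computes_within M ins outs T ->
  size (nth [::] outs j) <= size (nth [::] ins j) + T.
Proof.
move=> /computes_withinP[_ le e].
have [lt|/(nth_default [::]) -> //] := ltnP j (size outs).
have lt' : j < tm_tapes M by lia.
rewrite -(e (Ordinal lt') lt); apply: leq_trans (size_word_of_tape _) _.
elim: T {e} => [|T IH]; first by rewrite ffunE nonblank_of_word addn0.
rewrite iterS {1}/tm_step; case: ifP => _; first lia.
by rewrite ffunE; apply: leq_trans (nonblank_step _ _) _; lia.
Qed.

(** * Functions computed by polynomial-time counter programs *)

Definition execle c s t s' := exists2 n, n <= t & exec c s n s'.

Lemma execle_le c s t t' s' : t <= t' -> execle c s t s' -> execle c s t' s'.
Proof. by move=> le [n len X]; exists n => //; apply: leq_trans le. Qed.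

Lemma execle_seq c1 c2 s t1 s1 t2 s2 :
  execle c1 s t1 s1 -> execle c2 s1 t2 s2 -> execle (Seq c1 c2) s (t1 + t2) s2.
Proof. by move=> [n1 l1 X1] [n2 l2 X2]; exists (n1 + n2); [lia|apply: ExSeq X1 X2]. Qed.

Lemma execle_while r (p : pred (option bool)) c (S : nat -> store) n L :
  (forall i, i < n -> p (ohead (S i r)) /\ execle c (S i) L (S i.+1)) ->
  ~~ p (ohead (S n r)) -> execle (While r p c) (S 0) (n * L.+1 + 1) (S n).
Proof.
elim: n S => [|n IH] S H Hn; first by exists 1 => //; apply: ExWhileF.
have [p0 [n1 l1 X1]] := H 0 isT.
have [i lt|//|n2 l2 X2] := IH (fun i => S i.+1); first exact: H.
by exists (n1 + n2).+1; [nia|apply: ExWhileT X1 X2].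
Qed.

Definition upn (u : nat -> nat) i k : nat -> nat := fun j => if j == i then k else u j.

Definition ctr b i : nat := b.+2 + i.

(* Registers below [b] belong to [o]; [x] and [y] are the input stack and the
   stack receiving its popped prefix; the other registers are unary counters. *)
Definition st b (o : store) (x y : word) (u : nat -> nat) : store := fun r =>
  if r < b then o r else if r == b then x else if r == b.+1 then y
  else nseq (u (r - b.+2)) true.

Section St.
Variables (b : nat) (o : store) (x y : word).
Implicit Type u : nat -> nat.

Lemma st_ctr u i : st b o x y u (ctr b i) = nseq (u i) true.
Proof.
rewrite /st /ctr !ifF; first by congr nseq; congr u; lia.
all: by apply/negP; lia.
Qed.

Lemma st_x u : st b o x y u b = x.
Proof. by rewrite /st ltnn eqxx. Qed.

Lemma st_y u : st b o x y u b.+1 = y.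
Proof. by rewrite /st ltnNge leqnSn /= gtn_eqF // eqxx. Qed.

Lemma upd_ctr u i k :
  upd (st b o x y u) (ctr b i) (nseq k true) = st b o x y (upn u i k).
Proof.
apply: functional_extensionality => r; rewrite /upd /st /ctr /upn.
case: eqP => [->|ne].
  have -> : b.+2 + i < b = false by lia.
  have -> : (b.+2 + i == b) = false by lia.
  have -> : (b.+2 + i == b.+1) = false by lia.
  by rewrite addKn eqxx.
do 3!case: ifP => // ?.
by rewrite ifF //; apply/negP; lia.
Qed.

Lemma upd_x u x' : upd (st b o x y u) b x' = st b o x' y u.
Proof.
apply: functional_extensionality => r; rewrite /upd /st.
by case: eqP => [->|ne] //; rewrite ltnn.
Qed.

Lemma upd_y u y' : upd (st b o x y u) b.+1 y' = st b o x y' u.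
Proof.
apply: functional_extensionality => r; rewrite /upd /st.
by case: eqP => [->|ne] //; rewrite ltnNge leqnSn /= gtn_eqF.
Qed.

Lemma upd_low u r w : r < b -> upd (st b o x y u) r w = st b (upd o r w) x y u.
Proof.
move=> lt; apply: functional_extensionality => i; rewrite /upd /st.
by case: eqP => [->|ne] //; rewrite lt.
Qed.

Lemma st_low u r : r < b -> st b o x y u r = o r.
Proof. by rewrite /st => ->. Qed.
End St.

Lemma upn_same u i k : u i = k -> upn u i k = u.
Proof.
by move=> e; apply: functional_extensionality => j; rewrite /upn; case: eqP => // ->.
Qed.

Lemma ohead_nseq n : isSome (ohead (nseq n true)) = (0 < n).
Proof. by case: n. Qed.

Ltac upn_eq := apply: functional_extensionality => ?; rewrite /upn;
  repeat (case: eqP => ?); subst; try congruence; try lia.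

Section Macros.
Variables (b : nat) (o : store) (x y : word).
Implicit Type u : nat -> nat.
Local Notation S u := (st b o x y u).

Definition inc i := Push (ctr b i) true.
Definition dec i := Pop (ctr b i).
Definition loop i c := While (ctr b i) isSome c.

Lemma inc_ok u i : execle (inc i) (S u) 2 (S (upn u i (u i).+1)).
Proof. by exists 2 => //; rewrite -upd_ctr /= -(st_ctr b o x y); apply: ExPush. Qed.

Lemma dec_ok u i : execle (dec i) (S u) 1 (S (upn u i (u i).-1)).
Proof.
exists 1 => //; rewrite -upd_ctr.
have -> : nseq (u i).-1 true = behead (S u (ctr b i)) by rewrite st_ctr; case: (u i).
exact: ExPop.
Qed.

Definition clear_ctr i := loop i (dec i).
Lemma clear_ctr_ok u i : execle (clear_ctr i) (S u) (u i * 2 + 1) (S (upn u i 0)).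
Proof.
have := @execle_while (ctr b i) isSome (dec i) (fun j => S (upn u i (u i - j))) (u i) 1.
rewrite subn0 subnn (@upn_same u i (u i)) //; apply=> [j lt|]; rewrite st_ctr ohead_nseq /upn eqxx //.
split; first lia.
have -> : (fun j0 => if j0 == i then u i - j.+1 else u j0) =
          upn (upn u i (u i - j)) i (upn u i (u i - j) i).-1 by upn_eq.
exact: dec_ok.
Qed.

Definition move_ctr i j := loop i (Seq (dec i) (inc j)).
Lemma move_ctr_ok u i j : i != j ->
  execle (move_ctr i j) (S u) (u i * 4 + 1) (S (upn (upn u j (u j + u i)) i 0)).
Proof.
move=> /eqP ne.
have := @execle_while (ctr b i) isSome (Seq (dec i) (inc j))
  (fun k => S (upn (upn u j (u j + k)) i (u i - k))) (u i) 3.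
have -> : upn (upn u j (u j + 0)) i (u i - 0) = u by upn_eq.
rewrite subnn; apply=> [k lt|]; rewrite st_ctr ohead_nseq {1}/upn eqxx //.
split; first lia.
apply: (execle_seq (dec_ok _ _) (t2 := 2)).
set v := upn _ _ (_.-1).
have -> : upn (upn u j (u j + k.+1)) i (u i - k.+1) = upn v j (v j).+1 by rewrite /v; upn_eq.
exact: inc_ok.
Qed.

Definition split_ctr i j k := loop i (Seq (dec i) (Seq (inc j) (inc k))).
Lemma split_ctr_ok u i j k : i != j -> i != k -> j != k ->
  execle (split_ctr i j k) (S u) (u i * 6 + 1)
    (S (upn (upn (upn u j (u j + u i)) k (u k + u i)) i 0)).
Proof.
move=> /eqP n1 /eqP n2 /eqP n3.
have := @execle_while (ctr b i) isSome (Seq (dec i) (Seq (inc j) (inc k)))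
  (fun l => S (upn (upn (upn u j (u j + l)) k (u k + l)) i (u i - l))) (u i) 5.
have -> : upn (upn (upn u j (u j + 0)) k (u k + 0)) i (u i - 0) = u by upn_eq.
rewrite subnn; apply=> [l lt|]; rewrite st_ctr ohead_nseq {1}/upn eqxx //.
split; first lia.
apply: (execle_seq (dec_ok _ _) (t2 := 4)).
set v := upn _ _ (_.-1).
apply: (execle_seq (inc_ok _ _) (t2 := 2)).
set w := upn v _ _.
have -> : upn (upn (upn u j (u j + l.+1)) k (u k + l.+1)) i (u i - l.+1)
          = upn w k (w k).+1 by rewrite /w /v; upn_eq.
exact: inc_ok.
Qed.
End Macros.

Definition shift_bit r1 r2 :=
  Seq (Ite r1 (pred1 (Some true)) (Push r2 true)
        (Ite r1 (pred1 (Some false)) (Push r2 false) Skip)) (Pop r1).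

Lemma shift_bit_ok s r1 r2 : r1 != r2 ->
  execle (shift_bit r1 r2) s 5 (upd (upd s r2 (seq.cat (take 1 (s r1)) (s r2))) r1 (behead (s r1))).
Proof.
move=> ne.
have nr w : upd s r2 w r1 = s r1 by rewrite /upd (negbTE ne).
case e : (s r1) => [|c w].
  exists 4 => //; apply: (@ExSeq _ _ _ 3 s 1).
    apply: ExIteF; first by rewrite e.
    by apply: ExIteF; [rewrite e|apply: ExSkip].
  have -> : upd (upd s r2 (seq.cat (take 1 [::]) (s r2))) r1 (behead [::]) = upd s r1 (behead (s r1)).
    apply: functional_extensionality => i; rewrite /upd /= e.
    by case: eqP => // _; case: eqP => // ->.
  exact: ExPop.
rewrite /= take0 /=; have -> : w = behead (upd s r2 (c :: s r2) r1) by rewrite nr e.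
case: c e => e.
  exists 4 => //; apply: (@ExSeq _ _ _ 3 _ 1); last exact: ExPop.
  by apply: ExIteT; [rewrite e|apply: ExPush].
exists 5 => //; apply: (@ExSeq _ _ _ 4 _ 1); last exact: ExPop.
apply: ExIteF; first by rewrite e.
by apply: ExIteT; [rewrite e|apply: ExPush].
Qed.

Definition reverse_onto r1 r2 := While r1 isSome (shift_bit r1 r2).

Lemma reverse_onto_ok s r1 r2 : r1 != r2 ->
  execle (reverse_onto r1 r2) s (size (s r1) * 6 + 1)
    (upd (upd s r2 (seq.cat (rev (s r1)) (s r2))) r1 [::]).
Proof.
move=> ne.
have := @execle_while r1 isSome (shift_bit r1 r2)
  (fun j => upd (upd s r2 (seq.cat (rev (take j (s r1))) (s r2))) r1 (drop j (s r1))) (size (s r1)) 5.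
rewrite take_size drop_size take0 drop0 /=.
have -> : upd (upd s r2 (s r2)) r1 (s r1) = s.
  by apply: functional_extensionality => i; rewrite /upd; case: eqP => [->|_] //; case: eqP => [->|_].
apply=> [j lt|]; last by rewrite /upd eqxx.
split; first by rewrite /upd eqxx (drop_nth false lt).
set s1 := upd _ _ (drop j _).
have -> : upd (upd s r2 (seq.cat (rev (take j.+1 (s r1))) (s r2))) r1 (drop j.+1 (s r1)) =
          upd (upd s1 r2 (seq.cat (take 1 (s1 r1)) (s1 r2))) r1 (behead (s1 r1)).
  have ne' : (r2 == r1) = false by rewrite eq_sym; apply/negbTE.
  apply: functional_extensionality => i; rewrite /s1 /upd !eqxx ne'.
  rewrite (drop_nth false lt) /= take0 (take_nth false lt) rev_rcons /=.
  by case: eqP => //; case: eqP.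
exact: shift_bit_ok.
Qed.

(** * Polynomial bounds for functions of a word and some numbers *)

Lemma leq_exp2 m n c : m <= n -> m ^ c <= n ^ c.
Proof. by case: c => // c le; rewrite leq_exp2r. Qed.

(** A context provides an input word and the numbers in scope; [ext] binds one more number, such as
    a loop index. *)
Record ctx := Ctx { ctx_sort :> Type; cw : ctx_sort -> word; cv : ctx_sort -> seq nat }.
Definition ext (C : ctx) : ctx :=
  @Ctx (C * nat)%type (fun p => cw p.1) (fun p => p.2 :: cv p.1).

Definition sz (C : ctx) (a : C) : nat := size (cw a) + sumn (cv a).
(** The base is at least 2, so that constants and sums are absorbed by raising the exponent. *)
Definition polyb (C : ctx) (f : C -> nat) := exists c, forall a, f a <= (sz a).+2 ^ c.

Section Polyb.
Variable C : ctx.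
Implicit Types f g : C -> nat.

Lemma polyb_le f g : (forall a, f a <= g a) -> polyb g -> polyb f.
Proof. by move=> le [c H]; exists c => a; apply: leq_trans (H a). Qed.

Lemma polyb_sz : polyb (@sz C).
Proof. by exists 1 => a; rewrite expn1; lia. Qed.

Lemma polyb_const k : polyb (fun _ : C => k).
Proof.
exists k => a; apply: leq_trans (_ : 2 ^ k <= _); first exact: ltnW (ltn_expl _ _).
exact: leq_exp2.
Qed.

Lemma polyb_mul f g : polyb f -> polyb g -> polyb (fun a => f a * g a).
Proof. by move=> [c H] [d I]; exists (c + d) => a; rewrite expnD leq_mul. Qed.

Lemma polyb_add f g : polyb f -> polyb g -> polyb (fun a => f a + g a).
Proof.
move=> [c H] [d I]; exists (c + d).+1 => a; rewrite expnS expnD.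
have := H a; have := I a.
have : 0 < (sz a).+2 ^ c by rewrite expn_gt0.
have : 0 < (sz a).+2 ^ d by rewrite expn_gt0.
set A := _ ^ c; set B := _ ^ d; nia.
Qed.

Lemma polyb_exp f k : polyb f -> polyb (fun a => f a ^ k).
Proof.
move=> H; elim: k => [|k IH]; first exact: (polyb_const 1).
by apply: polyb_le (polyb_mul H IH) => a; rewrite expnS.
Qed.
End Polyb.

(** Makes a bound on a loop body uniform in the loop index, provided the index itself is
    polynomially bounded. *)
Lemma polyb_ext (C : ctx) (f : ext C -> nat) (N : C -> nat) :
  polyb f -> polyb N -> exists2 g : C -> nat, polyb g &
    forall a i, i <= N a -> f (a, i) <= g a.
Proof.
move=> [c H] HN; exists (fun a => (sz a + N a + 2) ^ c).
  by apply: polyb_exp; apply: polyb_add (polyb_const _ _); apply: polyb_add HN; apply: polyb_sz.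
move=> a i le; apply: leq_trans (H _) _; apply: leq_exp2.
by rewrite /sz /=; lia.
Qed.

Lemma polyb_wk (C : ctx) (N : C -> nat) : polyb N -> polyb (fun p : ext C => N p.1).
Proof.
move=> [c H]; exists c => -[a i]; apply: leq_trans (H a) _.
by apply: leq_exp2; rewrite /sz /=; lia.
Qed.

(* The program extends the stack of counters, of height [m], by the value. *)
Definition computed_by (C : ctx) (f : C -> nat) b m pos c (t : C -> nat) :=
  forall a o u, (forall i, m <= i -> u i = 0) -> cv a = map u pos ->
  execle c (st b o (cw a) [::] u) (t a) (st b o (cw a) [::] (upn u m (f a))).

(** A program is required for every number [b] of reserved registers, every stack height [m] and
    every placement [pos] of the variables. This lets programs be nested inside loops that keep
    counters of their own. *)
Definition PF (C : ctx) (f : C -> nat) := polyb f /\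
  forall b m (pos : seq nat), all (fun i => i < m) pos ->
  exists c t, polyb t /\ computed_by f b m pos c t.

Lemma map_upn u pos m k : all (fun i => i < m) pos -> map (upn u m k) pos = map u pos.
Proof.
move=> /allP H; apply/eq_in_map => i /H lt; rewrite /upn ifF //.
by apply/negP => /eqP e; rewrite e ltnn in lt.
Qed.

Lemma upn_high u m k : (forall i, m <= i -> u i = 0) ->
  forall i, m.+1 <= i -> upn u m k i = 0.
Proof. by move=> H i le; rewrite /upn gtn_eqF // H //; lia. Qed.

(** * Basic counter programs *)

Section Closure.
Variable C : ctx.
Implicit Types f g : C -> nat.

Lemma PF_polyb f : PF f -> polyb f. Proof. by case. Qed.

Lemma PF_eq f g : f =1 g -> PF f -> PF g.
Proof.
move=> e [H1 H2]; split; first by apply: polyb_le H1 => a; rewrite e.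
move=> b m pos lp; have [c [t [pt X]]] := H2 b m pos lp; exists c, t; split=> // a o u.
by rewrite -e; apply: X.
Qed.

Lemma PF_zero : PF (fun _ : C => 0).
Proof.
split; first exact: polyb_const.
move=> b m pos lp; exists Skip, (fun=> 1); split; first exact: polyb_const.
by move=> a o u hu e; rewrite upn_same ?hu //; exists 1 => //; apply: ExSkip.
Qed.

Lemma PF_succ f : PF f -> PF (fun a => (f a).+1).
Proof.
move=> [H1 H2]; split.
  by apply: polyb_le (polyb_add H1 (polyb_const _ 1)) => a; rewrite addn1.
move=> b m pos lp; have [c [t [pt X]]] := H2 b m pos lp.
exists (Seq c (inc b m)), (fun a => t a + 2); split.
  exact: polyb_add (polyb_const _ _).
move=> a o u hu e; apply: execle_seq (X a o u hu e) _.
have := inc_ok b o (cw a) [::] (upn u m (f a)) m.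
by congr (execle _ _ _ (st _ _ _ _ _)); upn_eq.
Qed.

Lemma PF_pred f : PF f -> PF (fun a => (f a).-1).
Proof.
move=> [H1 H2]; split.
  by apply: polyb_le H1 => a; rewrite leq_pred.
move=> b m pos lp; have [c [t [pt X]]] := H2 b m pos lp.
exists (Seq c (dec b m)), (fun a => t a + 1); split.
  exact: polyb_add (polyb_const _ _).
move=> a o u hu e; apply: execle_seq (X a o u hu e) _.
have := dec_ok b o (cw a) [::] (upn u m (f a)) m.
by congr (execle _ _ _ (st _ _ _ _ _)); upn_eq.
Qed.

Lemma PF_const k : PF (fun _ : C => k).
Proof. by elim: k => [|k IH]; [apply: PF_zero|apply: (PF_succ IH)]. Qed.

Lemma nth_le_sumn (s : seq nat) i : nth 0 s i <= sumn s.
Proof. by elim: s i => [|x s IH] [|i] //=; [|have := IH i]; lia. Qed.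

(** A unary counter can be read only by destroying it, so it is split into two copies and one of
    them is moved back. *)
Lemma PF_var i : PF (fun a : C => nth 0 (cv a) i).
Proof.
split.
  by apply: polyb_le (@polyb_sz C) => a; have := nth_le_sumn (cv a) i; rewrite /sz; lia.
move=> b m pos lp; have [le|lt] := leqP (size pos) i.
  exists Skip, (fun=> 1); split; first exact: polyb_const.
  move=> a o u hu e; rewrite upn_same; first by exists 1 => //; apply: ExSkip.
  by rewrite hu // e nth_default // size_map.
have ltm : nth 0 pos i < m by apply: (allP lp); apply: mem_nth.
set j := nth 0 pos i in ltm *.
exists (Seq (split_ctr b j m m.+1) (move_ctr b m.+1 j)), (fun a => sz a * 10 + 2); split.
  by apply: polyb_add (polyb_const _ _); apply: polyb_mul (polyb_const _ _); apply: polyb_sz.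
move=> a o u hu e.
have ej : nth 0 (cv a) i = u j by rewrite e (nth_map 0).
have le : u j <= sz a by rewrite -ej; have := nth_le_sumn (cv a) i; rewrite /sz; lia.
have hm : u m = 0 by apply: hu.
have hm1 : u m.+1 = 0 by apply: hu.
have S1 : execle (split_ctr b j m m.+1) (st b o (cw a) [::] u) (u j * 6 + 1)
   (st b o (cw a) [::] (upn (upn (upn u m (u m + u j)) m.+1 (u m.+1 + u j)) j 0)).
  by apply: split_ctr_ok; lia.
set v := upn _ j 0 in S1.
have S2 : execle (move_ctr b m.+1 j) (st b o (cw a) [::] v) (v m.+1 * 4 + 1)
   (st b o (cw a) [::] (upn (upn v j (v j + v m.+1)) m.+1 0)).
  by apply: move_ctr_ok; lia.
have ev : v m.+1 = u j.
  by rewrite /v /upn; case: eqP => [?|_]; [lia|rewrite eqxx hm1].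
have := execle_seq S1 S2; rewrite ev.
have -> : upn (upn v j (v j + u j)) m.+1 0 = upn u m (nth 0 (cv a) i).
  by rewrite ej /v; upn_eq.
by apply: execle_le; lia.
Qed.

(** The bits before the wanted position are popped onto the second stack, the exposed bit is tested,
    and the prefix is reversed back. *)
Lemma PF_nth f : PF f -> PF (fun a => nth false (cw a) (f a) : nat).
Proof.
move=> [H1 H2]; split.
  by apply: polyb_le (polyb_const _ 1) => a; case: nth.
move=> b m pos lp; have [c [t [pt X]]] := H2 b m pos lp.
exists (Seq c (Seq (loop b m (Seq (dec b m) (shift_bit b b.+1)))
       (Seq (Ite b (pred1 (Some true)) (inc b m) Skip) (reverse_onto b.+1 b)))),
  (fun a => t a + (f a * 7 + 1 + (3 + (sz a * 6 + 1)))); split.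
  apply: polyb_add pt _; apply: polyb_add.
    by apply: polyb_add (polyb_const _ _); apply: polyb_mul (polyb_const _ _).
  apply: polyb_add; first exact: polyb_const.
  by apply: polyb_add (polyb_const _ _); apply: polyb_mul (polyb_const _ _); apply: polyb_sz.
move=> a o u hu e; apply: execle_seq (X a o u hu e) _.
have um : u m = 0 by apply: hu.
apply: (execle_seq (s1 := st b o (drop (f a) (cw a)) (rev (take (f a) (cw a))) u)).
  have := @execle_while (ctr b m) isSome (Seq (dec b m) (shift_bit b b.+1))
    (fun j => st b o (drop j (cw a)) (rev (take j (cw a))) (upn u m (f a - j))) (f a) 6.
  rewrite drop0 take0 /= subn0 subnn (upn_same um); apply=> [j lt|]; last first.
    by rewrite st_ctr ohead_nseq um.
  rewrite st_ctr ohead_nseq {1}/upn eqxx; split; first lia.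
  apply: (execle_seq (dec_ok _ _ _ _ _ _) (t2 := 5)).
  set s1 := st _ _ _ _ _.
  have -> : st b o (drop j.+1 (cw a)) (rev (take j.+1 (cw a))) (upn u m (f a - j.+1)) =
     upd (upd s1 b.+1 (seq.cat (take 1 (s1 b)) (s1 b.+1))) b (behead (s1 b)).
    rewrite /s1 st_x st_y upd_y upd_x; congr (st b o _ _ _).
    - by rewrite -drop1 drop_drop add1n.
    - have [lt2|ge] := ltnP j (size (cw a)).
        by rewrite (drop_nth false lt2) /= take0 (take_nth false lt2) rev_rcons.
      by rewrite !take_oversize // ?drop_oversize //; lia.
    - by upn_eq.
  by apply: shift_bit_ok; lia.
apply: (execle_seq (s1 := st b o (drop (f a) (cw a)) (rev (take (f a) (cw a)))
         (upn u m (nth false (cw a) (f a))))).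
  have e0 : ohead (drop (f a) (cw a)) == Some true = nth false (cw a) (f a).
    rewrite -[in RHS](addn0 (f a)) -nth_drop; by case: (drop _ _) => [|[]].
  case en : (nth false _ _).
    exists 3 => //; apply: ExIteT; first by rewrite st_x /= e0 en.
    rewrite -upd_ctr.
    have -> : nseq true true = true :: st b o (drop (f a) (cw a)) (rev (take (f a) (cw a))) u (ctr b m).
      by rewrite st_ctr um.
    exact: ExPush.
  exists 2 => //; apply: ExIteF; first by rewrite st_x /= e0 en.
  rewrite upn_same //; exact: ExSkip.
set s1 := st _ _ _ _ _.
have ->: st b o (cw a) [::] (upn u m (nth false (cw a) (f a))) =
   upd (upd s1 b (seq.cat (rev (s1 b.+1)) (s1 b))) b.+1 [::].
  by rewrite /s1 st_x st_y upd_x upd_y revK cat_take_drop.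
apply: execle_le (reverse_onto_ok _ _); last by lia.
rewrite /s1 st_y size_rev size_take_min /sz.
have := geq_minr (f a) (size (cw a)); lia.
Qed.

Lemma PF_size : PF (fun a : C => size (cw a)).
Proof.
split.
  by apply: polyb_le (@polyb_sz C) => a; rewrite /sz; lia.
move=> b m pos lp.
exists (Seq (While b isSome (Seq (inc b m) (shift_bit b b.+1))) (reverse_onto b.+1 b)),
  (fun a => sz a * 14 + 2); split.
  by apply: polyb_add (polyb_const _ _); apply: polyb_mul (polyb_const _ _); apply: polyb_sz.
move=> a o u hu e; have um : u m = 0 by apply: hu.
apply: (@execle_le _ _ (size (cw a) * 8 + 1 + (size (cw a) * 6 + 1))); first by rewrite /sz; lia.
apply: (execle_seq (s1 := st b o [::] (rev (cw a)) (upn u m (size (cw a))))).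
  have := @execle_while b isSome (Seq (inc b m) (shift_bit b b.+1))
    (fun j => st b o (drop j (cw a)) (rev (take j (cw a))) (upn u m j)) (size (cw a)) 7.
  rewrite drop0 take0 drop_size take_size /= (upn_same um); apply=> [j lt|]; last first.
    by rewrite st_x.
  rewrite st_x (drop_nth false lt); split=> //.
  rewrite -(drop_nth false lt).
  apply: (execle_seq (inc_ok _ _ _ _ _ _) (t2 := 5)).
  set s1 := st _ _ _ _ _.
  have -> : st b o (drop j.+1 (cw a)) (rev (take j.+1 (cw a))) (upn u m j.+1) =
     upd (upd s1 b.+1 (seq.cat (take 1 (s1 b)) (s1 b.+1))) b (behead (s1 b)).
    rewrite /s1 st_x st_y upd_y upd_x; congr (st b o _ _ _).
    - by rewrite -drop1 drop_drop add1n.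
    - by rewrite (drop_nth false lt) /= take0 (take_nth false lt) rev_rcons.
    - by upn_eq.
  by apply: shift_bit_ok; lia.
set s1 := st _ _ _ _ _.
have ->: st b o (cw a) [::] (upn u m (size (cw a))) =
   upd (upd s1 b (seq.cat (rev (s1 b.+1)) (s1 b))) b.+1 [::].
  by rewrite /s1 st_x st_y upd_x upd_y revK cats0.
apply: execle_le (reverse_onto_ok _ _); last by lia.
by rewrite /s1 st_y size_rev.
Qed.

End Closure.

Lemma PF_wk (C : ctx) (f : C -> nat) : PF f -> PF (C := ext C) (fun p => f p.1).
Proof.
move=> [H1 H2]; split; first exact: (polyb_wk H1).
move=> b m [|i pos] lp.
  exists Skip, (fun=> 1); split; first exact: polyb_const.
  by move=> a o u _ [].
have [|c [t [pt X]]] := H2 b m pos; first by case/andP: lp.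
exists c, (fun p => t p.1); split; first exact: (polyb_wk pt).
by move=> [a k] o u hu [_ e]; apply: X.
Qed.

(** Iterating a polynomially bounded function can produce exponentially large values, so a
    polynomial bound [B] on all iterates is a separate hypothesis. *)
Lemma PF_iter (C : ctx) (N Z B : C -> nat) (F : C -> nat -> nat -> nat) :
  PF N -> PF Z -> PF (C := ext (ext C)) (fun p => F p.1.1 p.1.2 p.2) ->
  polyb B -> (forall a i, i <= N a -> iteri i (F a) (Z a) <= B a) ->
  PF (fun a => iteri (N a) (F a) (Z a)).
Proof.
move=> [N1 N2] [Z1 Z2] [F1 F2] pB HB; split.
  by apply: polyb_le pB => a; apply: HB.
move=> b m pos lp.
have lp1 : all (fun i => i < m.+1) pos by apply: sub_all lp => i /=; lia.
have lp3 : all (fun i => i < m.+3) [:: m, m.+2 & pos].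
  by rewrite /= !ltnS leqnn ltnW ?leqnSn //=; apply: sub_all lp => i /=; lia.
have [cZ [tZ [ptZ XZ]]] := Z2 b m pos lp.
have [cN [tN [ptN XN]]] := N2 b m.+1 pos lp1.
have [cF [tF [ptF XF]]] := F2 b m.+3 _ lp3.
(* The time of the body is made uniform first in the current iterate, by [B], and then in the index,
   by [N]. *)
have [g1 pg1 Hg1] := polyb_ext ptF (polyb_wk pB).
have [g2 pg2 Hg2] := polyb_ext pg1 N1.
(* Counter [m] holds the iterate, [m.+1] the rounds left, [m.+2] the index and [m.+3] the new
   value. *)
pose body := Seq (dec b m.+1) (Seq cF (Seq (clear_ctr b m)
               (Seq (move_ctr b m.+3 m) (inc b m.+2)))).
pose L a := 1 + (g2 a + (B a * 2 + 1 + (B a * 4 + 1 + 2))).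
exists (Seq cZ (Seq cN (Seq (loop b m.+1 body) (clear_ctr b m.+2)))),
  (fun a => tZ a + (tN a + (N a * (L a + 1) + 1 + (N a * 2 + 1)))); split.
  apply: polyb_add ptZ _; apply: polyb_add ptN _; apply: polyb_add.
    apply: polyb_add (polyb_const _ _); apply: polyb_mul N1 _.
    apply: polyb_add (polyb_const _ _); apply: polyb_add; first exact: polyb_const.
    apply: polyb_add pg2 _; apply: polyb_add.
      by apply: polyb_add (polyb_const _ _); apply: polyb_mul pB (polyb_const _ _).
    apply: polyb_add (polyb_const _ _).
    by apply: polyb_add (polyb_const _ _); apply: polyb_mul pB (polyb_const _ _).
  by apply: polyb_add (polyb_const _ _); apply: polyb_mul N1 (polyb_const _ _).
move=> a o u hu e.
pose acc i := iteri i (F a) (Z a).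
apply: (execle_seq (XZ a o u hu e)).
have hu1 := upn_high (Z a) hu.
have e1 : cv a = map (upn u m (Z a)) pos by rewrite map_upn.
apply: (execle_seq (XN a o _ hu1 e1)).
pose V i := upn (upn (upn u m (acc i)) m.+1 (N a - i)) m.+2 i.
have um2 : u m.+2 = 0 by apply: hu; lia.
have um3 : u m.+3 = 0 by apply: hu; lia.
have um1 : u m.+1 = 0 by apply: hu; lia.
apply: (execle_seq (s1 := st b o (cw a) [::] (V (N a)))).
  have -> : upn (upn u m (Z a)) m.+1 (N a) = V 0 by rewrite /V /acc /=; upn_eq.
  rewrite (addn1 (L a)).
  apply: (@execle_while (ctr b m.+1) isSome body (fun i => st b o (cw a) [::] (V i)) (N a) (L a)).
    move=> i lt; rewrite st_ctr ohead_nseq {1}/V /upn ifF ?eqxx; last by apply/negP; lia.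
    split; first lia.
    apply: (execle_seq (dec_ok _ _ _ _ _ _)); set v1 := upn _ _ (_.-1).
    have ev1 : v1 = upn (upn (upn u m (acc i)) m.+1 (N a - i.+1)) m.+2 i.
      by rewrite /v1 /V; upn_eq.
    have hv1 j : m.+3 <= j -> v1 j = 0.
      move=> lej; rewrite ev1 /upn !ifF ?hu //; try lia.
    have ecv : cv ((a, i, acc i) : ext (ext C)) = map v1 [:: m, m.+2 & pos].
      rewrite /=; congr [:: _, _ & _].
      - by rewrite ev1 /upn; repeat (case: eqP => ?); lia.
      - by rewrite ev1 /upn eqxx.
      - rewrite ev1 !map_upn //; apply: sub_all lp => j /=; lia.
    have := XF (a, i, acc i) o v1 hv1 ecv; rewrite /= => XFi.
    apply: execle_seq (execle_le _ XFi) _.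
      by apply: leq_trans (Hg1 (a, i) (acc i) _) (Hg2 _ _ _); rewrite /=; [apply: HB|]; lia.
    set v2 := upn v1 m.+3 _; have v2m : v2 m = acc i.
      by rewrite /v2 ev1 /upn; repeat (case: eqP => ?); lia.
    have le1 : acc i <= B a by apply: HB; lia.
    have le2 : acc i.+1 <= B a by apply: HB; lia.
    apply: (execle_seq (execle_le _ (clear_ctr_ok _ _ _ _ _ _))); first by rewrite v2m; lia.
    set v3 := upn v2 m 0; have v3m : v3 m.+3 = acc i.+1.
      by rewrite /v3 /v2 /upn; repeat (case: eqP => ?); try lia.
    apply: execle_seq (execle_le _ (move_ctr_ok _ _ _ _ _ _)) _; [by rewrite v3m; lia|lia|].
    set v4 := upn _ _ 0.
    have -> : V i.+1 = upn v4 m.+2 (v4 m.+2).+1.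
      by rewrite /v4 v3m /V /v3 /v2 ev1; upn_eq.
    exact: inc_ok.
  by rewrite st_ctr ohead_nseq /V /upn ifF ?eqxx ?subnn //; apply/negP; lia.
have -> : upn u m (acc (N a)) = upn (V (N a)) m.+2 0 by rewrite /V; upn_eq.
apply: execle_le (clear_ctr_ok _ _ _ _ _ _).
by rewrite /V /upn eqxx.
Qed.

Lemma PF_var0 (C : ctx) : PF (C := ext C) (fun p => p.2).
Proof. exact: (PF_var (ext C) 0). Qed.

(** * Arithmetic, bounded sums, connectives and bounded quantifiers *)

Section Arith.
Variable C : ctx.
Implicit Types f g N : C -> nat.

Lemma PF_add f g : PF f -> PF g -> PF (fun a => f a + g a).
Proof.
move=> Hf Hg; have e i n : iteri i (fun _ x => x.+1) n = n + i.
  by elim: i => [|i /= ->]; rewrite ?addn0 ?addnS.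
apply: (@PF_eq _ (fun a => iteri (g a) (fun _ x => x.+1) (f a))) => [a|]; first exact: e.
apply: (@PF_iter _ g f (fun a => f a + g a) (fun _ _ x => x.+1)) => //.
- by apply: PF_succ; apply: (PF_var0 (ext C)).
- by apply: polyb_add; apply: PF_polyb.
- by move=> a i; rewrite e; lia.
Qed.

Lemma PF_sub f g : PF f -> PF g -> PF (fun a => f a - g a).
Proof.
move=> Hf Hg; have e i n : iteri i (fun _ x => x.-1) n = n - i.
  by elim: i => [|i /= ->]; rewrite ?subn0 ?subnS.
apply: (@PF_eq _ (fun a => iteri (g a) (fun _ x => x.-1) (f a))) => [a|]; first exact: e.
apply: (@PF_iter _ g f f (fun _ _ x => x.-1)) => //.
- by apply: PF_pred; apply: (PF_var0 (ext C)).
- exact: PF_polyb.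
- by move=> a i; rewrite e; lia.
Qed.
End Arith.

Section Arith2.
Variable C : ctx.
Implicit Types f g N : C -> nat.

Lemma PF_sum N (F : C -> nat -> nat) : PF N -> PF (C := ext C) (fun p => F p.1 p.2) ->
  PF (fun a => \sum_(0 <= i < N a) F a i).
Proof.
move=> HN HF.
have e a n : iteri n (fun i x => x + F a i) 0 = \sum_(0 <= i < n) F a i.
  by elim: n => [|n /= ->]; [rewrite big_geq|rewrite big_nat_recr].
apply: (@PF_eq _ (fun a => iteri (N a) (fun i x => x + F a i) 0)) => [a|]; first exact: e.
have [g pg Hg] := polyb_ext (PF_polyb HF) (PF_polyb HN).
apply: (@PF_iter _ N (fun=> 0) (fun a => N a * g a) (fun a i x => x + F a i)) => //.
- exact: PF_const.
- apply: PF_add; first exact: (PF_var0 (ext C)).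
  exact: (PF_wk (C := ext C) HF).
- by apply: polyb_mul => //; apply: PF_polyb.
- move=> a i le; rewrite e; apply: leq_trans (_ : i * g a <= _); last by rewrite leq_mul2r le orbT.
  apply: leq_trans (_ : \sum_(0 <= j < i) g a <= _); last by rewrite sum_nat_const_nat subn0.
  by rewrite big_nat [X in _ <= X]big_nat; apply: leq_sum => j /andP[_ lt]; apply: (Hg a j); lia.
Qed.

Lemma PF_mul f g : PF f -> PF g -> PF (fun a => f a * g a).
Proof.
move=> Hf Hg; apply: (@PF_eq _ (fun a => \sum_(0 <= i < f a) g a)).
  by move=> a; rewrite sum_nat_const_nat subn0.
by apply: PF_sum => //; apply: PF_wk.
Qed.

Lemma PF_exp f k : PF f -> PF (fun a => f a ^ k).
Proof.
move=> H; elim: k => [|k IH]; first exact: (PF_const _ 1).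
by apply: PF_eq (PF_mul H IH) => a; rewrite expnS.
Qed.

Definition PB (p : C -> bool) := PF (fun a => p a : nat).

Lemma PB_eq p q : p =1 q -> PB p -> PB q.
Proof. by move=> e; apply: PF_eq => a; rewrite e. Qed.

Lemma PB_leq f g : PF f -> PF g -> PB (fun a => f a <= g a).
Proof.
move=> Hf Hg; apply: (@PF_eq _ (fun a => 1 - (f a - g a))).
  by move=> a; case: leqP => /=; lia.
by apply: PF_sub (PF_sub Hf Hg); apply: PF_const.
Qed.

Lemma PB_ltn f g : PF f -> PF g -> PB (fun a => f a < g a).
Proof. by move=> Hf Hg; apply: PB_leq => //; apply: PF_succ. Qed.

Lemma PB_neg p : PB p -> PB (fun a => ~~ p a).
Proof.
move=> H; apply: (@PF_eq _ (fun a => 1 - p a)); first by move=> a; case: (p a).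
by apply: PF_sub H; apply: PF_const.
Qed.

Lemma PB_and p q : PB p -> PB q -> PB (fun a => p a && q a).
Proof.
by move=> H1 H2; apply: PF_eq (PF_mul H1 H2) => a; case: (p a); case: (q a).
Qed.

Lemma PB_or p q : PB p -> PB q -> PB (fun a => p a || q a).
Proof.
move=> H1 H2; apply: PB_eq (PB_neg (PB_and (PB_neg H1) (PB_neg H2))) => a.
by rewrite negb_and !negbK.
Qed.

Lemma PB_imp p q : PB p -> PB q -> PB (fun a => p a ==> q a).
Proof. by move=> H1 H2; apply: PB_eq (PB_or (PB_neg H1) H2) => a; rewrite implybE. Qed.

Lemma PB_eqn f g : PF f -> PF g -> PB (fun a => f a == g a).
Proof.
move=> Hf Hg; apply: PB_eq (PB_and (PB_leq Hf Hg) (PB_leq Hg Hf)) => a.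
by rewrite eqn_leq.
Qed.

Lemma PB_const c : PB (fun _ : C => c).
Proof. exact: PF_const. Qed.

Lemma PB_nth f : PF f -> PB (fun a => nth false (cw a) (f a)).
Proof. exact: PF_nth. Qed.

Lemma PB_eqb p q : PB p -> PB q -> PB (fun a => p a == q a).
Proof.
by move=> H1 H2; apply: PB_eq (PB_eqn H1 H2) => a; case: (p a); case: (q a).
Qed.

Lemma PF_if p f g : PB p -> PF f -> PF g -> PF (fun a => if p a then f a else g a).
Proof.
move=> Hp Hf Hg; apply: PF_eq (PF_add (PF_mul Hp Hf) (PF_mul (PB_neg Hp) Hg)) => a.
by case: (p a); rewrite /= ?mul1n ?mul0n ?addn0.
Qed.

Lemma PB_if p q r : PB p -> PB q -> PB r -> PB (fun a => if p a then q a else r a).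
Proof.
move=> Hp Hf Hg; apply: PF_eq (PF_if Hp Hf Hg) => a; by case: (p a).
Qed.

Lemma PF_count N (p : C -> nat -> bool) : PF N ->
  PF (C := ext C) (fun q => p q.1 q.2 : nat) ->
  PF (fun a => count (p a) (iota 0 (N a))).
Proof.
move=> HN Hp; apply: PF_eq (PF_sum (F := fun a i => p a i : nat) HN Hp) => a.
by rewrite -sum1_count [RHS]big_mkcond /index_iota subn0; apply: eq_bigr => i _; case: (p a i).
Qed.

Lemma PB_all N (p : C -> nat -> bool) : PF N ->
  PF (C := ext C) (fun q => p q.1 q.2 : nat) ->
  PB (fun a => all (p a) (iota 0 (N a))).
Proof.
move=> HN Hp; apply: PB_eq (PB_eqn (PF_count HN Hp) HN) => a.
by rewrite all_count size_iota.
Qed.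

Lemma PB_has N (p : C -> nat -> bool) : PF N ->
  PF (C := ext C) (fun q => p q.1 q.2 : nat) ->
  PB (fun a => has (p a) (iota 0 (N a))).
Proof.
move=> HN Hp; apply: PB_eq (PB_ltn (PF_const _ 0) (PF_count HN Hp)) => a.
by rewrite has_count.
Qed.

Lemma PB_all_seq (T : Type) (s : seq T) (p : T -> C -> bool) :
  (forall x, PB (p x)) -> PB (fun a => all (fun x => p x a) s).
Proof.
by move=> H; elim: s => [|x s IH] /=; [apply: PB_const|apply: PB_and].
Qed.

Lemma PF_tab (s : seq nat) f : PF f -> PF (fun a => nth 0 s (f a)).
Proof.
elim: s f => [|x s IH] f H; first by apply: PF_eq (PF_zero C) => a; rewrite nth_nil.
apply: PF_eq (PF_if (PB_eqn H (PF_const C 0)) (PF_const C x) (IH _ (PF_pred H))) => a.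
by case: (f a).
Qed.
End Arith2.

Section Arith3.
Variable C : ctx.
Implicit Types f g N : C -> nat.

(** The quotient counts the positive multiples of the divisor that do not exceed the dividend. *)
Lemma PF_div f g : PF f -> PF g -> PF (fun a => f a %/ g a).
Proof.
move=> Hf Hg.
apply: (@PF_eq _ (fun a => if g a == 0 then 0 else
          count (fun i => i.+1 * g a <= f a) (iota 0 (f a)))).
  move=> a; case: eqP => [->|/eqP ne]; first by rewrite divn0.
  rewrite (@eq_in_count _ _ (fun i => i < f a %/ g a)); last first.
    by move=> i _; rewrite leq_divRL // lt0n.
  have le : f a %/ g a <= f a by apply: leq_div.
  rewrite -{2}(subnKC le) iotaD count_cat.
  rewrite (@eq_in_count _ _ predT) ?count_predT ?size_iota; last first.
    by move=> i; rewrite mem_iota /=; lia.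
  rewrite (@eq_in_count _ _ pred0) ?count_pred0; first lia.
  by move=> i; rewrite mem_iota /=; lia.
apply: PF_if; [by apply: PB_eqn => //; apply: PF_const|exact: PF_const|].
apply: PF_count => //.
apply: PB_leq; last by apply: PF_wk.
by apply: PF_mul; [apply: PF_succ; apply: PF_var0|apply: PF_wk].
Qed.

Lemma PF_mod f g : PF f -> PF g -> PF (fun a => f a %% g a).
Proof.
move=> Hf Hg; apply: PF_eq (PF_sub Hf (PF_mul (PF_div Hf Hg) Hg)) => a.
by rewrite {1}(divn_eq (f a) (g a)) addKn.
Qed.
End Arith3.

(** * Writing unary codes onto an output stack *)

Definition emits (C : ctx) b r (c : cmd) m pos (f : C -> word) (t : C -> nat) :=
  forall a o u, (forall i, m <= i -> u i = 0) -> cv a = map u pos ->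
  execle c (st b o (cw a) [::] u) (t a)
    (st b (upd o r (seq.cat (f a) (o r))) (cw a) [::] u).

Lemma emit_unary (C : ctx) b r m pos (f : C -> nat) : r < b ->
  all (fun i => i < m) pos -> PF f ->
  exists c t, polyb t /\ emits b r c m pos (fun a => unary (f a)) t.
Proof.
move=> lt lp [H1 H2]; have [c [t [pt X]]] := H2 b m pos lp.
exists (Seq c (loop b m (Seq (dec b m) (Push r true)))), (fun a => t a + (f a * 4 + 1)); split.
  by apply: polyb_add pt _; apply: polyb_add (polyb_const _ _); apply: polyb_mul (polyb_const _ _).
move=> a o u hu e; apply: (execle_seq (X a o u hu e)).
have um : u m = 0 by apply: hu.
have := @execle_while (ctr b m) isSome (Seq (dec b m) (Push r true))
  (fun j => st b (upd o r (seq.cat (nseq j true) (o r))) (cw a) [::] (upn u m (f a - j))) (f a) 3.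
have eo : upd o r (seq.cat (nseq 0 true) (o r)) = o.
  by apply: functional_extensionality => i; rewrite /upd; case: eqP => // ->.
rewrite eo subn0 subnn (upn_same um); apply=> [j ltj|]; rewrite st_ctr ohead_nseq ?um //.
rewrite {1}/upn eqxx; split; first lia.
apply: (execle_seq (dec_ok _ _ _ _ _ _) (t2 := 2)); set v := upn _ _ (_.-1).
have -> : upn u m (f a - j.+1) = v by rewrite /v; upn_eq.
exists 2 => //; set s1 := st _ _ _ _ v.
have -> : st b (upd o r (seq.cat (nseq j.+1 true) (o r))) (cw a) [::] v = upd s1 r (true :: s1 r).
  rewrite /s1 upd_low // st_low //; congr (st b _ _ _ _).
  by apply: functional_extensionality => i; rewrite /upd eqxx; case: eqP.
exact: ExPush.
Qed.

Lemma code_nats_cons n s : code_nats (n :: s) = seq.cat (unary n) (false :: code_nats s).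
Proof. by rewrite /code_nats /= cat_rcons. Qed.

(** A stack is filled from the bottom, so the fields are written from the last to the first, each
    after its separator; the loop counter, once decremented, is the index of the field to write. *)
Lemma emit_code (C : ctx) b r m pos (N : C -> nat) (F : C -> nat -> nat) : r < b ->
  all (fun i => i < m) pos -> PF N -> PF (C := ext C) (fun p => F p.1 p.2) ->
  exists c t, polyb t /\
    emits b r c m pos (fun a => code_nats (mkseq (F a) (N a))) t.
Proof.
move=> lt lp [N1 N2] HF; have [cN [tN [ptN XN]]] := N2 b m pos lp.
have lp1 : all (fun i => i < m.+1) (m :: pos).
  by rewrite /= ltnS leqnn; apply: sub_all lp => i /=; lia.
have [cF [tF [ptF XF]]] := emit_unary lt lp1 HF.
have [g pg Hg] := polyb_ext ptF N1.
exists (Seq cN (loop b m (Seq (dec b m) (Seq (Push r false) cF)))),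
  (fun a => tN a + (N a * (3 + g a).+1 + 1)); split.
  apply: polyb_add ptN _; apply: polyb_add (polyb_const _ _); apply: polyb_mul N1 _.
  by apply: polyb_le (polyb_add pg (polyb_const _ 4)) => a; lia.
move=> a o u hu e; apply: (execle_seq (XN a o u hu e)).
have um : u m = 0 by apply: hu.
pose W j := seq.cat (code_nats (map (F a) (iota (N a - j) j))) (o r).
have := @execle_while (ctr b m) isSome (Seq (dec b m) (Seq (Push r false) cF))
  (fun j => st b (upd o r (W j)) (cw a) [::] (upn u m (N a - j))) (N a) (3 + g a).
have eo : upd o r (W 0) = o.
  by apply: functional_extensionality => i; rewrite /upd /W; case: eqP => // ->.
rewrite eo subn0 {4 5}/W subnn (upn_same um) /mkseq.
apply=> [j ltj|]; rewrite st_ctr ohead_nseq ?um //.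
rewrite {1}/upn eqxx; split; first lia.
rewrite -[3 + g a]/(1 + (2 + g a)); apply: (execle_seq (dec_ok _ _ _ _ _ _)); set v := upn _ _ (_.-1).
have ev : upn u m (N a - j.+1) = v by rewrite /v; upn_eq.
apply: (execle_seq (s1 := st b (upd o r (false :: W j)) (cw a) [::] v)).
  exists 2 => //; set s1 := st _ _ _ _ v.
  have -> : st b (upd o r (false :: W j)) (cw a) [::] v = upd s1 r (false :: s1 r).
    rewrite /s1 upd_low // st_low //; congr (st b _ _ _ _).
    by apply: functional_extensionality => i; rewrite /upd eqxx; case: eqP.
  exact: ExPush.
set o1 := upd o r (false :: W j).
have hv i : m.+1 <= i -> v i = 0.
  by move=> le; rewrite -ev /upn ifF ?hu //; lia.
have ecv : cv ((a, N a - j.+1) : ext C) = map v (m :: pos).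
  by rewrite /= -ev map_upn // -e /upn eqxx.
have := XF (a, N a - j.+1) o1 v hv ecv; rewrite /= ev => XX.
have -> : upd o r (W j.+1) = upd o1 r (seq.cat (unary (F a (N a - j.+1))) (o1 r)).
  apply: functional_extensionality => i; rewrite /o1 /upd eqxx.
  case: eqP => // _; rewrite /W.
  have -> : iota (N a - j.+1) j.+1 = N a - j.+1 :: iota (N a - j) j.
    by rewrite /=; congr (_ :: iota _ _); lia.
  by rewrite map_cons code_nats_cons -catA.
by apply: execle_le XX; apply: (Hg a); lia.
Qed.

(** * Composition of a machine with counter programs *)

Definition base : ctx := @Ctx (word * nat)%type fst (fun p => [:: p.2]).

Section Load.
Variables (b rk : nat).
Hypothesis lt_b : 3 < b.
Hypothesis lt_rk : rk < b.
Hypothesis ne_rk : rk != 2.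

(** Moving a stack reverses it, so the word is moved twice; one move is enough for a unary
    number. *)
Definition load :=
  Seq (reverse_onto 2 b.+1) (Seq (reverse_onto b.+1 b) (reverse_onto rk (ctr b 0))).

Lemma load_ok (s : store) x k :
  s 2 = x -> s rk = unary k -> (forall r, b <= r -> s r = [::]) ->
  execle load s (size x * 12 + k * 6 + 3)
    (st b (upd (upd s 2 [::]) rk [::]) x [::] (upn (fun=> 0) 0 k)).
Proof.
move=> e2 ek hb; have -> : size x * 12 + k * 6 + 3 =
  (size x * 6 + 1) + ((size x * 6 + 1) + (k * 6 + 1)) by lia.
pose s1 := upd (upd s b.+1 (rev x)) 2 [::].
pose s2 := upd (upd s b x) 2 [::].
apply: (execle_seq (s1 := s1)).
  have := reverse_onto_ok s (r1 := 2) (r2 := b.+1).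
  by rewrite e2 hb ?cats0 //; apply; lia.
apply: (execle_seq (s1 := s2)).
  have := reverse_onto_ok s1 (r1 := b.+1) (r2 := b).
  have -> : s1 b.+1 = rev x by rewrite /s1 /upd ifF ?eqxx //; lia.
  have -> : s1 b = [::] by rewrite /s1 /upd !ifF ?hb //; lia.
  have -> : upd (upd s1 b (seq.cat (rev (rev x)) [::])) b.+1 [::] = s2.
    apply: functional_extensionality => i; rewrite /s2 /s1 /upd revK cats0.
    case: (i =P b.+1) => [->|_]; last by case: eqP => // ->; rewrite ifF //; lia.
    by rewrite !ifF ?hb //; lia.
  by rewrite size_rev; apply; lia.
have := reverse_onto_ok s2 (r1 := rk) (r2 := ctr b 0).
have -> : s2 rk = unary k.
  by rewrite /s2 /upd (negbTE ne_rk) ifF ?ek //; lia.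
have -> : s2 (ctr b 0) = [::].
  by rewrite /s2 /upd !ifF ?hb //; rewrite /ctr; lia.
rewrite size_nseq cats0 rev_nseq => X.
have -> : st b (upd (upd s 2 [::]) rk [::]) x [::] (upn (fun=> 0) 0 k) =
          upd (upd s2 (ctr b 0) (unary k)) rk [::].
  apply: functional_extensionality => i; rewrite /st /s2 /upd /ctr /upn.
  case: ltnP => [lti|le].
    rewrite (_ : i == b.+2 + 0 = false); last lia.
    by rewrite (_ : i == b = false) //; lia.
  rewrite (_ : i == rk = false); last lia.
  rewrite (_ : i == 2 = false); last lia.
  case: (i =P b) => [->|ne1]; first by rewrite ifF //; lia.
  case: (i =P b.+1) => [->|ne2]; first by rewrite ifF ?hb //; lia.
  case: (i =P b.+2 + 0) => [->|ne3]; first by rewrite addn0 subnn.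
  by rewrite ifF ?hb //; lia.
by apply: X; rewrite /ctr; lia.
Qed.
End Load.

(** The exponent is fixed by the counter programs, so the work after [M] is polynomial in the word
    and the parameter that [M] returns, whatever the time [T] of [M] itself. *)
Theorem compose_tm (M : tm) (N s : base -> nat) (F : base -> nat -> nat) :
  PF N -> PF s -> PF (C := ext base) (fun p => F p.1 p.2) ->
  exists M' c, forall ins x k T, size ins <= 2 ->
    computes_within M ins [:: x; unary k] T ->
    computes_within M' ins [:: code_nats (mkseq (F (x, k)) (N (x, k))); unary (s (x, k))]
      (sumn (map size ins) * 12 + T + (size x + k).+2 ^ c).
Proof.
move=> HN Hs HF; pose b := tm_tapes M + 4.
have lb : 3 < b by rewrite /b; lia.
have lt0 : 0 < b by lia.
have lt1 : 1 < b by lia.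
have lp : all (fun i => i < 1) [:: 0] by [].
have [cE [tE [ptE XE]]] := emit_code lt0 lp HN HF.
have [cS [tS [ptS XS]]] := emit_unary lt1 lp Hs.
(* The inputs move from tapes 0 and 1 to tapes 2 and 3, where [M] has its first two tapes; register
   [b] is scratch space. *)
pose c0 := Seq (reverse_onto 0 b) (Seq (reverse_onto b 2)
            (Seq (reverse_onto 1 b) (reverse_onto b 3))).
pose c1 := Seq (load b 3) (Seq cE cS).
pose N' := maxn b (maxn (reg_bound c0) (reg_bound c1)).
have [c Hc] : polyb (fun a : base => (sz a * 12 + 8 + (tE a + tS a))).
  apply: polyb_add (polyb_add ptE ptS); apply: polyb_add (polyb_const _ _).
  by apply: polyb_mul (polyb_const _ _); apply: polyb_sz.
exists (seqtm M N' c0 c1), c => ins x k T szi cM.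
have szM : 2 <= tm_tapes M by case/computes_withinP: cM.
have Hc' := Hc (x, k); rewrite /sz /= addn0 in Hc'.
pose s0 : store := nth [::] ins.
have s0hi r : 2 <= r -> s0 r = [::] by move=> le; apply: nth_default; lia.
pose s1 : store := fun r => if r == 2 then s0 0 else if r == 3 then s0 1 else [::].
have [t0 le0 X0] : execle c0 s0 (sumn (map size ins) * 12 + 4) s1.
  have ei : sumn (map size ins) = size (s0 0) + size (s0 1).
    by rewrite /s0; case: (ins) szi => [|w [|w' [|? ?]]] //=; lia.
  have -> : sumn (map size ins) * 12 + 4 = (size (s0 0) * 6 + 1) + ((size (s0 0) * 6 + 1) +
        ((size (s0 1) * 6 + 1) + (size (s0 1) * 6 + 1))) by lia.
  apply: (execle_seq (s1 := upd (upd s0 b (rev (s0 0))) 0 [::])).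
    have := reverse_onto_ok s0 (r1 := 0) (r2 := b).
    by rewrite (s0hi b) ?cats0; [apply; lia|lia].
  set u1 := upd _ _ _.
  have -> : size (s0 0) = size (u1 b) by rewrite /u1 /upd ifF ?eqxx ?size_rev //; lia.
  apply: execle_seq (reverse_onto_ok _ _) _; first lia.
  set u2 := upd _ _ _.
  have -> : size (s0 1) = size (u2 1) by rewrite /u2 /u1 /upd !ifF //; lia.
  apply: execle_seq (reverse_onto_ok _ _) _; first lia.
  set u3 := upd _ _ _.
  have u1b : u1 b = rev (s0 0) by rewrite /u1 /upd ifF ?eqxx //; lia.
  have u12 : u1 2 = [::] by rewrite /u1 /upd !ifF ?s0hi //; lia.
  have u2b : u2 b = [::] by rewrite /u2 /upd eqxx.
  have u21 : u2 1 = s0 1 by rewrite /u2 /u1 /upd !ifF //; lia.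
  have u3b : u3 b = rev (s0 1).
    have nb1 : (b == 1) = false by lia.
    by rewrite /u3 {1}/upd nb1 {1}/upd eqxx u2b u21 cats0.
  have u33 : u3 3 = [::] by rewrite /u3 /u2 /u1 /upd !ifF ?s0hi //; lia.
  have -> : size (u2 1) = size (u3 b).
    by rewrite u3b u21 size_rev.
  have -> : s1 = upd (upd u3 3 (seq.cat (rev (u3 b)) (u3 3))) b [::].
    apply: functional_extensionality => r; rewrite /s1 u3b u33 revK cats0 {1 2}/upd.
    case: (r =P b) => [->|nb]; first by rewrite !ifF //; lia.
    case: (r =P 3) => [->|n3] //.
    rewrite /u3 u2b u21 cats0 {1}/upd; case: (r =P 1) => [->|n1] //.
    rewrite {1}/upd (introF eqP nb).
    rewrite /u2 u1b u12 cats0 revK {1}/upd (introF eqP nb).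
    rewrite {1}/upd; case: eqP => // n2.
    rewrite /u1 /upd; case: eqP => // n0; rewrite (introF eqP nb).
    by rewrite s0hi //; lia.
  by apply: reverse_onto_ok; lia.
apply: (@computes_within_le _ _ _ (t0 + T.+1 + (size x * 12 + k * 6 + 3 + (tE (x, k) + tS (x, k))))).
  by lia.
apply: (seqtm_correct _ _ _ _ X0 _ cM).
- by rewrite leq_max /b; lia.
- exact: leq_trans (leq_maxl _ _) (leq_maxr _ _).
- exact: leq_trans (leq_maxr _ _) (leq_maxr _ _).
- by rewrite leq_max /=; lia.
- move=> j lt; rewrite /s1; case: j lt => [|[|j]] lt //=.
  by rewrite -/(s0 j.+2) s0hi.
move=> s2 h1 h2.
have e2 : s2 2 = x by rewrite (h2 0).
have e3 : s2 3 = unary k by rewrite (h2 1).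
have X1 : execle c1 s2 (size x * 12 + k * 6 + 3 + (tE (x, k) + tS (x, k)))
  (st b (upd (upd (upd (upd s2 2 [::]) 3 [::]) 0 (code_nats (mkseq (F (x, k)) (N (x, k)))))
    1 (unary (s (x, k)))) x [::] (upn (fun=> 0) 0 k)).
  apply: execle_seq.
    apply: load_ok e2 e3 _ => //.
    move=> r le; rewrite h1; last by move: le; rewrite /b; lia.
    by rewrite /s1 !ifF //; move: le; rewrite /b; lia.
  set o := upd (upd s2 _ _) _ _.
  set u := upn _ _ _.
  have hu i : 1 <= i -> u i = 0 by rewrite /u /upn; case: i.
  have ecv : cv ((x, k) : base) = map u [:: 0] by [].
  have X2 := XE (x, k) o u hu ecv.
  have o0 : o 0 = [::] by rewrite /o /upd /= h1.
  rewrite o0 cats0 /= in X2; apply: execle_seq X2 _.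
  set o' := upd o _ _.
  have X3 := XS (x, k) o' u hu ecv.
  have o1 : o' 1 = [::] by rewrite /o' /o /upd /= h1.
  by rewrite o1 cats0 /= in X3.
case: X1 => n le X1; exists n; eexists; split; [exact: le|exact: X1|].
by move=> [|[|i]] // _; rewrite st_low.
Qed.

(** Serves for the bounds that depend on the parameter only. The value [h n] need not be polynomial
    in [n], so it enters as an input word of its own length. *)
Theorem computable_comp (h : nat -> nat) (f : base -> nat) :
  computable h -> PF f -> computable (fun n => f (unary (h n), n)).
Proof.
move=> [M HM] Hf; pose b := tm_tapes M + 4.
have lb : 3 < b by rewrite /b; lia.
have lt0 : 0 < b by lia.
have lp : all (fun i => i < 1) [:: 0] by [].
have [cS [tS [ptS XS]]] := emit_unary lt0 lp Hf.
(* The number is duplicated: tape 2 is the input of [M], and tape 1 keeps a copy for the last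
   program. *)
pose c0 := While 0 isSome (Seq (Pop 0) (Seq (Push 2 true) (Push 1 true))).
pose c1 := Seq (load b 1) cS.
pose N' := maxn b (maxn (reg_bound c0) (reg_bound c1)).
exists (seqtm M N' c0 c1) => n; have [T cM] := HM n.
pose s1 : store := fun r => if (r == 1) || (r == 2) then unary n else [::].
have szM : 1 <= tm_tapes M by case/computes_withinP: cM.
have [t0 le0 X0] : execle c0 (nth [::] [:: unary n]) (n * 6 + 1) s1.
  pose S j : store := fun r => if r == 0 then unary (n - j) else
                if (r == 1) || (r == 2) then unary j else [::].
  have -> : nth [::] [:: unary n] = S 0.
    apply: functional_extensionality => -[|[|[|r]]] //=; rewrite /S ?subn0 //=.
  have -> : s1 = S n.
    by apply: functional_extensionality => -[|[|[|r]]] //=; rewrite /S subnn.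
  apply: (@execle_while 0 isSome _ S n 5) => [i lt|]; last by rewrite /S subnn.
  split; first by rewrite /S /= ohead_nseq; lia.
  exists 5 => //; apply: (ExSeq (n1 := 1)); first exact: ExPop.
  have -> : S i.+1 = let s := upd (S i) 0 (behead (S i 0)) in
     upd (upd s 2 (true :: s 2)) 1 (true :: (upd s 2 (true :: s 2)) 1).
    apply: functional_extensionality => -[|[|[|r]]] //=; rewrite /S /upd /=.
    by rewrite (_ : n - i = (n - i.+1).+1) //; lia.
  by apply: (ExSeq (n1 := 2) (n2 := 2)); apply: ExPush.
exists (t0 + T.+1 + (h n * 12 + n * 6 + 3 + tS (unary (h n), n))).
apply: (seqtm_correct _ _ _ _ X0 _ cM).
- by rewrite leq_max /b; lia.
- exact: leq_trans (leq_maxl _ _) (leq_maxr _ _).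
- exact: leq_trans (leq_maxr _ _) (leq_maxr _ _).
- by rewrite leq_max /=; lia.
- by move=> [|j] lt; rewrite /s1 //= nth_nil.
move=> s2 h1 h2.
have e2 : s2 2 = unary (h n) by rewrite (h2 0).
have e1 : s2 1 = unary n by rewrite h1.
have X1 : execle c1 s2 (h n * 12 + n * 6 + 3 + tS (unary (h n), n))
  (st b (upd (upd (upd s2 2 [::]) 1 [::]) 0 (unary (f (unary (h n), n))))
     (unary (h n)) [::] (upn (fun=> 0) 0 n)).
  apply: execle_seq.
    have := load_ok lb (_ : 1 < b) (_ : 1 != 2) e2 e1; rewrite size_nseq; apply=> //; first lia.
    move=> r le; rewrite h1; last by move: le; rewrite /b; lia.
    by rewrite /s1 ifF //; move: le; rewrite /b; lia.
  set o := upd (upd s2 _ _) _ _.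
  set u := upn _ _ _.
  have hu i : 1 <= i -> u i = 0 by rewrite /u /upn; case: i.
  have ecv : cv ((unary (h n), n) : base) = map u [:: 0] by [].
  have X2 := XS (unary (h n), n) o u hu ecv.
  have o0 : o 0 = [::] by rewrite /o /upd /= h1.
  by rewrite o0 cats0 /= in X2.
case: X1 => m le X1; exists m; eexists; split; [exact: le|exact: X1|].
by move=> [|i] // _; rewrite st_low.
Qed.

(** * Binary constraint satisfaction as two simultaneous Hamiltonian paths *)

Definition csp_yes K D (R : nat -> nat -> nat -> nat -> bool) :=
  exists a : nat -> nat, (forall i, i < K -> a i < D) /\
    forall i j, i < K -> j < K -> R i j (a i) (a j).

Lemma mem_nthn (q : seq nat) i : i < size q -> nth 0 q i \in q.
Proof. exact: mem_nth. Qed.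

Lemma nthn_inj (q : seq nat) i j : uniq q -> i < size q -> j < size q ->
  nth 0 q i = nth 0 q j -> i = j.
Proof. by move=> uq li lj /eqP; rewrite nth_uniq // => /eqP. Qed.

(** * The levelled graph and the rigidity of long paths in its first layer *)

Section Levels.
Variables (K D : nat) (R : nat -> nat -> nat -> nat -> bool).

Definition nlev := 3 * (K * K) + 16.
Definition lv u := u %/ (D * D).
Definition vl u := u %% (D * D).
(** Level [12 + 3 * p] separates off the two levels [13 + 3 * p] and [14 + 3 * p] of pair [p], so
    [L %/ 3 - 4] recovers [p] from any of the three. *)
Definition single L := [|| L < 12, L %% 3 == 0 | 12 + 3 * (K * K) <= L].
Definition active u := single (lv u) ==> (vl u == 0).
(** On a diagonal pair the two values must be equal; this ties the row value of a variable to its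
    column value. *)
Definition cell_ok p x :=
  R (p %/ K) (p %% K) (x %/ D) (x %% D) &&
  ((p %/ K == p %% K) ==> (x %/ D == x %% D)).

Definition e1 u v :=
  [&& lv v == (lv u).+1, active u, active v &
      ~~ single (lv u) && ~~ single (lv v) ==>
      (vl u == vl v) && cell_ok (lv u %/ 3 - 4) (vl u)].

Definition transpose p := p %% K * K + p %/ K.

(* The order in which the second layer visits the levels. *)
Definition pos L :=
  if L < 12 then L else
  if 12 + 3 * (K * K) <= L then L - 2 * (K * K) else
  if L %% 3 == 0 then L %/ 3 + 8 else
  if L %% 3 == 1 then L %/ 3 + 12 + K * K
  else 16 + 2 * (K * K) + transpose (L %/ 3 - 4).

(** All single levels come first in this order, then the first copies of the pairs in row-major
    order, then the second copies in column-major order. A step that starts a new row or column is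
    unrestricted. *)
Definition e2 u v :=
  [&& pos (lv v) == (pos (lv u)).+1, active u, active v &
      (16 + K * K <= pos (lv u)) && ((pos (lv u) - (16 + K * K)).+1 %% K != 0) ==>
      (if pos (lv u) < 16 + 2 * (K * K) then vl u %/ D == vl v %/ D
       else vl u %% D == vl v %% D)].

Definition g1 u v := e1 u v || e1 v u.
Definition g2 u v := e2 u v || e2 v u.

Arguments single : simpl never.
Arguments lv : simpl never.
Arguments vl : simpl never.
Arguments active : simpl never.
Arguments pos : simpl never.
Arguments g1 : simpl never.
Arguments g2 : simpl never.

Lemma g1_sym : symmetric g1. Proof. by move=> u v; rewrite /g1 orbC. Qed.
Lemma g2_sym : symmetric g2. Proof. by move=> u v; rewrite /g2 orbC. Qed.
Lemma g1_irr : irreflexive g1.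
Proof. by move=> u; rewrite /g1 /e1 (_ : (lv u == (lv u).+1) = false) //; lia. Qed.
Lemma g2_irr : irreflexive g2.
Proof. by move=> u; rewrite /g2 /e2 (_ : (pos _ == (pos _).+1) = false) //; lia. Qed.

Lemma lv_vl_inj u v : lv u = lv v -> vl u = vl v -> u = v.
Proof. by rewrite /lv /vl => e1 e2; rewrite (divn_eq u (D * D)) (divn_eq v (D * D)) e1 e2. Qed.

Lemma e1_lv u v : e1 u v -> lv v = (lv u).+1.
Proof. by case/and4P => /eqP. Qed.

Lemma single_eq u v : active u -> active v -> single (lv u) -> lv u = lv v -> u = v.
Proof.
rewrite /active => au av s e; apply: lv_vl_inj => //.
by move: au av; rewrite -e s /= => /eqP -> /eqP ->.
Qed.

Lemma e1_active u v : e1 u v -> active u /\ active v.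
Proof. by case/and4P. Qed.

Lemma g1_active u v : g1 u v -> active u /\ active v.
Proof. by case/orP => /e1_active []. Qed.

Lemma e1_match u v : e1 u v -> ~~ single (lv u) -> ~~ single (lv v) -> vl u = vl v.
Proof. by case/and4P => _ _ _ H a b; move: H; rewrite a b /= => /andP[/eqP]. Qed.

Lemma not_singleS L : ~~ single L -> single L.+1 ->
  [/\ ~~ single L.-1, single L.-2, 14 <= L & L < 12 + 3 * (K * K)].
Proof. by rewrite /single => a b; split; lia. Qed.

Lemma not_single_next L : ~~ single L -> ~~ single L.+1 ->
  [/\ L %% 3 = 1, single L.-1, single L.+2 & 12 <= L.-1].
Proof. by rewrite /single => a b; split; lia. Qed.

(* Between two consecutive single levels, [e1] is a matching. *)
Lemma no_three x y z : g1 x y -> g1 y z -> ~~ single (lv x) -> ~~ single (lv y) ->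
  ~~ single (lv z) -> x = z.
Proof.
move=> /orP[exy|eyx] /orP[eyz|ezy] sx sy sz.
- have [] := not_single_next sx; rewrite -(e1_lv exy) // => _ _.
  by rewrite (e1_lv exy) -(e1_lv exy) -(e1_lv eyz) (negbTE sz).
- apply: lv_vl_inj; first by have := e1_lv exy; have := e1_lv ezy; lia.
  by rewrite (e1_match exy) // (e1_match ezy).
- apply: lv_vl_inj; first by have := e1_lv eyx; have := e1_lv eyz; lia.
  by rewrite -(e1_match eyx) // -(e1_match eyz).
- have [] := not_single_next sz; rewrite -(e1_lv ezy) // => _ _.
  by rewrite (e1_lv ezy) -(e1_lv ezy) -(e1_lv eyx) (negbTE sx).
Qed.

(** Of three consecutive path vertices one lies on a single level, since otherwise the first and the
    third coincide by [no_three]. *)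
Lemma size_singles q : uniq q -> sorted g1 q ->
  size q <= 3 * count (fun u => single (lv u)) q + 2.
Proof.
have [n] := ubnP (size q); elim: n q => // n IH [|x [|y [|z q]]] //; try by move=> _ _ _; rewrite /=; lia.
move=> ltn uq sq.
have u1 : uniq (y :: z :: q) by move: uq; rewrite cons_uniq => /andP[].
have u2 : uniq (z :: q) by move: u1; rewrite cons_uniq => /andP[].
have u3 : uniq q by move: u2; rewrite cons_uniq => /andP[].
have /= /andP[gxy /andP[gyz pz]] := sq.
have s1 : sorted g1 [:: y, z & q] by rewrite /= gyz.
have s2 : sorted g1 (z :: q) by [].
have s3 : sorted g1 q by case: (q) pz => //= w q' /andP[].
have lt1 : (size q).+2 < n by [].
have lt2 : (size q).+1 < n by apply: ltnW.
have lt3 : size q < n by apply: ltnW.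
pose c := count (fun u => single (lv u)) q.
have H1 : (size q).+2 <= 3 * (single (lv y) + (single (lv z) + c)) + 2.
  exact: (IH [:: y, z & q] lt1 u1 s1).
have H2 : (size q).+1 <= 3 * (single (lv z) + c) + 2 by exact: (IH (z :: q) lt2 u2 s2).
have H3 : size q <= 3 * c + 2 by exact: (IH q lt3 u3 s3).
rewrite [size _]/= [count _ _]/= -/c; case sx : (single (lv x)).
  move: (nat_of_bool (single (lv y)) + _) H1 => m; move: (size q) => k; clear; rewrite /=; lia.
case sy : (single (lv y)).
  move: (nat_of_bool (single (lv z)) + _) H2 => m; move: (size q) => k; clear; rewrite /=; lia.
case sz : (single (lv z)).
  by move: (c) (size q) H3 => m k; clear; rewrite /=; lia.
have exz := no_three gxy gyz (negbT sx) (negbT sy) (negbT sz).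
by move: uq; rewrite exz /= !inE eqxx orbT.
Qed.

Lemma sorted_nth (e : rel nat) q i : sorted e q -> i.+1 < size q ->
  e (nth 0 q i) (nth 0 q i.+1).
Proof. by move=> s lt; exact: (sortedP 0 s _ lt). Qed.

Lemma sorted_active q u : sorted g1 q -> 1 < size q -> u \in q -> active u.
Proof.
move=> s sz /(nthP 0) [i lt <-]; have [lt1|ge] := ltnP i.+1 (size q).
  by have [] := g1_active (sorted_nth s lt1).
case: i lt ge => [|i] lt ge; first lia.
by have [] := g1_active (sorted_nth s lt).
Qed.

Section Forced.
Variable q : seq nat.
Hypotheses (uq : uniq q) (sq : sorted g1 q) (szq : nlev <= size q)
  (lvq : forall u, u \in q -> lv u < nlev).

(** A single level has only one active vertex. Without levels below 12 the path meets at most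
    [K * K + 4] of these, hence has at most [3 * (K * K) + 14] vertices, fewer than [nlev]. *)
Lemma low_level : exists2 u, u \in q & lv u < 12.
Proof.
apply/hasP; apply/negP => /negP/hasPn H.
have H0 := size_singles uq sq; have szq' := szq.
suff Hc : count (fun u => single (lv u)) q <= K * K + 4.
  by move: Hc H0 szq'; rewrite /nlev; move: (count _ _) (size q) (K * K) => c k P; clear; lia.
rewrite -size_filter -(size_map lv).
have : size ([seq 12 + 3 * p | p <- iota 0 (K * K)] ++ iota (12 + 3 * (K * K)) 4)
       <= K * K + 4 by rewrite size_cat size_map !size_iota.
apply: leq_trans; apply: uniq_leq_size.
  rewrite map_inj_in_uniq ?filter_uniq // => u v; rewrite !mem_filter => /andP[su iu] /andP[sv iv] e.
  by apply: single_eq => //; apply: sorted_active sq _ _ => //; move: szq'; rewrite /nlev; lia.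
move=> L /mapP[u]; rewrite mem_filter => /andP[su iu] ->.
rewrite mem_cat mem_iota; have := H _ iu; have := lvq iu; move: su; rewrite /single /nlev => su l1 l2.
apply/orP; case: (ltnP (lv u) (12 + 3 * (K * K))) => h; [left|right; lia].
apply/mapP; exists (lv u %/ 3 - 4); last lia.
by rewrite mem_iota; lia.
Qed.

(** All neighbours of a vertex of least level lie one level higher. That level is at most 12 and
    therefore single, so there is at most one neighbour on the path and the vertex is an end of
    it. *)
Lemma start_low : exists2 q', (q' = q \/ q' = rev q) &
  lv (nth 0 q' 0) < 12 /\ forall u, u \in q -> lv (nth 0 q' 0) <= lv u.
Proof.
have [u0 iu0 lu0] := low_level.
have [z iz zmin] : exists2 z, z \in q & forall u, u \in q -> lv z <= lv u.
  have : exists L, has (fun u => lv u == L) q by exists (lv u0); apply/hasP; exists u0.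
  case/ex_minnP => L /hasP[z iz /eqP ez] mn; exists z => // u iu; rewrite ez.
  by apply: mn; apply/hasP; exists u.
have lz : lv z < 12 by apply: leq_ltn_trans (zmin _ iu0) lu0.
have sz1 : 1 < size q by move: szq; rewrite /nlev; lia.
have act u : u \in q -> active u by apply: sorted_active.
have [i lti ei] : exists2 i, i < size q & nth 0 q i = z by apply/nthP.
have nb j : j \in q -> g1 z j -> lv j = (lv z).+1.
  by move=> ij /orP[/e1_lv //|/e1_lv e]; have := zmin _ ij; rewrite e; lia.
have i_end : i = 0 \/ i = (size q).-1.
  case: i lti ei => [|i] lti ei; first by left.
  right; case: (ltnP i.+2 (size q)) => [lt2|]; last lia.
  have a := sorted_nth sq lti; have b := sorted_nth sq lt2.
  rewrite ei in a b; rewrite g1_sym in a.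
  have ia : nth 0 q i \in q by apply: mem_nthn; lia.
  have ib : nth 0 q i.+2 \in q by apply: mem_nthn.
  have la := nb _ ia a; have lb := nb _ ib b.
  have : nth 0 q i = nth 0 q i.+2.
    by apply: single_eq; [exact: act|exact: act|rewrite la /single; lia|rewrite la lb].
  by move/(nthn_inj uq); lia.
case: i_end => ii.
  by exists q; [left|rewrite ii in ei; rewrite ei].
exists (rev q); first by right.
by rewrite nth_rev; [rewrite subn1 -ii ei|lia].
Qed.
End Forced.

Lemma monotone q : uniq q -> sorted g1 q -> nlev <= size q ->
  (forall u, u \in q -> lv u < nlev) ->
  lv (nth 0 q 0) < 12 -> (forall u, u \in q -> lv (nth 0 q 0) <= lv u) ->
  forall i, i.+1 < size q -> e1 (nth 0 q i) (nth 0 q i.+1).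
Proof.
move=> uq sq szq lvq; have [a ea] : exists a, lv (nth 0 q 0) = a by exists (lv (nth 0 q 0)).
rewrite ea => l0 mn.
have sz1 : 1 < size q by apply: leq_trans szq; rewrite /nlev; lia.
have act u : u \in q -> active u by apply: sorted_active.
have neq i j : i < j -> j < size q -> nth 0 q i = nth 0 q j -> False.
  move=> lij lj /(nthn_inj uq (ltn_trans lij lj) lj) e.
  by rewrite e ltnn in lij.
suff H n : forall i, i < n -> i.+1 < size q -> e1 (nth 0 q i) (nth 0 q i.+1).
  by move=> i; apply: (H i.+1).
elim: n => // n IH i; rewrite ltnS => lein lti.
have up : forall j, j <= i -> lv (nth 0 q j) = a + j.
  elim=> [|j IHj] lej; first by rewrite ea addn0.
  rewrite (e1_lv (IH j (leq_trans lej lein) (leq_ltn_trans lej (ltnW lti)))).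
  by rewrite IHj ?addnS // ltnW.
case/orP: (sorted_nth sq lti) => // dn.
have ld := e1_lv dn.
case: i lein lti up dn ld => [|i] lein lti up dn ld.
  by have := mn _ (mem_nthn lti); rewrite -ea ld ltnn.
have ui : e1 (nth 0 q i) (nth 0 q i.+1) by apply: IH => //; apply: ltnW.
have lu := e1_lv ui.
have eL : lv (nth 0 q i.+2) = lv (nth 0 q i) by move: ld; rewrite lu => -[].
have [dn1 dn2] := e1_active dn; have [ui1 ui2] := e1_active ui.
case sL : (single (lv (nth 0 q i))).
  by case: (@neq i i.+2) => //; apply: single_eq.
(* Between the two levels of a pair the edges form a matching, so stepping up and down again returns
   to the same vertex. *)
case sL1 : (single (lv (nth 0 q i.+1))); last first.
  case: (@neq i i.+2) => //; apply: lv_vl_inj => //.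
  by rewrite (e1_match ui) ?sL ?sL1 // (e1_match dn) ?eL ?sL ?sL1.
(* The path has turned back at a separator; it gets stuck after two steps. *)
have sL' : ~~ single (lv (nth 0 q i)) by rewrite sL.
have sL1' : single (lv (nth 0 q i)).+1 by rewrite -lu.
have [nsA sS geL ltL] := not_singleS sL' sL1'.
have Li : lv (nth 0 q i) = a + i by apply: up.
(* The current level is below [12 + 3 * (K * K)], so the four top levels guarantee that the path has
   two more vertices to examine. *)
have bnd : i.+4 < size q.
  apply: leq_trans szq; move: ltL; rewrite Li /nlev; move: (K * K); clear; lia.
have l3 : i.+3 < size q by apply: ltnW.
case/orP: (sorted_nth sq l3) => [up2|dn3].
  case: (@neq i.+1 i.+3) => //; have [_ a3] := e1_active up2.
  by apply: single_eq => //; rewrite (e1_lv up2) -ld.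
have ld3 := e1_lv dn3; have [a31 a32] := e1_active dn3.
have eA : lv (nth 0 q i.+3) = (lv (nth 0 q i)).-1 by rewrite -eL ld3.
case/orP: (sorted_nth sq bnd) => [up4|dn4].
  have eB : lv (nth 0 q i.+4) = lv (nth 0 q i) by rewrite (e1_lv up4) -ld3 eL.
  case: (@neq i.+2 i.+4) => //; apply: lv_vl_inj; first by rewrite eL eB.
  by rewrite -(e1_match dn3) ?eL ?eA // (e1_match up4) ?eA ?eB.
have ld4 := e1_lv dn4; have [a41 a42] := e1_active dn4.
have eS : lv (nth 0 q i.+4) = (lv (nth 0 q i)).-2 by rewrite -eA ld4.
(* Having started below level 12 and climbed since, the path visited the separator two levels down
   at index [i - 2]. *)
have [lei eS2] : 2 <= i /\ a + (i - 2) = (lv (nth 0 q i)).-2.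
  by move: geL l0; rewrite Li; clear; lia.
have lei2 : i - 2 <= i.+1 by clear; lia.
have l2 : lv (nth 0 q (i - 2)) = (lv (nth 0 q i)).-2 by rewrite up.
case: (@neq (i - 2) i.+4) => //; first by clear; lia.
apply: single_eq => //; rewrite ?l2 ?eS //.
apply: act; apply: mem_nthn; apply: ltn_trans bnd; clear; lia.
Qed.

(** Every step climbs by one and there are at least as many vertices as levels, so the path begins
    at level 0 and meets each level once. *)
Lemma forced_path q : uniq q -> sorted g1 q -> nlev <= size q ->
  (forall u, u \in q -> lv u < nlev) ->
  exists q', [/\ q' =i q, size q' = nlev,
    forall L, L < nlev -> lv (nth 0 q' L) = L &
    forall L, L.+1 < nlev -> e1 (nth 0 q' L) (nth 0 q' L.+1)].
Proof.
move=> uq sq szq lvq; have [q' hq' [l0 mn]] := start_low uq sq szq lvq.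
have [uq' sq' mq' szq'] : [/\ uniq q', sorted g1 q', q' =i q & size q' = size q].
  case: hq' => ->; first by [].
  split; rewrite ?rev_uniq ?size_rev //; last by move=> u; rewrite mem_rev.
  by rewrite rev_sorted (eq_sorted (e' := g1)) // => u v; apply: g1_sym.
have mono : forall i, i.+1 < size q' -> e1 (nth 0 q' i) (nth 0 q' i.+1).
  apply: monotone => //; rewrite ?szq' // => u; rewrite mq'; [exact: lvq|exact: mn].
have [a ea] : exists a, lv (nth 0 q' 0) = a by exists (lv (nth 0 q' 0)).
have up : forall j, j < size q' -> lv (nth 0 q' j) = a + j.
  elim=> [|j IHj] lej; first by rewrite ea addn0.
  by rewrite (e1_lv (mono j _)) ?IHj; lia.
have sz0 : 0 < size q' by rewrite szq'; move: szq; rewrite /nlev; lia.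
have : lv (nth 0 q' (size q').-1) < nlev by apply: lvq; rewrite -mq'; apply: mem_nthn; lia.
rewrite up => [last_lt|]; last lia.
have a0 : a = 0 by lia.
have eqsz : size q' = nlev by lia.
exists q'; split=> // L lt; first by rewrite up ?a0 ?eqsz.
by apply: mono; rewrite eqsz.
Qed.

End Levels.

Lemma crossing (e : rel nat) (Pr : pred nat) s :
  sorted e s -> has Pr s -> has (predC Pr) s ->
  exists u v, [/\ u \in s, v \in s, Pr u, ~~ Pr v & e u v || e v u].
Proof.
elim: s => // a [|b s] IH; first by rewrite /= !orbF => _ ->.
move=> /= /andP[eab pb]; have IH' := IH pb.
case pa : (Pr a); case pbb : (Pr b); rewrite /= => h1 h2.
- have [||u [v [iu iv pu pv euv]]] := IH'; rewrite /= ?pbb //.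
  by exists u, v; split=> //; rewrite inE ?iu ?iv orbT.
- by exists a, b; split; rewrite ?inE ?eqxx ?orbT ?pa ?pbb ?eab.
- by exists b, a; split; rewrite ?inE ?eqxx ?orbT ?pa ?pbb ?eab ?orbT.
- have [||u [v [iu iv pu pv euv]]] := IH'; rewrite /= ?pbb //.
  by exists u, v; split=> //; rewrite inE ?iu ?iv orbT.
Qed.

(** * Two Hamiltonian paths against one satisfying assignment *)

Section Csp.
Variables (K D : nat) (R : nat -> nat -> nat -> nat -> bool).
Hypotheses (K_gt0 : 0 < K) (D_gt0 : 0 < D).
Local Notation nlev := (nlev K).
Local Notation lv := (lv D).
Local Notation vl := (vl D).
Local Notation single := (single K).
Local Notation pos := (pos K).
Local Notation transpose := (transpose K).
Local Notation P := (K * K).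

Definition posinv g :=
  if g < 12 then g else if g < 12 + P then 12 + 3 * (g - 12) else
  if g < 16 + P then g + 2 * P else
  if g < 16 + 2 * P then 13 + 3 * (g - (16 + P))
  else 14 + 3 * transpose (g - (16 + 2 * P)).

Lemma transpose_lt p : p < P -> transpose p < P.
Proof.
move=> lt; rewrite /transpose; have : p %% K < K by rewrite ltn_mod.
have : p %/ K < K by rewrite ltn_divLR.
by move: (p %% K) (p %/ K) => x y; clear; nia.
Qed.

Lemma transpose_div p : p < P -> transpose p %/ K = p %% K.
Proof.
move=> lt; have lt2 : p %/ K < K by rewrite ltn_divLR.
by rewrite /transpose divnMDl // divn_small // addn0.
Qed.

Lemma transpose_mod p : p < P -> transpose p %% K = p %/ K.
Proof.
move=> lt; have lt2 : p %/ K < K by rewrite ltn_divLR.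
by rewrite /transpose modnMDl modn_small.
Qed.

Lemma transposeK p : p < P -> transpose (transpose p) = p.
Proof.
move=> lt; rewrite {1}/transpose transpose_div // transpose_mod //.
by rewrite -divn_eq.
Qed.

Lemma posinv_spec g : g < nlev -> posinv g < nlev /\ pos (posinv g) = g.
Proof.
rewrite /nlev /posinv => lt.
case: ifP => h1; first by rewrite /pos h1; split=> //; lia.
case: ifP => h2.
  split; first lia; rewrite /pos.
  rewrite [_ < 12](_ : _ = false); last lia.
  rewrite [_ <= _](_ : _ = false); last lia.
  rewrite [_ == 0](_ : _ = true); last lia.
  by lia.
case: ifP => h3.
  split; first lia; rewrite /pos.
  rewrite [_ < 12](_ : _ = false); last lia.
  rewrite [_ <= _](_ : _ = true); last lia.
  by lia.
case: ifP => h4.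
  split; first lia; rewrite /pos.
  rewrite [_ < 12](_ : _ = false); last lia.
  rewrite [_ <= _](_ : _ = false); last lia.
  rewrite [_ == 0](_ : _ = false); last lia.
  rewrite [_ == 1](_ : _ = true); last lia.
  by lia.
have lt2 : g - (16 + 2 * P) < P by lia.
have := transpose_lt lt2; set q := transpose _ => ltq.
split; first lia; rewrite /pos.
rewrite [_ < 12](_ : _ = false); last lia.
rewrite [_ <= _](_ : _ = false); last lia.
rewrite [_ == 0](_ : _ = false); last lia.
rewrite [_ == 1](_ : _ = false); last lia.
have -> : (14 + 3 * q) %/ 3 - 4 = q by lia.
by rewrite /q transposeK //; lia.
Qed.

Lemma posinvK L : L < nlev -> pos L < nlev /\ posinv (pos L) = L.
Proof.
rewrite /nlev /pos => lt.
case: ifP => h1; first by rewrite /posinv h1; split=> //; lia.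
case: ifP => h2.
  split; first lia; rewrite /posinv.
  rewrite [_ < 12](_ : _ = false); last lia.
  rewrite [_ < 12 + _](_ : _ = false); last lia.
  rewrite [_ < 16 + _](_ : _ = true); last lia.
  by lia.
case: ifP => h3.
  split; first lia; rewrite /posinv.
  rewrite [_ < 12](_ : _ = false); last lia.
  rewrite [_ < 12 + _](_ : _ = true); last lia.
  by lia.
case: ifP => h4.
  split; first lia; rewrite /posinv.
  rewrite [_ < 12](_ : _ = false); last lia.
  rewrite [_ < 12 + _](_ : _ = false); last lia.
  rewrite [_ < 16 + P](_ : _ = false); last lia.
  rewrite [_ < 16 + _](_ : _ = true); last lia.
  by lia.
have lt2 : L %/ 3 - 4 < P by lia.
have := transpose_lt lt2; set q := transpose _ => ltq.
split; first lia; rewrite /posinv.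
rewrite [_ < 12](_ : _ = false); last lia.
rewrite [_ < 12 + _](_ : _ = false); last lia.
rewrite [_ < 16 + P](_ : _ = false); last lia.
rewrite [_ < 16 + _](_ : _ = false); last lia.
have -> : 16 + 2 * P + q - (16 + 2 * P) = q by lia.
by rewrite /q transposeK //; lia.
Qed.

Lemma posinvA p : p < P -> posinv (16 + P + p) = 13 + 3 * p.
Proof.
move=> lt; rewrite /posinv.
rewrite [_ < 12](_ : _ = false); last lia.
rewrite [_ < 12 + _](_ : _ = false); last lia.
rewrite [_ < 16 + P](_ : _ = false); last lia.
rewrite [_ < 16 + _](_ : _ = true); last lia.
by rewrite addKn.
Qed.

Lemma posinvB h : posinv (16 + 2 * P + h) = 14 + 3 * transpose h.
Proof.
rewrite /posinv.
rewrite [_ < 12](_ : _ = false); last lia.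
rewrite [_ < 12 + _](_ : _ = false); last lia.
rewrite [_ < 16 + P](_ : _ = false); last lia.
rewrite [_ < 16 + _](_ : _ = false); last lia.
by rewrite addKn.
Qed.

Lemma vl_lt u : vl u < D * D.
Proof. by rewrite ltn_mod muln_gt0 D_gt0. Qed.

Lemma div_succ p : p.+1 %% K != 0 -> p.+1 %/ K = p %/ K.
Proof. by move=> h; rewrite divnS // /dvdn (negbTE h). Qed.

(** The first path leaves one vertex [x L] on each level. The second path must therefore pass from
    the positions up to [g] to the later ones along the edge from [x (posinv g)] to
    [x (posinv g.+1)]. Only connectedness of the second layer is used. *)
Lemma csp_of_paths (q q2 : seq nat) : (forall u, u \in q -> lv u < nlev) ->
  uniq q -> sorted (g1 K D R) q -> nlev <= size q ->
  sorted (g2 K D) q2 -> q2 =i q -> csp_yes K D R.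
Proof.
move=> lvq uq sq szq sq2 eq2.
have [q' [eq' sz' lvq' e1q']] := forced_path uq sq szq lvq.
pose x L := nth 0 q' L.
have xin L : L < nlev -> x L \in q2.
  by move=> lt; rewrite eq2 -eq' mem_nth ?sz'.
have xlv u : u \in q2 -> u = x (lv u) /\ lv u < nlev.
  rewrite eq2 -eq' => /(nthP 0)[i]; rewrite sz' => lt <-.
  by rewrite lvq'.
have e2x g : g.+1 < nlev -> e2 K D (x (posinv g)) (x (posinv g.+1)).
  move=> lt; have [lt1 p1] := posinv_spec (ltnW lt); have [lt2 p2] := posinv_spec lt.
  have [||u [v [iu iv pu pv euv]]] := crossing (Pr := fun u => pos (lv u) <= g) sq2.
  - by apply/hasP; exists (x (posinv g)); rewrite ?xin // lvq' // p1.
  - by apply/hasP; exists (x (posinv g.+1)); rewrite ?xin //= lvq' // p2 ltnn.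
  have {}euv : e2 K D u v.
    have : g2 K D u v by case/orP: euv => //; rewrite g2_sym.
    by case/orP => // /and4P[/eqP e _ _ _]; lia.
  have [eu ltu] := xlv _ iu; have [ev ltv] := xlv _ iv.
  have e : pos (lv v) = (pos (lv u)).+1 by case/and4P: euv => /eqP.
  have [_ Ku] := posinvK ltu; have [_ Kv] := posinvK ltv.
  have gu : pos (lv u) = g by lia.
  by move: euv; rewrite eu ev -{1}Ku -{1}Kv e gu.
pose val p := vl (x (13 + 3 * p)).
have nlevE : nlev = 3 * P + 16 by [].
have AB p : p < P -> vl (x (14 + 3 * p)) = val p /\ cell_ok K D R p (val p).
  move=> lt; have lt1 : (13 + 3 * p).+1 < nlev by rewrite nlevE; lia.
  have /and4P[_ _ _] := e1q' _ lt1.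
  rewrite !lvq' //; last lia.
  rewrite [_ && _](_ : _ = true) /=; last by rewrite /single; lia.
  rewrite -/(x (13 + 3 * p)) -/(x (13 + 3 * p).+1) -/(val p).
  have -> : (13 + 3 * p) %/ 3 - 4 = p by lia.
  by case/andP=> /eqP ->.
have row p : p.+1 < P -> p.+1 %% K != 0 -> val p %/ D = val p.+1 %/ D.
  move=> lt ne; have ltg : (16 + P + p).+1 < nlev by rewrite nlevE; lia.
  have /and4P[_ _ _] := e2x _ ltg.
  have [lt1 p1] := posinv_spec (ltnW ltg).
  rewrite lvq' // p1.
  have -> : (16 + P + p) - (16 + P) = p by lia.
  rewrite ne leq_addr /= ifT; last lia.
  rewrite -addnS !posinvA //; last exact: ltnW.
  by move/eqP.
have col h : h.+1 < P -> h.+1 %% K != 0 -> val (transpose h) %% D = val (transpose h.+1) %% D.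
  move=> lt ne; have ltg : (16 + 2 * P + h).+1 < nlev by rewrite nlevE; lia.
  have /and4P[_ _ _] := e2x _ ltg.
  have [lt1 p1] := posinv_spec (ltnW ltg).
  rewrite lvq' // p1.
  rewrite [16 + P <= _](_ : _ = true) /=; last lia.
  (* The row copies occupy [K * K] positions, a multiple of [K], so one divisibility test marks the
     ends of rows and of columns. *)
  have mm : (16 + 2 * P + h - (16 + P)).+1 %% K = h.+1 %% K.
    by rewrite (_ : _.+1 = K * K + h.+1); [rewrite modnMDl|lia].
  rewrite mm ne /= ifF; last lia.
  rewrite -addnS !posinvB.
  have [-> _] := AB _ (transpose_lt (ltnW lt)); have [-> _] := AB _ (transpose_lt lt).
  by move/eqP.
have mulK i j : i < K -> j < K -> i * K + j < P by move=> hi hj; nia.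
have dK i j : j < K -> (i * K + j) %/ K = i by move=> hj; rewrite divnMDl // divn_small // addn0.
have mK i j : j < K -> (i * K + j) %% K = j by move=> hj; rewrite modnMDl modn_small.
have rows i j : i < K -> j < K -> val (i * K + j) %/ D = val (i * K) %/ D.
  move=> hi; elim: j => [|j IH] hj; first by rewrite addn0.
  rewrite addnS -row; [by apply: IH; lia|by rewrite -addnS mulK|].
  by rewrite -addnS mK.
have cols i j : i < K -> j < K -> val (j * K + i) %% D = val i %% D.
  move=> hi; have trE j' : j' < K -> transpose (i * K + j') = j' * K + i.
    by move=> hj; rewrite /transpose dK // mK.
  elim: j => [|j IH] hj; first by rewrite mul0n.
  rewrite -IH; last lia.
  rewrite -!trE //; last lia.
  rewrite addnS -col //; first by rewrite -addnS mulK.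
  by rewrite -addnS mK.
(* The assignment consists of the row values; the diagonal pairs identify them with the column
   values. *)
exists (fun i => val (i * K) %/ D); split=> [i hi|i j hi hj].
  by rewrite ltn_divLR // vl_lt.
have [_ /andP[]] := AB _ (mulK _ _ hi hj); rewrite dK // mK // rows // => HR _.
have [_ /andP[_]] := AB _ (mulK _ _ hj hj); rewrite dK // mK // eqxx /= rows // => /eqP e.
by move: HR; rewrite e !cols.
Qed.

Section Forward.
Variable a : nat -> nat.
Hypotheses (a_lt : forall i, i < K -> a i < D)
  (a_R : forall i j, i < K -> j < K -> R i j (a i) (a j)).

Definition cellval p := a (p %/ K) * D + a (p %% K).
Definition vert L := L * (D * D) + (if single L then 0 else cellval (L %/ 3 - 4)).

Lemma not_single_lt L : ~~ single L -> L %/ 3 - 4 < P.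
Proof. by rewrite /single; lia. Qed.

Lemma cellval_lt p : p < P -> cellval p < D * D.
Proof.
move=> lt; have h1 : p %/ K < K by rewrite ltn_divLR.
have h2 : p %% K < K by rewrite ltn_mod.
have := a_lt h1; have := a_lt h2; rewrite /cellval; nia.
Qed.

Lemma cellval_div p : p < P -> cellval p %/ D = a (p %/ K).
Proof.
move=> lt; have h2 : p %% K < K by rewrite ltn_mod.
by rewrite /cellval divnMDl // (@divn_small (a (p %% K))) ?addn0 //; apply: a_lt.
Qed.

Lemma cellval_mod p : p < P -> cellval p %% D = a (p %% K).
Proof.
move=> lt; have h2 : p %% K < K by rewrite ltn_mod.
by rewrite /cellval modnMDl (@modn_small (a (p %% K))) //; apply: a_lt.
Qed.

Lemma vert_off L : (if single L then 0 else cellval (L %/ 3 - 4)) < D * D.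
Proof.
case: ifP => h; first by rewrite muln_gt0 D_gt0.
by apply: cellval_lt; apply: not_single_lt; rewrite h.
Qed.

Lemma lv_vert L : lv (vert L) = L.
Proof.
by rewrite /vert /lv divnMDl ?muln_gt0 ?D_gt0 // divn_small ?addn0 ?vert_off.
Qed.

Lemma vl_vert L : vl (vert L) = if single L then 0 else cellval (L %/ 3 - 4).
Proof. by rewrite /vert /vl modnMDl modn_small ?vert_off. Qed.

Lemma active_vert L : active K D (vert L).
Proof. by rewrite /active lv_vert vl_vert; case: (single L). Qed.

Lemma e1_vert L : e1 K D R (vert L) (vert L.+1).
Proof.
rewrite /e1 !lv_vert eqxx !active_vert /=.
apply/implyP => /andP[s1 s2].
have [m3 _ _ _] := not_single_next s1 s2.
rewrite !vl_vert (negbTE s1) (negbTE s2).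
have -> : L.+1 %/ 3 - 4 = L %/ 3 - 4 by lia.
rewrite eqxx /=; have lt := not_single_lt s1.
rewrite /cell_ok cellval_div // cellval_mod // a_R ?ltn_divLR ?ltn_mod //=.
by apply/implyP => /eqP ->.
Qed.

Lemma e2_vert g : g.+1 < nlev -> e2 K D (vert (posinv g)) (vert (posinv g.+1)).
Proof.
move=> lt; have [lt1 p1] := posinv_spec (ltnW lt); have [lt2 p2] := posinv_spec lt.
rewrite /e2 !lv_vert p1 p2 eqxx !active_vert /=.
apply/implyP => /andP[le ne]; have nlevE : nlev = 3 * P + 16 by [].
case: ifP => h.
  pose p := g - (16 + P); have ne' : p.+1 %% K != 0 by [].
  (* For the last row copy [p.+1] would be [K * K], which the divisibility condition rules out. *)
  have ltp : p.+1 < P.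
    have : p.+1 <= P by rewrite /p; lia.
    rewrite leq_eqVlt => /orP[/eqP e|//].
    by move: ne'; rewrite e modnMl.
  have eg : g = 16 + P + p by rewrite /p; lia.
  rewrite {1}eg posinvA; last exact: ltnW.
  rewrite eg -addnS posinvA //.
  rewrite !vl_vert !ifF; try by rewrite /single; lia.
  have -> : (13 + 3 * p) %/ 3 - 4 = p by lia.
  have -> : (13 + 3 * p.+1) %/ 3 - 4 = p.+1 by lia.
  by rewrite !cellval_div ?div_succ // ltnW.
pose p := g - (16 + 2 * P).
have ne' : p.+1 %% K != 0.
  move: ne; rewrite (_ : _.+1 = K * K + p.+1); [by rewrite modnMDl|by rewrite /p; lia].
have ltp : p.+1 < P by rewrite /p; lia.
have := transpose_lt ltp; have := transpose_lt (ltnW ltp).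
have eg : g = 16 + 2 * P + p by rewrite /p; lia.
have -> : posinv g = 14 + 3 * transpose p by rewrite {1}eg posinvB.
have -> : posinv g.+1 = 14 + 3 * transpose p.+1 by rewrite eg -addnS posinvB.
set t1 := transpose p; set t2 := transpose p.+1 => h1 h2.
rewrite !vl_vert !ifF; try by rewrite /single; lia.
have -> : (14 + 3 * t1) %/ 3 - 4 = t1 by lia.
have -> : (14 + 3 * t2) %/ 3 - 4 = t2 by lia.
by rewrite !cellval_mod // !transpose_mod ?div_succ // ltnW.
Qed.

Lemma paths_of_csp : exists q q2, [/\ forall u, u \in q -> u < nlev * (D * D),
  uniq q /\ size q = nlev, sorted (g1 K D R) q, uniq q2 /\ q2 =i q & sorted (g2 K D) q2].
Proof.
have vinj : injective vert by move=> L L' /(congr1 lv); rewrite !lv_vert.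
exists (map vert (iota 0 nlev)), (map (vert \o posinv) (iota 0 nlev)).
have inP u : (u \in map vert (iota 0 nlev)) <-> exists2 L, L < nlev & u = vert L.
  split=> [/mapP[L]|[L lt ->]]; first by rewrite mem_iota => /andP[_ lt] ->; exists L.
  by apply: map_f; rewrite mem_iota.
split.
- move=> u /inP[L lt ->]; rewrite /vert.
  have := vert_off L; set o := (if _ then _ else _).
  by move: o (D * D) => o dd; move: lt; clear; nia.
- by rewrite map_inj_uniq // iota_uniq size_map size_iota.
- apply/(sortedP 0) => i; rewrite size_map size_iota => lt.
  by rewrite !(nth_map 0) ?size_iota ?(ltnW lt) // !nth_iota ?(ltnW lt) // /g1 e1_vert.
- split.
    rewrite map_inj_in_uniq ?iota_uniq // => g g'; rewrite !mem_iota !add0n /= => lt lt' /vinj e.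
    by have [_ <-] := posinv_spec lt; rewrite e; have [_ ->] := posinv_spec lt'.
  move=> u; apply/mapP/idP => [[g]|/inP[L lt ->]].
    by rewrite mem_iota /= => lt ->; apply/inP; exists (posinv g) => //; have [] := posinv_spec lt.
  exists (pos L); last by rewrite /=; have [_ ->] := posinvK lt.
  by rewrite mem_iota /=; have [] := posinvK lt.
- apply/(sortedP 0) => i; rewrite size_map size_iota => lt.
  by rewrite !(nth_map 0) ?size_iota ?(ltnW lt) // !nth_iota ?(ltnW lt) // /g2 /= e2_vert.
Qed.
End Forward.
End Csp.

(** * Syntax-directed proofs that a function is given by a counter program *)

Ltac pf_user := fail.
Ltac pf_wk := lazymatch goal with
  | |- @PF (ext ?C) ?f =>
      let g := eval cbn [fst snd cw ext] in (fun a : ctx_sort C => f (a, 0)) in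
      refine (@PF_wk C g _)
  end.
Ltac pf_hyp := match goal with
  | H : ?P |- ?P => exact H
  | H : PF ?h |- PF (fun a => ?h a) => exact H
  | H : PB ?h |- PB (fun a => ?h a) => exact H
  end.
Ltac pf_step := lazymatch goal with
  | |- PF (fun _ => ?k) => apply: PF_const
  | |- PF (fun a => nat_of_bool (@?p a)) => change (PB p)
  | |- PF (fun a => @?f a + @?g a) => refine (@PF_add _ f g _ _)
  | |- PF (fun a => @?f a - @?g a) => refine (@PF_sub _ f g _ _)
  | |- PF (fun a => @?f a * @?g a) => refine (@PF_mul _ f g _ _)
  | |- PF (fun a => @?f a %/ @?g a) => refine (@PF_div _ f g _ _)
  | |- PF (fun a => @?f a %% @?g a) => refine (@PF_mod _ f g _ _)
  | |- PF (fun a => (@?f a) ^ ?k) => refine (@PF_exp _ f k _)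
  | |- PF (fun a => (@?f a).+1) => refine (@PF_succ _ f _)
  | |- PF (fun a => (@?f a).-1) => refine (@PF_pred _ f _)
  | |- PF (fun a => count (@?p a) (iota 0 (@?n a))) => refine (@PF_count _ n p _ _)
  | |- PF (fun a => size (cw _)) => exact: PF_size
  | |- PB (fun _ => ?k) => apply: PB_const
  | |- PB (fun a => @?p a && @?q a) => refine (@PB_and _ p q _ _)
  | |- PB (fun a => @?p a || @?q a) => refine (@PB_or _ p q _ _)
  | |- PB (fun a => @?p a ==> @?q a) => refine (@PB_imp _ p q _ _)
  | |- PB (fun a => ~~ @?p a) => refine (@PB_neg _ p _)
  | |- PB (fun a => S (@?p a) <= @?q a) => refine (@PB_ltn _ p q _ _)
  | |- PB (fun a => @?p a <= @?q a) => refine (@PB_leq _ p q _ _)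
  | |- PB (fun a => @eq_op _ (@?p a) (@?q a)) =>
      first [refine (@PB_eqn _ p q _ _) | refine (@PB_eqb _ p q _ _)]
  | |- PB (fun a => all (@?p a) (iota 0 (@?n a))) => refine (@PB_all _ n p _ _)
  | |- PB (fun a => has (@?p a) (iota 0 (@?n a))) => refine (@PB_has _ n p _ _)
  | |- PB (fun a => nth false (cw _) (@?f a)) => refine (@PB_nth _ f _)
  | |- PF _ => first [pf_hyp | exact: PF_var0 | pf_user | apply: PF_if | pf_wk]
  | |- PB _ => first [pf_hyp | pf_user | apply: PB_if]
  end.
Ltac pf := repeat pf_step.

(** * The multi-layer instance *)

Section HamiltonianPaths.
Variables (n : nat) (e : rel nat) (G : sgraph 'I_n).
Hypothesis adjE : forall u v : 'I_n, adj G u v = e u v.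
Variable X : {set 'I_n}.

(** Replaces the nested subtypes by sequences of numbers, in which paths of different layers can be
    compared. *)
Lemma hamiltonian_induced : Hamiltonian (induced G X) <->
  exists q : seq nat, [/\ 0 < size q, uniq q, sorted e q &
    forall u, (u \in q) = (u \in map val (enum X))].
Proof.
split=> [[x [p [pp up ap]]]|[q [sz uq sq mq]]].
  exists (map (fun z : {x | x \in X} => val (val z)) (x :: p)); split=> //.
  - by rewrite map_inj_uniq // => a b /val_inj/val_inj.
  - rewrite sorted_map; apply: sub_path pp => a b.
    by rewrite /= /induced_adj adjE.
  - move=> u; apply/mapP/mapP => [[z _ ->]|[z]].
      by exists (val z) => //; rewrite mem_enum (valP z).
    by rewrite mem_enum => zX ->; exists (exist _ z zX); [apply: ap|].
have [s Es] : exists s : seq {x | x \in X}, map (fun z => val (val z)) s = q.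
  have Hq u : u \in q -> exists z : {x | x \in X}, val (val z) = u.
    rewrite mq => /mapP[z]; rewrite mem_enum => zX ->.
    by exists (exist _ z zX).
  elim: q Hq {sz uq sq mq} => [|u q IH] Hq; first by exists [::].
  have [|s <-] := IH; first by move=> v iv; apply: Hq; rewrite inE iv orbT.
  by have [z <-] := Hq u (mem_head _ _); exists (z :: s).
case: s Es => [|x p] Es; first by rewrite -Es in sz.
exists x, p; split.
- rewrite -Es sorted_map in sq; apply: sub_path sq => a b.
  by rewrite /= /induced_adj adjE.
- by rewrite -Es in uq; apply: map_uniq uq.
- move=> z; have : val (val z) \in q.
    by rewrite mq; apply: map_f; rewrite mem_enum (valP z).
  by rewrite -Es => /mapP[z' iz /val_inj/val_inj ->].
Qed.
End HamiltonianPaths.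

Section Instance.
Variables (K D : nat) (R : nat -> nat -> nat -> nat -> bool) (l t : nat).

(* Complete layers pad up to [l], and edgeless ones up to [t]. *)
Definition lay i u v :=
  if i == 0 then g1 K D R u v else if i == 1 then g2 K D u v else
  (i < l) && (u != v).

Lemma lay_sym i : symmetric (lay i).
Proof.
move=> u v; rewrite /lay; case: ifP => _; first exact: g1_sym.
by case: ifP => _; [exact: g2_sym|rewrite eq_sym].
Qed.

Lemma lay_irr i : irreflexive (lay i).
Proof.
move=> u; rewrite /lay; case: ifP => _; first exact: g1_irr.
by case: ifP => _; [exact: g2_irr|rewrite eqxx andbF].
Qed.

Definition nvert := nlev K * (D * D).

Definition layer (i : 'I_t) : sgraph 'I_nvert :=
  @SGraph 'I_nvert (fun u v => lay i u v)
    (fun u v => lay_sym i u v) (fun u => lay_irr i u).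

Definition ml_of_csp : ml_instance :=
  @MLInstance nvert t layer (nlev K) l.

Hypotheses (K_gt0 : 0 < K) (D_gt0 : 0 < D) (l_ge2 : 2 <= l) (l_le_t : l <= t).

Lemma uniq_sorted_neq (q : seq nat) : uniq q -> sorted (fun u v => u != v) q.
Proof.
case: q => //= x q; elim: q x => //= y q IH x /andP[].
rewrite inE negb_or => /andP[-> _] /andP[uy uq] /=.
by apply: IH; rewrite uy.
Qed.

(** An edgeless layer has no Hamiltonian path on two or more vertices. So the layers selected, at
    least [l] in number, are exactly the first [l], and these include the two that carry the
    constraints. *)
Lemma ml_of_csp_yes : ml_yes Hamiltonian ml_of_csp <-> csp_yes K D R.
Proof.
have nl2 : 1 < nlev K by rewrite /nlev addnC.
split=> [[X szX [S szS HS]]|[a [a_lt a_R]]].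
  rewrite /= in X szX S szS HS.
  have Sl i : i \in S -> i < l.
    move=> iS; have /(hamiltonian_induced (e := lay i)) [//|q [sz uq sq mq]] := HS i iS.
    case: (ltnP i l) => // lei; move: sq.
    have szq : 1 < size q.
      have : size (map val (enum X)) <= size q.
        apply: uniq_leq_size; first by rewrite map_inj_uniq ?enum_uniq //; apply: val_inj.
        by move=> u; rewrite mq.
      by rewrite size_map -cardE; apply: leq_trans; apply: leq_trans szX.
    case: q szq {sz uq mq} => [|x [|y q]] //= _; rewrite /lay.
    by rewrite !ifF ?(ltnNge i l) ?lei //; lia.
  have inS (i : 'I_t) : i < l -> i \in S.
    move=> lt; have sub : S \subset [set j : 'I_t | j < l].
      by apply/subsetP => j /Sl; rewrite inE.
    have cl : #|[set j : 'I_t | j < l]| <= l.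
      rewrite cardE -(size_map val) -[l in _ <= l](size_iota 0).
      apply: uniq_leq_size; first by rewrite map_inj_uniq ?enum_uniq //; apply: val_inj.
      by move=> u /mapP[j]; rewrite mem_enum inE => ltj ->; rewrite mem_iota.
    have /eqP -> : S == [set j : 'I_t | j < l].
      by rewrite eqEcard sub; apply: leq_trans szS.
    by rewrite inE.
  have lt0 : 0 < t by lia.
  have lt1 : 1 < t by lia.
  have /(hamiltonian_induced (e := g1 K D R)) [//|q [sz uq sq mq]] := HS (Ordinal lt0) (inS (Ordinal lt0) (ltnW l_ge2)).
  have /(hamiltonian_induced (e := g2 K D)) [//|q2 [_ _ sq2 mq2]] := HS (Ordinal lt1) (inS (Ordinal lt1) l_ge2).
  apply: (@csp_of_paths _ _ _ K_gt0 D_gt0 q q2) => //.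
  - move=> u; rewrite mq => /mapP[z _ ->]; rewrite /lv ltn_divLR ?muln_gt0 ?D_gt0 //.
    exact: ltn_ord.
  - apply: leq_trans szX _; rewrite cardE -(size_map val); apply: uniq_leq_size.
      by rewrite map_inj_uniq ?enum_uniq //; apply: val_inj.
    by move=> u; rewrite mq.
  - by move=> u; rewrite mq2 mq.
have [q [q2 [ltq [uq szq] sq [uq2 mq2] sq2]]] := paths_of_csp K_gt0 D_gt0 a_lt a_R.
pose X : {set 'I_nvert} := [set u | val u \in q].
have mX u : (u \in q) = (u \in map val (enum X)).
  apply/idP/mapP => [iu|[z]]; last by rewrite mem_enum inE => iz ->.
  by exists (Ordinal (ltq _ iu)) => //; rewrite mem_enum inE.
exists X.
  rewrite /= -szq cardE -(size_map val); apply: uniq_leq_size => // u.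
  by rewrite mX.
exists [set i : 'I_t | i < l].
  rewrite /= cardE -(size_map val) -[l in l <= _](size_iota 0).
  apply: uniq_leq_size (iota_uniq _ _) _ => i; rewrite mem_iota => /andP[_ lt].
  have ltt : i < t by apply: leq_trans l_le_t.
  by apply/mapP; exists (Ordinal ltt) => //; rewrite mem_enum inE.
move=> i; rewrite inE /= => lt.
have sz0 : 0 < size q by rewrite szq ltnW.
apply/(hamiltonian_induced (e := lay i)) => //.
case e0 : (val i == 0).
  by exists q; split=> //; rewrite /lay e0.
case e1 : (val i == 1).
  exists q2; split=> //.
  - by rewrite -(perm_size (uniq_perm uq uq2 (fun u => esym (mq2 u)))).
  - by rewrite /lay e0 e1.
  - by move=> u; rewrite mq2 mX.
exists q; split=> //; apply: sub_sorted (uniq_sorted_neq uq) => u v ne.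
by rewrite /lay e0 e1 lt.
Qed.

End Instance.

(** * The code of the instance *)

Lemma code_nats_inj : injective code_nats.
Proof.
elim=> [|m s IH] [|n s'] //; rewrite ?code_nats_cons; first by case: n.
  by case: m.
elim: m n => [|m IHm] [|n] //=; first by case=> /IH ->.
by case=> /IHm [-> ->].
Qed.

Lemma flatten_mkseq (T : Type) (f : nat -> nat -> T) m n :
  flatten (mkseq (fun i => mkseq (f i) n) m) = mkseq (fun e => f (e %/ n) (e %% n)) (m * n).
Proof.
elim: m => [|m IH]; first by rewrite mul0n.
rewrite -addn1 mulnDl mul1n /mkseq iotaD map_cat flatten_cat -/(mkseq _ m) IH.
rewrite iotaD map_cat /= cats0 add0n; congr (_ ++ _).
rewrite /mkseq -[m * n]addn0 (iotaDl (m * n) 0) -map_comp; apply/eq_in_map => i.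
rewrite mem_iota => /andP[_ lt] /=.
by rewrite divnMDl ?(leq_ltn_trans _ lt) // divn_small // addn0 modnMDl modn_small.
Qed.

Lemma map_enum_ord (T : Type) (f : nat -> T) n :
  [seq f (nat_of_ord v) | v <- enum 'I_n] = mkseq f n.
Proof. by rewrite /mkseq -val_enum_ord -map_comp. Qed.

Lemma shape_rows (n : nat) (r : seq (seq nat)) :
  all (fun s => size s == n) r -> shape r = nseq (size r) n.
Proof. by elim: r => //= s r IH /andP[/eqP -> /IH ->]. Qed.

(** Needed because the problem quantifies over all instances with the given code. Such instances
    need not be equal, but their layers have the same edges. *)
Lemma ml_yes_code (I J : ml_instance) : code_ml I = code_ml J ->
  ml_yes Hamiltonian I -> ml_yes Hamiltonian J.
Proof.
case: I J => n t L k l [n' t' L' k' l']; rewrite /code_ml /=.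
move/code_nats_inj => [en et ek el]; subst n' t' k' l' => efl.
pose row (M : 'I_t -> sgraph 'I_n) i u := [seq nat_of_bool (M i u v) | v <- enum 'I_n].
pose blk M i := flatten [seq row M i u | u <- enum 'I_n].
have shr M i : shape [seq row M i u | u <- enum 'I_n] = nseq n n.
  rewrite (@shape_rows n); first by rewrite size_map size_enum_ord.
  by rewrite all_map; apply/allP => u _ /=; rewrite size_map size_enum_ord.
have shb M : shape [seq blk M i | i <- enum 'I_t] = nseq t (n * n).
  rewrite (@shape_rows (n * n)); first by rewrite size_map size_enum_ord.
  by rewrite all_map; apply/allP => u _ /=; rewrite /blk size_flatten shr sumn_nseq.
have Hb : [seq blk L i | i <- enum 'I_t] = [seq blk L' i | i <- enum 'I_t].
  by apply: eq_from_flatten_shape; rewrite ?shb.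
have HL i u v : L i u v = L' i u v.
  have e1 : blk L i = blk L' i by move/eq_in_map: Hb; apply; rewrite mem_enum.
  have e2 : [seq row L i u | u <- enum 'I_n] = [seq row L' i u | u <- enum 'I_n].
    by apply: eq_from_flatten_shape; rewrite ?shr.
  have e3 : row L i u = row L' i u by move/eq_in_map: e2; apply; rewrite mem_enum.
  have : nat_of_bool (L i u v) = L' i u v by move/eq_in_map: e3; apply; rewrite mem_enum.
  by case: (L i u v); case: (L' i u v).
case=> X szX [S szS HS]; exists X => //; exists S => // i /HS [x [p [pp up ap]]].
exists x, p; split=> //; apply: sub_path pp => a b.
by rewrite /= /induced_adj HL.
Qed.

Theorem ml_by_k_csp K D R l t : 0 < K -> 0 < D -> 2 <= l -> l <= t ->
  forall k, ml_subgraph_by_k Hamiltonian l t (code_ml (ml_of_csp K D R l t)) k <->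
    k = nlev K /\ csp_yes K D R.
Proof.
move=> K0 D0 l2 lt k; split=> [[I [ec [et el] ek _ yes]]|[-> yes]].
  split.
    by move: ec; rewrite /code_ml => /code_nats_inj[_ _ -> _ _].
  by apply/(ml_of_csp_yes R K0 D0 l2 lt); apply: ml_yes_code yes.
exists (ml_of_csp K D R l t); split=> //.
  by split; [rewrite /= /nlev addn_gt0 orbT|apply: ltnW].
exact/(ml_of_csp_yes R K0 D0 l2 lt).
Qed.

(** After the four header fields, the index is read in base [n] as layer, row and column. *)
Definition ml_field K D R l t e :=
  let n := nvert K D in
  if e == 0 then n else if e == 1 then t else if e == 2 then nlev K else
  if e == 3 then l else
  lay K D R l ((e - 4) %/ n %/ n) ((e - 4) %/ n %% n) ((e - 4) %% n) : nat.

Lemma code_ml_of_csp K D R l t :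
  code_ml (ml_of_csp K D R l t) =
  code_nats (mkseq (ml_field K D R l t) (4 + t * nvert K D * nvert K D)).
Proof.
rewrite /code_ml /=; set n := nvert K D; congr code_nats.
rewrite /mkseq iotaD map_cat /=; congr [:: _, _, _, _ & _].
rewrite (eq_map (g := fun i : 'I_t => flatten (mkseq (fun u =>
   mkseq (fun v => lay K D R l i u v : nat) n) n))); last first.
  move=> i; rewrite -map_enum_ord; congr flatten; apply: eq_map => u.
  by rewrite -map_enum_ord.
rewrite (map_enum_ord (fun i => flatten (mkseq (fun u =>
   mkseq (fun v => lay K D R l i u v : nat) n) n))).
have -> : mkseq (fun i => flatten (mkseq (fun u => mkseq (fun v => lay K D R l i u v : nat) n) n)) t =
  mkseq (fun i => mkseq (fun e => lay K D R l i (e %/ n) (e %% n) : nat) (n * n)) t.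
  by apply: eq_map => i; rewrite flatten_mkseq.
rewrite flatten_mkseq -mulnA /mkseq.
have -> : iota 4 (t * (n * n)) = map (addn 4) (iota 0 (t * (n * n))) by rewrite -iotaDl.
rewrite -map_comp.
apply/eq_in_map => e; rewrite mem_iota => /andP[_ lt] /=.
rewrite /ml_field /= subSS !subnS subn0 /= -/n.
have n0 : 0 < n by case: (n) lt => //; rewrite !muln0.
rewrite -divnMA; congr (nat_of_bool (lay K D R l _ _ _)).
- by rewrite modn_divl.
- by rewrite modn_dvdm // dvdn_mulr.
Qed.

Opaque divn modn muln addn subn expn.

(** * Computing the instance from the constraints *)

Section PFReduction.
Variables (K D : word -> nat -> nat)
  (R : word -> nat -> nat -> nat -> nat -> nat -> bool) (l t : nat).
Hypotheses
  (PK : forall (C : ctx) (k : C -> nat), PF k -> PF (fun a => K (cw a) (k a)))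
  (PD : forall (C : ctx) (k : C -> nat), PF k -> PF (fun a => D (cw a) (k a)))
  (PR : forall (C : ctx) (k i j v w : C -> nat),
     PF k -> PF i -> PF j -> PF v -> PF w ->
     PB (fun a => R (cw a) (k a) (i a) (j a) (v a) (w a))).

Section Ctx.
Variables (C : ctx) (k : C -> nat).
Hypothesis Pk : PF k.
Local Notation Ka := (fun a : C => K (cw a) (k a)).
Local Notation Da := (fun a : C => D (cw a) (k a)).
Let PKa : PF Ka := PK Pk.
Let PDa : PF Da := PD Pk.

Lemma PF_nlev : PF (fun a => nlev (K (cw a) (k a))).
Proof. by rewrite /nlev; pf. Qed.

Lemma PF_nvert : PF (fun a => nvert (K (cw a) (k a)) (D (cw a) (k a))).
Proof. by rewrite /nvert /nlev; pf. Qed.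

Lemma PF_pos L : PF L -> PF (fun a => pos (K (cw a) (k a)) (L a)).
Proof. by move=> PL; rewrite /pos /transpose; pf. Qed.

Lemma PF_lv u : PF u -> PF (fun a => lv (D (cw a) (k a)) (u a)).
Proof. by move=> Pu; rewrite /lv; pf. Qed.

Lemma PF_vl u : PF u -> PF (fun a => vl (D (cw a) (k a)) (u a)).
Proof. by move=> Pu; rewrite /vl; pf. Qed.

Lemma PB_single L : PF L -> PB (fun a => single (K (cw a) (k a)) (L a)).
Proof. by move=> PL; rewrite /single; pf. Qed.

Lemma PB_active u : PF u -> PB (fun a => active (K (cw a) (k a)) (D (cw a) (k a)) (u a)).
Proof.
move=> Pu; apply: PB_imp; first by apply: PB_single; apply: PF_lv.
by apply: PB_eqn (PF_const _ _); apply: PF_vl.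
Qed.

Lemma PB_cell_ok p x : PF p -> PF x ->
  PB (fun a => cell_ok (K (cw a) (k a)) (D (cw a) (k a)) (R (cw a) (k a)) (p a) (x a)).
Proof. by move=> Pp Px; apply: PB_and; [apply: PR|]; pf. Qed.

Lemma PB_e1 u v : PF u -> PF v ->
  PB (fun a => e1 (K (cw a) (k a)) (D (cw a) (k a)) (R (cw a) (k a)) (u a) (v a)).
Proof.
move=> Pu Pv; rewrite /e1.
have Plu := PF_lv Pu; have Plv := PF_lv Pv; have Pvu := PF_vl Pu; have Pvv := PF_vl Pv.
have Psu := PB_single Plu; have Psv := PB_single Plv.
have Pau := PB_active Pu; have Pav := PB_active Pv.
have Pc : PB (fun a => cell_ok (K (cw a) (k a)) (D (cw a) (k a)) (R (cw a) (k a))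
   (lv (D (cw a) (k a)) (u a) %/ 3 - 4) (vl (D (cw a) (k a)) (u a))).
  by apply: PB_cell_ok => //; pf.
by pf.
Qed.

Lemma PB_e2 u v : PF u -> PF v ->
  PB (fun a => e2 (K (cw a) (k a)) (D (cw a) (k a)) (u a) (v a)).
Proof.
move=> Pu Pv; rewrite /e2.
have Plu := PF_lv Pu; have Plv := PF_lv Pv; have Pvu := PF_vl Pu; have Pvv := PF_vl Pv.
have Ppu := PF_pos Plu; have Ppv := PF_pos Plv.
have Pau := PB_active Pu; have Pav := PB_active Pv.
by pf.
Qed.

Lemma PB_lay i u v : PF i -> PF u -> PF v ->
  PB (fun a => lay (K (cw a) (k a)) (D (cw a) (k a)) (R (cw a) (k a)) l (i a) (u a) (v a)).
Proof.
move=> Pi Pu Pv; rewrite /lay /g1 /g2.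
have E1 := PB_e1 Pu Pv; have E1' := PB_e1 Pv Pu.
have E2 := PB_e2 Pu Pv; have E2' := PB_e2 Pv Pu.
by pf.
Qed.

Lemma PF_ml_field e : PF e ->
  PF (fun a => ml_field (K (cw a) (k a)) (D (cw a) (k a)) (R (cw a) (k a)) l t (e a)).
Proof.
move=> Pe; have Pn := PF_nvert; have Pl := PF_nlev; rewrite /ml_field.
have := PB_lay (i := fun a => (e a - 4) %/ nvert (K (cw a) (k a)) (D (cw a) (k a)) %/
                                nvert (K (cw a) (k a)) (D (cw a) (k a)))
  (u := fun a => (e a - 4) %/ nvert (K (cw a) (k a)) (D (cw a) (k a)) %%
                                nvert (K (cw a) (k a)) (D (cw a) (k a)))
  (v := fun a => (e a - 4) %% nvert (K (cw a) (k a)) (D (cw a) (k a))).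
move=> H; have {}H := H ltac:(pf) ltac:(pf) ltac:(pf).
by pf.
Qed.
End Ctx.

(** The common last stage: [M] is a trivial copying machine for NP-hardness and a given
    parameterized reduction for W[1]-hardness. *)
Theorem reduce_csp (M : tm) : exists M' c, forall ins x k T, size ins <= 2 ->
  computes_within M ins [:: x; unary k] T ->
  computes_within M' ins
    [:: code_ml (ml_of_csp (K x k) (D x k) (R x k) l t); unary (nlev (K x k))]
    (sumn (map size ins) * 12 + T + (size x + k).+2 ^ c).
Proof.
have Pk : PF (C := base) snd by apply: (PF_var base 0).
have Pk1 : PF (C := ext base) (fun p => p.1.2) by apply: (PF_var (ext base) 1).
have Pn := PF_nvert Pk.
have PN : PF (C := base) (fun a => 4 + t * nvert (K a.1 a.2) (D a.1 a.2) * nvert (K a.1 a.2) (D a.1 a.2)).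
  by pf.
have [M' [c H]] := compose_tm M PN (PF_nlev Pk) (F := fun a e => ml_field (K a.1 a.2) (D a.1 a.2) (R a.1 a.2) l t e)
  (PF_ml_field Pk1 (PF_var0 base)).
exists M', c => ins x k T szi cM; rewrite code_ml_of_csp.
exact: (H ins x k T szi cM).
Qed.
End PFReduction.

Transparent divn modn muln addn subn expn.

(** * NP-hardness *)

Section Cells.
Variable E : finType.
Implicit Types tp : tape E.

(* The symbol at absolute position [p] when the head stands at position [h]. *)
Definition cell tp h p : symbol E :=
  if p < h then nth None (tape_left tp) (h - p.+1)
  else nth None (tape_head tp :: tape_right tp) (p - h).

Definition move_pos (m : move) h :=
  match m with MoveL => h.-1 | Stay => h | MoveR => h.+1 end.

Lemma cell_head tp h : cell tp h h = tape_head tp.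
Proof. by rewrite /cell ltnn subnn. Qed.

Lemma cell_step tp a h p : 0 < h ->
  cell (tape_step tp a) (move_pos a.2 h) p = if p == h then a.1 else cell tp h p.
Proof.
case: tp a h => l x r [s m] [//|h] _ /=; rewrite /cell; case: m => /=.
- case: (ltngtP p h) => [lt|gt|->].
  + rewrite (ltn_trans lt (ltnSn h)) ltn_eqF ?(ltn_trans lt) //.
    by rewrite nth_behead subSS subnSK.
  + case: eqP => [->|ne]; first by rewrite subSnn.
    have -> : p < h.+1 = false by lia.
    have -> : p - h = (p - h.+2).+2 by lia.
    by have -> : p - h.+1 = (p - h.+2).+1 by lia.
  + by rewrite subnn /= ltnSn ltn_eqF // subnn nth0.
- case: eqP => [->|ne]; first by rewrite ltnn subnn.
  by case: ltnP => // le; have -> : p - h.+1 = (p - h.+2).+1 by lia.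
- case: (ltngtP p h.+1) => [lt|gt|->].
  + rewrite (ltn_trans lt (ltnSn _)).
    by have -> : h.+2 - p.+1 = (h.+1 - p.+1).+1 by lia.
  + have -> : p < h.+2 = false by lia.
    have -> : p - h.+1 = (p - h.+2).+1 by lia.
    by case: (p - h.+2) => [|k] /=; rewrite ?nth0 ?nth_behead.
  + by rewrite ltnSn subnn.
Qed.

Lemma cell_word w O p : cell (tape_of_word E w) O p =
  if p < O then None else nth None (map (@cell_bit E) w) (p - O).
Proof.
rewrite /cell; case: ltnP => _; first by rewrite nth_nil.
exact: (proj2 (clean_of_word E w)).
Qed.

Definition is_bit (s : symbol E) := if s is Some (inl _) then true else false.

Lemma leading_bits_prefix (s : seq (symbol E)) :
  (forall q, is_bit (nth None s q) || (nth None s q == None)) ->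
  (forall q, is_bit (nth None s q.+1) -> is_bit (nth None s q)) ->
  forall q, nth None s q = nth None (map (@cell_bit E) (leading_bits s)) q.
Proof.
elim: s => [|x s IH] H1 H2 q; first by rewrite nth_nil.
case: x H1 H2 => [[b|e]|] H1 H2; last first.
- have nb : forall j, ~~ is_bit (nth None (None :: s) j).
    by elim=> // j IHj; apply: contra (H2 j) IHj.
  by rewrite /= nth_nil; have := H1 q; rewrite (negbTE (nb q)) => /eqP.
- by have := H1 0.
case: q => //= q; apply: IH => j; [exact: (H1 j.+1)|exact: (H2 j.+1)].
Qed.
End Cells.

(** * The tableau of a run and its binary constraints *)

Section Tableau.
Variable M : tm.
Local Notation mt := (tm_tapes M).
Local Notation E := (tm_extra M).
Local Notation sym := (symbol E).

Definition scan : finType := (tm_state M * {ffun 'I_mt -> sym})%type.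
(* A tableau entry: the state and the scanned symbols at its time, and for each
   tape the symbol at its position with a flag telling whether the head is there. *)
Definition entry : finType := (scan * {ffun 'I_mt -> sym * bool})%type.

Definition action (s : scan) : tm_state M * {ffun 'I_mt -> sym * move} :=
  if tm_halt s.1 then (s.1, [ffun i => (s.2 i, Stay)]) else tm_trans s.1 s.2.

Definition scan_of (c : config M) : scan := (c.1, [ffun i => tape_head (c.2 i)]).

Lemma tm_stepE (c : config M) : tm_step c =
  ((action (scan_of c)).1, [ffun i => tape_step (c.2 i) ((action (scan_of c)).2 i)]).
Proof.
rewrite /tm_step /action /scan_of /=; case: ifP => //= _.
case: c => q tp; congr pair; apply/ffunP => i; rewrite !ffunE /=.
by case: (tp i).
Qed.

Definition mv_is (m m' : move) :=
  match m, m' with MoveL, MoveL | Stay, Stay | MoveR, MoveR => true | _, _ => false end.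

Lemma mv_isP m m' : mv_is m m' -> m = m'. Proof. by case: m; case: m'. Qed.

Definition r_same (a b : entry) := a.1 == b.1.
Definition r_state (a b : entry) := b.1.1 == (action a.1).1.
Definition r_sym (a b : entry) :=
  [forall i, (b.2 i).1 == if (a.2 i).2 then ((action a.1).2 i).1 else (a.2 i).1].
Definition r_mv m (a b : entry) :=
  [forall i, (a.2 i).2 && mv_is ((action a.1).2 i).2 m ==> (b.2 i).2].
(** The moves only force a flag at the new head position; this relation clears the flag everywhere
    else at that time. *)
Definition r_uniq (a b : entry) := [forall i, ~~ ((a.2 i).2 && (b.2 i).2)].
Definition r_read (a b : entry) := [forall i, (a.2 i).2 ==> ((a.2 i).1 == a.1.2 i)].
Definition r_start (a b : entry) := (a.1.1 == tm_start M) &&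
  [forall i : 'I_mt, (1 < i) ==> ((a.2 i).1 == None)].
Definition r_flag f (a b : entry) := [forall i, (a.2 i).2 == f].
Definition r_in s (a b : entry) := [forall i : 'I_mt, (val i == 0) ==> ((a.2 i).1 == s)].
Definition r_cert (a b : entry) :=
  [forall i : 'I_mt, (val i == 1) ==> is_bit (a.2 i).1 || ((a.2 i).1 == None)].
Definition r_blank (a b : entry) := [forall i : 'I_mt, (val i == 1) ==> ((a.2 i).1 == None)].
Definition r_prefix (a b : entry) :=
  [forall i : 'I_mt, (val i == 1) ==> is_bit (b.2 i).1 ==> is_bit (a.2 i).1].
(** Jointly with [r_end] it says that the output word is exactly the one bit [true]. *)
Definition r_halt (a b : entry) := tm_halt a.1.1 &&
  [forall i : 'I_mt, (val i == 0) && (a.2 i).2 ==> ((a.2 i).1 == Some (inl true))].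
Definition r_end (a b : entry) :=
  [forall i : 'I_mt, (val i == 0) && (a.2 i).2 ==> ~~ is_bit (b.2 i).1].

(** Every entry records the state and all scanned symbols of its time, so a single entry determines
    the whole action. A cell of the next time then depends on one entry only, which makes all
    constraints binary. At time 0 tape 0 holds [x], tape 1 holds at most [B] freely chosen bits
    without gaps, and the other tapes are blank. *)
Definition local_ok (x : word) T B t p t' p' (a b : entry) : bool :=
  [&& (t == t') ==> r_same a b, (t' == t.+1) ==> r_state a b,
      (t' == t.+1) && (p' == p) ==> r_sym a b,
      (t' == t.+1) && (p' == p) ==> r_mv Stay a b,
      (t' == t.+1) && (p' == p.+1) ==> r_mv MoveR a b,
      (t' == t.+1) && (p == p'.+1) ==> r_mv MoveL a b,
      (t == t') && (p != p') ==> r_uniq a b,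
      (t == t') && (p == p') ==> r_read a b,
      (t == 0) ==> r_start a b,
      (t == 0) && (p == T.+1) ==> r_flag true a b,
      (t == 0) && (p != T.+1) ==> r_flag false a b,
      [&& t == 0, T < p, p - T.+1 < size x & nth false x (p - T.+1)]
        ==> r_in (Some (inl true)) a b,
      [&& t == 0, T < p, p - T.+1 < size x & ~~ nth false x (p - T.+1)]
        ==> r_in (Some (inl false)) a b,
      (t == 0) && ~~ ((T < p) && (p - T.+1 < size x)) ==> r_in None a b,
      (t == 0) ==> r_cert a b,
      (t == 0) && ~~ ((T < p) && (p - T.+1 < B)) ==> r_blank a b,
      [&& t == 0, t' == 0, T < p & p' == p.+1] ==> r_prefix a b,
      (t == T) ==> r_halt a b &
      [&& t == T, t' == T & p' == p.+1] ==> r_end a b].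

Record local_spec (x : word) T B t p t' p' (a b : entry) : Prop := LocalSpec {
  ls_same : t = t' -> r_same a b;
  ls_state : t' = t.+1 -> r_state a b;
  ls_sym : t' = t.+1 -> p' = p -> r_sym a b;
  ls_stay : t' = t.+1 -> p' = p -> r_mv Stay a b;
  ls_right : t' = t.+1 -> p' = p.+1 -> r_mv MoveR a b;
  ls_left : t' = t.+1 -> p = p'.+1 -> r_mv MoveL a b;
  ls_uniq : t = t' -> p != p' -> r_uniq a b;
  ls_read : t = t' -> p = p' -> r_read a b;
  ls_start : t = 0 -> r_start a b;
  ls_flag : t = 0 -> r_flag (p == T.+1) a b;
  ls_bit : t = 0 -> T < p -> p - T.+1 < size x ->
    r_in (Some (inl (nth false x (p - T.+1)))) a b;
  ls_out : t = 0 -> ~~ ((T < p) && (p - T.+1 < size x)) -> r_in None a b;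
  ls_cert : t = 0 -> r_cert a b;
  ls_blank : t = 0 -> ~~ ((T < p) && (p - T.+1 < B)) -> r_blank a b;
  ls_prefix : t = 0 -> t' = 0 -> T < p -> p' = p.+1 -> r_prefix a b;
  ls_halt : t = T -> r_halt a b;
  ls_end : t = T -> t' = T -> p' = p.+1 -> r_end a b }.

Lemma local_okP x T B t p t' p' a b : local_ok x T B t p t' p' a b ->
  local_spec x T B t p t' p' a b.
Proof.
rewrite /local_ok => /and5P[h1 h2 h3 h4] /and5P[h5 h6 h7 h8] /and5P[h9 h10 h11 h12].
move=> /and5P[h13 h14 h15 h16] /and3P[h17 h18 h19].
split.
- by move=> e; move: h1; rewrite e eqxx.
- by move=> e; move: h2; rewrite e eqxx.
- by move=> e e'; move: h3; rewrite e e' !eqxx.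
- by move=> e e'; move: h4; rewrite e e' !eqxx.
- by move=> e e'; move: h5; rewrite e e' !eqxx.
- by move=> e e'; move: h6; rewrite e e' !eqxx.
- by move=> e e'; move: h7; rewrite e e' !eqxx.
- by move=> e e'; move: h8; rewrite e e' !eqxx.
- by move=> e; move: h9; rewrite e eqxx.
- by move=> e; move: h10 h11; rewrite e eqxx; case: (p == T.+1).
- by move=> e l1 l2; move: h12 h13; rewrite e eqxx l1 l2; case: nth.
- by move=> e l1; move: h14; rewrite e eqxx l1.
- by move=> e; move: h15; rewrite e eqxx.
- by move=> e l1; move: h16; rewrite e eqxx l1.
- by move=> e e' l1 e2; move: h17; rewrite e e' l1 e2 !eqxx.
- by move=> e; move: h18; rewrite e eqxx.
- by move=> e e' e2; move: h19; rewrite e e' e2 !eqxx.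
Qed.

Definition entry0 : entry := ((tm_start M, [ffun=> None]), [ffun=> (None, false)]).
Definition entry_of v : entry := nth entry0 (enum entry) v.

(** From [T.+1] the head reaches only positions [1] to [T + T + 1] in [T] steps; the cell to its
    right is also inspected at the end. *)
Definition width T := T + T + 3.
Definition tab_rel x T B i j v w :=
  local_ok x T B (i %/ width T) (i %% width T) (j %/ width T) (j %% width T)
    (entry_of v) (entry_of w).

Section Run.
Variables (x y : word) (T B : nat).

Definition conf n := iter n (@tm_step M) (tm_init M [:: x; y]).
Fixpoint hpos n (i : 'I_mt) := if n is n'.+1
  then move_pos ((action (scan_of (conf n'))).2 i).2 (hpos n' i) else T.+1.

Lemma hpos_bounds n i : n <= T -> T.+1 - n <= hpos n i <= T.+1 + n.
Proof.
elim: n => [|n IH] le /=; first by rewrite subn0 addn0 leqnn.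
have /andP[h1 h2] := IH (ltnW le).
by case: (((action _).2 i).2) => /=; apply/andP; split; lia.
Qed.

Definition tableau n p : entry :=
  (scan_of (conf n), [ffun i => (cell ((conf n).2 i) (hpos n i) p, p == hpos n i)]).

Lemma tableau2 n p i :
  (tableau n p).2 i = (cell ((conf n).2 i) (hpos n i) p, p == hpos n i).
Proof. by rewrite ffunE. Qed.

Lemma tableau_cell_step n i p : n < T ->
  cell ((conf n.+1).2 i) (hpos n.+1 i) p =
  if p == hpos n i then ((action (scan_of (conf n))).2 i).1 else cell ((conf n).2 i) (hpos n i) p.
Proof.
move=> lt; rewrite /conf iterS tm_stepE -/(conf n) ffunE /= cell_step //.
by have := hpos_bounds i (ltnW lt); lia.
Qed.

Lemma tableau_cell0 i p : cell ((conf 0).2 i) (hpos 0 i) p =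
  if p < T.+1 then None else nth None (map (@cell_bit E) (nth [::] [:: x; y] i)) (p - T.+1).
Proof. by rewrite /conf /= ffunE cell_word. Qed.

Lemma word0P (tp : tape E) : word_of_tape tp = [:: true] <->
  tape_head tp = Some (inl true) /\ ~~ is_bit (nth None (tape_right tp) 0).
Proof.
rewrite /word_of_tape; case: tp => l [[[]|e]|] r /=; split=> //; try by case.
  by case: r => [|[[b|e]|] r].
by case=> _; case: r => [|[[b|e]|] r].
Qed.

Lemma cell_succ (tp : tape E) h : cell tp h h.+1 = nth None (tape_right tp) 0.
Proof. by rewrite /cell ltnNge leqnSn /= subSnn. Qed.

Lemma tableau_ok t p t' p' : t <= T -> t' <= T -> size y <= B ->
  tm_halt (conf T).1 ->
  (forall i : 'I_mt, val i = 0 -> word_of_tape ((conf T).2 i) = [:: true]) ->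
  local_ok x T B t p t' p' (tableau t p) (tableau t' p').
Proof.
move=> let_ let' szy hT wT; rewrite /local_ok.
have step_t : t' = t.+1 -> t < T by move=> e; rewrite -e.
apply/and5P; split; [| | | |apply/and5P; split; [| | | |apply/and5P; split; [| | | |
  apply/and5P; split; [| | | |apply/and3P; split]]]]; apply/implyP.
- by move/eqP=> <-; rewrite /r_same.
- move/eqP=> ->; apply/eqP; rewrite -[LHS]/((conf t.+1).1) -[conf t.+1]/(tm_step (conf t)).
  by rewrite tm_stepE.
- move=> /andP[/eqP e /eqP ->]; apply/forallP => i; rewrite e !tableau2.
  by rewrite tableau_cell_step ?step_t.
- move=> /andP[/eqP e /eqP ->]; apply/forallP => i; apply/implyP.
  rewrite e !tableau2 /= => /andP[/eqP <- /mv_isP em].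
  by rewrite em /=.
- move=> /andP[/eqP e /eqP ->]; apply/forallP => i; apply/implyP.
  rewrite e !tableau2 /= => /andP[/eqP <- /mv_isP em].
  by rewrite em /=.
- move=> /andP[/eqP e /eqP e2]; apply/forallP => i; apply/implyP.
  rewrite e !tableau2 /= => /andP[/eqP e3 /mv_isP em].
  by rewrite em /= -e3 e2.
- move=> /andP[/eqP <- ne]; apply/forallP => i; rewrite !tableau2 /=.
  by apply/negP => /andP[/eqP e1 /eqP e2]; rewrite e1 e2 eqxx in ne.
- move=> _; apply/forallP => i; apply/implyP; rewrite !tableau2 /= => /eqP ->.
  by rewrite cell_head ffunE.
- move/eqP=> ->; apply/andP; split=> //; apply/forallP => i; apply/implyP => lt.
  rewrite !tableau2 tableau_cell0; case: ifP => // _.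
  by rewrite (nth_default _ (_ : size [:: x; y] <= i)) //= nth_nil.
- by move=> /andP[/eqP -> /eqP ->]; apply/forallP => i; rewrite !tableau2 /= eqxx.
- by move=> /andP[/eqP -> /negbTE ne]; apply/forallP => i; rewrite !tableau2 /= ne.
- move=> /and4P[/eqP -> h1 h2 h3]; apply/forallP => i; apply/implyP => /eqP e0.
  rewrite !tableau2 tableau_cell0 [_ < _](_ : _ = false); last by lia.
  by rewrite -[nat_of_ord i]/(val i) e0 /= (nth_map false) // h3.
- move=> /and4P[/eqP -> h1 h2 h3]; apply/forallP => i; apply/implyP => /eqP e0.
  rewrite !tableau2 tableau_cell0 [_ < _](_ : _ = false); last by lia.
  by rewrite -[nat_of_ord i]/(val i) e0 /= (nth_map false) // (negbTE h3).
- move=> /andP[/eqP -> h1]; apply/forallP => i; apply/implyP => /eqP e0.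
  rewrite !tableau2 tableau_cell0 -[nat_of_ord i]/(val i) e0 /=; case: ltnP => // h2.
  by rewrite nth_default // size_map; move: h1 h2; clear; lia.
- move/eqP=> ->; apply/forallP => i; apply/implyP => /eqP e1.
  rewrite !tableau2 tableau_cell0 -[nat_of_ord i]/(val i) e1 /=; case: ltnP => // h2.
  have [lt|ge] := ltnP (p - T.+1) (size y); first by rewrite (nth_map false).
  by rewrite nth_default ?size_map // orbT.
- move=> /andP[/eqP -> h1]; apply/forallP => i; apply/implyP => /eqP e0.
  rewrite !tableau2 tableau_cell0 -[nat_of_ord i]/(val i) e0 /=; case: ltnP => // h2.
  by rewrite nth_default // size_map; move: h1 h2 szy; clear; lia.
- move=> /and4P[/eqP -> /eqP -> h1 /eqP ->]; apply/forallP => i; apply/implyP => /eqP e0.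
  rewrite !tableau2 !tableau_cell0 -[nat_of_ord i]/(val i) e0 /=.
  have -> : p.+1 < T.+1 = false by move: h1; clear; lia.
  have -> : p < T.+1 = false by move: h1; clear; lia.
  apply/implyP; have -> : p.+1 - T.+1 = (p - T.+1).+1 by move: h1; clear; lia.
  have [lt|ge] := ltnP (p - T.+1) (size y); first by rewrite [X in _ -> is_bit X](nth_map false).
  by rewrite nth_default // size_map; apply: leqW.
- move/eqP=> ->; apply/andP; split=> //; apply/forallP => i; apply/implyP.
  rewrite !tableau2 /= => /andP[/eqP e0 /eqP ->]; rewrite cell_head.
  by have [-> _] := (word0P _).1 (wT _ e0).
- move=> /and3P[/eqP -> /eqP -> /eqP ->]; apply/forallP => i; apply/implyP.
  rewrite !tableau2 /= => /andP[/eqP e0 /eqP ->]; rewrite cell_succ.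
  by have [_ ->] := (word0P _).1 (wT _ e0).
Qed.

Section Sound.
Variable b : nat -> nat -> entry.
Hypothesis Hb : forall t p t' p', t <= T -> p < width T -> t' <= T -> p' < width T ->
  local_ok x T B t p t' p' (b t p) (b t' p').
Hypothesis y_ok : forall (i : 'I_mt) p, val i = 1 -> p < width T ->
  (b 0 p).2 i = (cell ((conf 0).2 i) T.+1 p, p == T.+1).

Lemma T1_width : T.+1 < width T. Proof. by rewrite /width; lia. Qed.

(** All entries of one time agree on the scanned symbols, so each symbol can be checked at the entry
    under the head of its tape. *)
Lemma sound_scan t (h : 'I_mt -> nat) : t <= T ->
  (forall i, h i < width T) ->
  (forall i p, p < width T -> (b t p).2 i = (cell ((conf t).2 i) (h i) p, p == h i)) ->
  forall p, p < width T -> (b t p).1.2 = [ffun i => tape_head ((conf t).2 i)].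
Proof.
move=> let_ hw H p ltp; apply/ffunP => i; rewrite ffunE.
have /eqP -> := ls_same (local_okP (Hb let_ ltp let_ (hw i))) erefl.
have /forallP/(_ i) := ls_read (local_okP (Hb let_ (hw i) let_ (hw i))) erefl erefl.
by rewrite H // eqxx /= cell_head => /eqP ->.
Qed.

Lemma sound0 p : p < width T -> b 0 p = tableau 0 p.
Proof.
have H2 i q : q < width T -> (b 0 q).2 i = (cell ((conf 0).2 i) T.+1 q, q == T.+1).
  move=> ltq; case e1 : (val i == 1); first by apply: y_ok => //; apply/eqP.
  have S := local_okP (Hb (leq0n T) ltq (leq0n T) ltq).
  apply/eqP; rewrite [(b 0 q).2 i]surjective_pairing xpair_eqE; apply/andP; split; last first.
    by have /forallP/(_ i) := ls_flag S erefl.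
  rewrite (tableau_cell0 i q); case e0 : (val i == 0); last first.
    have gt1 : 1 < i by move: e0 e1 => /=; clear; case: (nat_of_ord i) => [|[|]].
    have /andP[_ /forallP/(_ i)] := ls_start S erefl; rewrite gt1 /= => /eqP ->.
    by rewrite (nth_default _ (_ : size [:: x; y] <= i)) //= nth_nil; case: ifP.
  have ei : nat_of_ord i = 0 by apply/eqP.
  rewrite ei /=; case: ltnP => [lt|le].
    have nq : ~~ ((T < q) && (q - T.+1 < size x)) by move: lt; clear; lia.
    by have /forallP/(_ i) := ls_out S erefl nq; rewrite e0.
  have gt : T < q by move: le; clear; lia.
  have [lt2|ge2] := ltnP (q - T.+1) (size x); last first.
    have nq : ~~ ((T < q) && (q - T.+1 < size x)) by rewrite gt -leqNgt.
    have /forallP/(_ i) := ls_out S erefl nq; rewrite e0 /= => /eqP ->.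
    by rewrite nth_default // size_map.
  rewrite (nth_map false) //.
  by have /forallP/(_ i) := ls_bit S erefl gt lt2; rewrite e0.
move=> ltp; apply/eqP; rewrite [b 0 p]surjective_pairing /tableau xpair_eqE; apply/andP; split; last first.
  by apply/eqP/ffunP => i; rewrite ffunE H2.
rewrite [(b 0 p).1]surjective_pairing /scan_of xpair_eqE.
rewrite (sound_scan (leq0n T) (h := fun=> T.+1)) ?eqxx ?andbT //; last by move=> _; exact: T1_width.
by have /andP[-> _] := ls_start (local_okP (Hb (leq0n T) ltp (leq0n T) ltp)) erefl.
Qed.

Lemma sound_step t : t < T -> (forall p, p < width T -> b t p = tableau t p) ->
  forall p, p < width T -> b t.+1 p = tableau t.+1 p.
Proof.
move=> ltT IH.
have hw n i : n <= T -> hpos n i < width T.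
  by move=> le; have := hpos_bounds i le; rewrite /width; move: le; clear; lia.
have nxt p q : p < width T -> q < width T -> local_spec x T B t p t.+1 q (tableau t p) (b t.+1 q).
  by move=> lp lq; rewrite -IH //; apply: local_okP; apply: Hb => //; apply: ltnW.
have fl i : ((b t.+1 (hpos t.+1 i)).2 i).2.
  have lw := hw t i (ltnW ltT); have lw' := hw t.+1 i ltT.
  have hb := hpos_bounds i (ltnW ltT).
  have S := nxt _ _ lw lw'; rewrite /= in S *.
  case em : (((action (scan_of (conf t))).2 i).2) S => /= S.
  (* The start at [T.+1] keeps the head off position 0, where a left move would not change the
     position. *)
  - have e : hpos t i = (hpos t i).-1.+1 by rewrite prednK //; move: ltT hb; clear; lia.
    by have /forallP/(_ i) := ls_left S erefl e; rewrite !tableau2 /= eqxx em.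
  - by have /forallP/(_ i) := ls_stay S erefl erefl; rewrite !tableau2 /= eqxx em.
  - by have /forallP/(_ i) := ls_right S erefl erefl; rewrite !tableau2 /= eqxx em.
have H2 i p : p < width T -> (b t.+1 p).2 i =
    (cell ((conf t.+1).2 i) (hpos t.+1 i) p, p == hpos t.+1 i).
  move=> ltp; apply/eqP; rewrite [(b t.+1 p).2 i]surjective_pairing xpair_eqE; apply/andP; split.
    have /forallP/(_ i)/eqP -> := ls_sym (nxt _ _ ltp ltp) erefl erefl.
    by rewrite tableau2 tableau_cell_step.
  case: (p =P hpos t.+1 i) => [->|/eqP ne]; first by rewrite fl.
  have /forallP/(_ i) := ls_uniq (local_okP (Hb ltT ltp ltT (hw t.+1 i ltT))) erefl ne.
  by rewrite fl andbT eqbF_neg.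
move=> p ltp; apply/eqP; rewrite [b t.+1 p]surjective_pairing /tableau xpair_eqE; apply/andP; split; last first.
  by apply/eqP/ffunP => i; rewrite ffunE H2.
rewrite [(b t.+1 p).1]surjective_pairing xpair_eqE.
rewrite (sound_scan ltT (h := hpos t.+1)) ?eqxx ?andbT //; last by move=> i; apply: hw.
have /eqP -> := ls_state (nxt _ _ ltp ltp) erefl.
by rewrite /= -/(conf t) tm_stepE.
Qed.

Lemma sound : tm_halt (conf T).1 /\
  forall i : 'I_mt, val i = 0 -> word_of_tape ((conf T).2 i) = [:: true].
Proof.
have H t : t <= T -> forall p, p < width T -> b t p = tableau t p.
  elim: t => [|t IH] le; first exact: sound0.
  by apply: sound_step => //; apply: IH; apply: ltnW.
have ok p q : p < width T -> q < width T -> local_spec x T B T p T q (tableau T p) (tableau T q).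
  by move=> lp lq; rewrite -!H //; apply: local_okP; apply: Hb.
split.
  by have /andP[] := ls_halt (ok _ _ T1_width T1_width) erefl.
move=> i e0; have hb := hpos_bounds i (leqnn T).
have l1 : hpos T i < width T by rewrite /width; move: hb; clear; lia.
have l2 : (hpos T i).+1 < width T by rewrite /width; move: hb; clear; lia.
have /andP[_ H1] := ls_halt (ok _ _ l1 l2) erefl.
have H2 := ls_end (ok _ _ l1 l2) erefl erefl erefl.
apply/word0P; have := forallP H1 i; have := forallP H2 i; rewrite !tableau2 /= -[nat_of_ord i]/(val i) e0 !eqxx /=.
by rewrite cell_head cell_succ => -> /eqP ->.
Qed.
End Sound.
End Run.
End Tableau.

(** * From tableaux to certificates and back *)

Section TableauCsp.
Variables (M : tm) (x : word) (T B : nat).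
Local Notation mt := (tm_tapes M).
Local Notation E := (tm_extra M).
Local Notation W := (width T).

Lemma size_leading_bits (s : seq (symbol E)) : size (leading_bits s) <= size s.
Proof. by elim: s => [|[[b|e]|] s IH]. Qed.

Lemma entry_of_index (a : entry M) : entry_of M (index a (enum (entry M))) = a.
Proof. by rewrite /entry_of nth_index // mem_enum. Qed.

Definition accepts (y : word) := tm_halt (conf M x y T).1 /\
  forall i : 'I_mt, val i = 0 -> word_of_tape ((conf M x y T).2 i) = [:: true].

(** At time 0 the constraints leave bits followed by blanks on tape 1; these bits are the
    certificate. *)
Lemma certificate (b : nat -> nat -> entry M) :
  (forall t p t' p', t <= T -> p < W -> t' <= T -> p' < W ->
    local_ok x T B t p t' p' (b t p) (b t' p')) ->
  exists2 y, size y <= B & forall (i : 'I_mt) p, val i = 1 -> p < W ->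
    (b 0 p).2 i = (cell ((conf M x y 0).2 i) T.+1 p, p == T.+1).
Proof.
move=> Hb; have S p q : p < W -> q < W -> local_spec x T B 0 p 0 q (b 0 p) (b 0 q).
  by move=> lp lq; apply: local_okP; apply: Hb.
(* If there is no second tape, the condition on the certificate is vacuous. *)
have [lt1|ge] := ltnP 1 mt; last first.
  exists [::] => // i p e; have := ltn_ord i; rewrite /= in e; rewrite e => l1.
  by have := leq_trans l1 ge; rewrite ltnn.
pose i1 := Ordinal lt1; pose g q := ((b 0 (T.+1 + q)).2 i1).1.
pose s := mkseq g (W - T.+1); pose y := leading_bits s.
have szs : size s = W - T.+1 by rewrite size_mkseq.
have ltW q : q < W - T.+1 -> T.+1 + q < W by rewrite /width; lia.
have nths q : q < W - T.+1 -> nth None s q = g q by move=> lt; rewrite nth_mkseq.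
have pre : forall q, nth None s q = nth None (map (@cell_bit E) y) q.
  apply: leading_bits_prefix => q.
    have [lt|ge] := ltnP q (W - T.+1); last by rewrite nth_default ?szs ?orbT.
    rewrite nths //; have /forallP/(_ i1) := ls_cert (S _ _ (ltW _ lt) (ltW _ lt)) erefl.
    exact.
  have [lt|ge] := ltnP q.+1 (W - T.+1); last by rewrite nth_default ?szs.
  rewrite !nths //; last exact: ltnW.
  have l1 := ltW _ (ltnW lt); have l2 := ltW _ lt.
  have /forallP/(_ i1) := ls_prefix (S _ _ l1 l2) erefl erefl (leq_addr _ _) (addnS _ _).
  by rewrite /= => /implyP.
exists y.
  (* A longer word would put a bit at position [T.+1 + B], against [r_blank]. *)
  rewrite leqNgt; apply/negP => gt.
  have ltB : B < W - T.+1 by rewrite -szs; apply: leq_trans gt (size_leading_bits s).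
  have nb : ~~ ((T < T.+1 + B) && (T.+1 + B - T.+1 < B)) by rewrite addKn ltnn andbF.
  have /forallP/(_ i1) := ls_blank (S _ _ (ltW _ ltB) (ltW _ ltB)) erefl nb.
  rewrite /= -/(g B) -nths // pre (nth_map false) //.
move=> i p e ltp; have -> : i = i1 by apply: val_inj.
apply/eqP; rewrite [(b 0 p).2 i1]surjective_pairing xpair_eqE; apply/andP; split; last first.
  by have /forallP/(_ i1) := ls_flag (S _ _ ltp ltp) erefl.
rewrite (tableau_cell0 x y T i1) /=; case: ltnP => [lt|le].
  have nb : ~~ ((T < p) && (p - T.+1 < B)) by move: lt; clear; lia.
  by have /forallP/(_ i1) := ls_blank (S _ _ ltp ltp) erefl nb.
rewrite -pre nths; last by move: ltp le; clear; lia.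
by rewrite /g subnKC.
Qed.

Lemma tableau_csp : csp_yes (T.+1 * W) #|entry M| (@tab_rel M x T B) <->
  exists2 y, size y <= B & accepts y.
Proof.
have W0 : 0 < W by rewrite /width addn3.
split=> [[a [a_lt a_R]]|[y szy [hT wT]]].
  pose b t p := entry_of M (a (t * W + p)).
  have Hb t p t' p' : t <= T -> p < W -> t' <= T -> p' < W ->
      local_ok x T B t p t' p' (b t p) (b t' p').
    move=> lt lp lt' lp'.
    have li : t * W + p < T.+1 * W by move: (W) lp => w; move: lt; clear; nia.
    have lj : t' * W + p' < T.+1 * W by move: (W) lp' => w; move: lt'; clear; nia.
    have := a_R _ _ li lj; rewrite /tab_rel !divnMDl // !modnMDl !divn_small // !modn_small //.
    by rewrite !addn0.
  have [y szy Hy] := certificate Hb.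
  by exists y => //; apply: (sound Hb Hy).
exists (fun i => index (tableau M x y T (i %/ W) (i %% W)) (enum (entry M))); split.
  by move=> i _; rewrite cardE index_mem mem_enum.
move=> i j li lj; rewrite /tab_rel !entry_of_index; apply: tableau_ok => //.
  by rewrite -ltnS ltn_divLR.
by rewrite -ltnS ltn_divLR.
Qed.
End TableauCsp.

(** The number of entries is a constant, so the relation is a lookup table. Numbers outside the
    range are cut to [D], which stands for the same default entry. *)
Lemma PB_tab2 (M : tm) (f : entry M -> entry M -> bool) (C : ctx) (v w : C -> nat) :
  PF v -> PF w -> PB (fun a => f (entry_of M (v a)) (entry_of M (w a))).
Proof.
move=> Pv Pw; set D := size (enum (entry M)).
pose cut n := if n < D then n else D.
have ecut n : entry_of M (cut n) = entry_of M n.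
  by rewrite /cut /entry_of; case: ltnP => // le; rewrite !nth_default.
have ltc n : cut n < D.+1 by rewrite ltnS /cut; case: ltnP => // /ltnW.
pose tbl := mkseq (fun e => f (entry_of M (e %/ D.+1)) (entry_of M (e %% D.+1)) : nat) (D.+1 * D.+1).
apply: (@PF_eq _ (fun a => nth 0 tbl (cut (v a) * D.+1 + cut (w a)))).
  move=> a; have := ltc (v a); have := ltc (w a); rewrite -(ecut (v a)) -(ecut (w a)).
  move: (cut (v a)) (cut (w a)) => n m lm ln.
  rewrite nth_mkseq; last by move: (D.+1) lm ln => d; clear; nia.
  by rewrite divnMDl // divn_small // addn0 modnMDl modn_small.
by apply: PF_tab; rewrite /cut; pf.
Qed.

Opaque divn modn muln addn subn expn.

Lemma PB_tab_rel (M : tm) (C : ctx) (T B i j v w : C -> nat) :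
  PF T -> PF B -> PF i -> PF j -> PF v -> PF w ->
  PB (fun a => @tab_rel M (cw a) (T a) (B a) (i a) (j a) (v a) (w a)).
Proof.
move=> PT PB_ Pi Pj Pv Pw; rewrite /tab_rel.
have Pw' : PF (fun a => width (T a)) by rewrite /width; pf.
have P1 : PF (fun a => i a %/ width (T a)) by pf.
have P2 : PF (fun a => i a %% width (T a)) by pf.
have P3 : PF (fun a => j a %/ width (T a)) by pf.
have P4 : PF (fun a => j a %% width (T a)) by pf.
have Ps : PF (fun a : C => size (cw a)) by apply: PF_size.
rewrite /local_ok.
repeat first [refine (PB_and _ _)]; (refine (PB_imp _ _); last by apply: PB_tab2); pf.
Qed.

Transparent divn modn muln addn subn expn.

(** * Assembling the polynomial-time reduction *)

Definition copy_tm : tm :=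
  @TM 2 unit unit tt xpredT (fun q h => (q, [ffun i => (h i, Stay)])).

(** The blank second tape reads as the parameter 0, a dummy in the unparameterized setting. *)
Lemma copy_tm_computes x : computes_within copy_tm [:: x] [:: x; unary 0] 0.
Proof.
apply/computes_withinP; split=> // -[[|[|i]] //= lt] _; rewrite ffunE /=.
  exact: word_of_tape_clean (clean_of_word _ _).
exact: word_of_tape_clean (clean_of_word _ _).
Qed.

(** For [n > 2] one has [n + 2 <= n ^ 2], whence the exponent [2 * m]; the summand [5 ^ m] takes
    care of [n <= 2]. *)
Lemma polybound_pow m : exists C, forall n, n.+2 ^ m <= polybound C n.
Proof.
exists (2 * m + 5 ^ m) => n; rewrite /polybound; set C := 2 * m + 5 ^ m.
have [le|gt] := leqP n 2.
  apply: (@leq_trans (5 ^ m)); first by apply: leq_exp2; lia.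
  by rewrite /C; move: (5 ^ m) (n ^ _) => u w; clear; lia.
apply: (@leq_trans (n ^ C)); last exact: leq_addr.
apply: (@leq_trans (n ^ (2 * m))).
  by rewrite expnM; apply: leq_exp2; rewrite expnS expn1; nia.
by rewrite leq_pexp2l ?leq_addr //; lia.
Qed.

Lemma polybound_mono c m n : m <= n -> polybound c m <= polybound c n.
Proof. by move=> le; rewrite /polybound leq_add2r leq_exp2. Qed.

Theorem ml_hamiltonian_NP_hard l t : 2 <= l -> l <= t ->
  NP_hard (ml_subgraph Hamiltonian l t).
Proof.
move=> l2 lt L [V [[M [c HM]] [c' HL]]].
pose Bx (x : word) := polybound c' (size x).
(* One time bound serves all admissible certificates, since halted configurations no longer
   change. *)
pose Tx (x : word) := polybound c (size x + Bx x).
pose K (x : word) (_ : nat) := (Tx x).+1 * width (Tx x).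
pose D (x : word) (_ : nat) := #|entry M|.
pose R (x : word) (_ : nat) := @tab_rel M x (Tx x) (Bx x).
have PBx (C : ctx) : PF (fun a : C => Bx (cw a)).
  by rewrite /Bx /polybound; have := PF_size C => H; pf.
have PTx (C : ctx) : PF (fun a : C => Tx (cw a)).
  by rewrite /Tx {1}/polybound; have := PBx C => H; have := PF_size C => H'; pf.
have PK (C : ctx) (k : C -> nat) : PF k -> PF (fun a => K (cw a) (k a)).
  by move=> _; rewrite /K /width; have := PTx C => H; pf.
have PD (C : ctx) (k : C -> nat) : PF k -> PF (fun a => D (cw a) (k a)).
  by move=> _; apply: PF_const.
have PR (C : ctx) (k i j v w : C -> nat) :
     PF k -> PF i -> PF j -> PF v -> PF w ->
     PB (fun a => R (cw a) (k a) (i a) (j a) (v a) (w a)).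
  by move=> _ Pi Pj Pv Pw; apply: PB_tab_rel.
have [M' [e HM']] := reduce_csp l t PK PD PR copy_tm.
have K0 x k : 0 < K x k by rewrite /K muln_gt0 /width addn3.
have D0 x k : 0 < D x k by apply/card_gt0P; exists (entry0 M).
exists (fun x => code_ml (ml_of_csp (K x 0) (D x 0) (R x 0) l t)); split.
  have [C HC] := polybound_pow (e + 4).
  exists M', C => x.
  have := HM' [:: x] x 0 0 isT (copy_tm_computes x).
  rewrite /= !addn0 => /(computes_within_prefix 1) /=.
  apply: computes_within_le; apply: leq_trans (HC (size x)).
  have : 0 < (size x).+2 ^ e by rewrite expn_gt0.
  rewrite expnD; move: (_ ^ e) => u u0.
  have : (size x * 12).+1 <= (size x).+2 ^ 4.
    by rewrite !expnS expn0 muln1; move: (size x) => n; clear; nia.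
  by move: (_ ^ 4) (size x * 12) => p q; move: u0; clear; nia.
move=> x; have mono (y : word) : size y <= Bx x -> polybound c (size x + size y) <= Tx x.
  by move=> le; apply: polybound_mono; rewrite leq_add2l.
have LV : L x <-> exists2 y, size y <= Bx x & accepts M x (Tx x) y.
  rewrite HL; split=> [[y [szy Vy]]|[y szy [hT wT]]]; exists y => //.
    have := computes_within_le (mono _ szy) (HM x y).
    move/computes_withinP => [h sz w]; split=> // i e0.
    by rewrite w /= -[nat_of_ord i]/(val i) e0 //= Vy.
  split=> //; have := computes_within_le (mono _ szy) (HM x y).
  move/computes_withinP => [h sz w]; have := w (Ordinal sz) isT.
  by rewrite -/(conf M x y (Tx x)) wT //= => -[].
rewrite LV -tableau_csp; split=> [yes|[k]].
  by exists (nlev (K x 0)); apply/(ml_by_k_csp _ (K0 x 0) (D0 x 0) l2 lt).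
by case/(ml_by_k_csp _ (K0 x 0) (D0 x 0) l2 lt).
Qed.

(** * W[1]-hardness *)

Definition zeros_before (w : word) p := count (fun i => ~~ nth false w i) (iota 0 p).
(* The fields of a code word are read off by counting its separators. *)
Definition field_at (w : word) j :=
  count (fun p => nth false w p && (zeros_before w p == j)) (iota 0 (size w)).
Definition nfields w := zeros_before w (size w).

(** A one-pass reading with [c] separators already seen, suited to induction on the word. *)
Fixpoint field_rec c (w : word) j : nat :=
  match w with
  | [::] => 0
  | true :: w' => (c == j) + field_rec c w' j
  | false :: w' => field_rec c.+1 w' j
  end.

Lemma zeros_before_cons b w p :
  zeros_before (b :: w) p.+1 = ~~ b + zeros_before w p.
Proof. by rewrite /zeros_before /= -[1]addn0 iotaDl count_map. Qed.

Lemma field_rec_count c w j : field_rec c w j =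
  count (fun p => nth false w p && (c + zeros_before w p == j)) (iota 0 (size w)).
Proof.
elim: w c => //= b w IH c; rewrite -[1]addn0 iotaDl count_map /= {1}/zeros_before /= addn0.
case: b => /=; rewrite IH; [congr addn|rewrite add0n]; apply: eq_count => p /=.
  by rewrite -[1 + p]/p.+1 zeros_before_cons add0n.
by rewrite zeros_before_cons add1n addnS.
Qed.

Lemma field_rec_code c s j :
  field_rec c (code_nats s) j = if j < c then 0 else nth 0 s (j - c).
Proof.
elim: s c => [|n s IH] c; first by rewrite nth_nil; case: ifP.
rewrite code_nats_cons; have -> : field_rec c (unary n ++ false :: code_nats s) j =
    (c == j) * n + field_rec c.+1 (code_nats s) j.
  elim: n => [|n IHn] /=; first by rewrite muln0.
  by rewrite IHn mulnS addnA.
rewrite IH; case: (ltngtP j c) => [lt|gt|->].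
- by rewrite ltnS (ltnW lt).
- by rewrite ltnS leqNgt gt /= -[in RHS](subnSK gt).
- by rewrite ltnSn subnn mul1n addn0.
Qed.

Lemma field_at_code s j : field_at (code_nats s) j = nth 0 s j.
Proof.
have := field_rec_code 0 s j; rewrite ltn0 subn0 => <-; rewrite field_rec_count.
by apply: eq_count => p; rewrite add0n.
Qed.

Lemma nfields_code s : nfields (code_nats s) = size s.
Proof.
have H w : nfields w = count negb w.
  rewrite /nfields /zeros_before -{3}(mkseq_nth false w) /mkseq count_map.
  exact: eq_count.
rewrite H; elim: s => //= n s IH; rewrite code_nats_cons count_cat /= IH.
by rewrite count_nseq.
Qed.

Lemma field_at_le w j : field_at w j <= size w.
Proof. by rewrite /field_at -[X in _ <= X](size_iota 0) count_size. Qed.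

Lemma code_nats_surj w : ~~ last false w -> exists s, w = code_nats s.
Proof.
(* Here [m] is the number of ones read since the last separator. *)
move=> lw; suff H m : ~~ last (0 < m) w -> exists s, unary m ++ w = code_nats s by apply: (H 0).
elim: w m {lw} => [|[] w IH] m /= lw.
- by exists [::]; case: m lw.
- have [s e] := IH m.+1 lw; exists s; rewrite -e /unary.
  by rewrite -[m.+1]addn1 nseqD -catA.
have [s e] := IH 0 lw; exists (m :: s).
by rewrite code_nats_cons -e.
Qed.

(** There are three header fields, and each gate takes two fields besides its wires. A gate can be
    located only by reading all earlier arities, hence the iteration. *)
Definition gate_start w j := iteri j (fun _ s => s + (2 + field_at w s.+1)) 3.
Definition gate_code w j := field_at w (gate_start w j).
Definition gate_arity w j := field_at w (gate_start w j).+1.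
Definition gate_arg w j i := field_at w (gate_start w j + (2 + i)).

Definition kind_of n := match n with 0 => GAnd | 1 => GOr | _ => GNot end.

Definition gate w j := (kind_of (gate_code w j), mkseq (gate_arg w j) (gate_arity w j)).
Definition decode w := Circuit (field_at w 0) (mkseq (gate w) (field_at w 2)) (field_at w 1).

Definition gate_fields (g : gate_kind * seq nat) := [:: code_gate_kind g.1, size g.2 & g.2].

Lemma kind_of_code g : kind_of (code_gate_kind g) = g. Proof. by case: g. Qed.
Lemma code_kind_of n : n <= 2 -> code_gate_kind (kind_of n) = n.
Proof. by case: n => [|[|[|]]]. Qed.

Section DecodeCode.
Variable C : circuit.
Let gs := c_gates C.
Let s := [:: c_inputs C, c_output C, size gs & flatten (map gate_fields gs)].
Let w := code_circuit C.

Lemma w_code : w = code_nats s. Proof. by []. Qed.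

Lemma drop_gate_start j : j <= size gs ->
  drop (gate_start w j) s = flatten (map gate_fields (drop j gs)).
Proof.
elim: j => [|j IH] lt; first by rewrite /= !drop0.
rewrite /gate_start iteriS -/(gate_start w j) w_code field_at_code -w_code.
have Hj := IH (ltnW lt); rewrite (drop_nth (GAnd, [::]) lt) /= in Hj.
have -> : nth 0 s (gate_start w j).+1 = size (nth (GAnd, [::]) gs j).2.
  by rewrite -addn1 -nth_drop Hj.
rewrite addnC -drop_drop Hj add2n /= drop_size_cat //.
Qed.

Lemma nth_gate_start j r : j < size gs ->
  nth 0 s (gate_start w j + r) = nth 0 (gate_fields (nth (GAnd, [::]) gs j) ++
    flatten (map gate_fields (drop j.+1 gs))) r.
Proof.
by move=> lt; rewrite -nth_drop drop_gate_start ?(ltnW lt) // (drop_nth (GAnd, [::]) lt).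
Qed.

Lemma decode_code : decode w = C.
Proof.
rewrite /decode w_code !field_at_code /= -w_code.
have -> : mkseq (gate w) (size gs) = gs; last by rewrite /gs; case: (C).
rewrite -[RHS](mkseq_nth (GAnd, [::])) ; apply/eq_in_map => j; rewrite mem_iota => /andP[_ lt].
rewrite /gate /gate_code /gate_arity /gate_arg w_code !field_at_code -w_code.
have h0 : nth 0 s (gate_start w j) = code_gate_kind (nth (GAnd, [::]) gs j).1.
  by rewrite -[gate_start w j]addn0 nth_gate_start.
have h1 : nth 0 s (gate_start w j).+1 = size (nth (GAnd, [::]) gs j).2.
  by rewrite -addn1 nth_gate_start.
rewrite h0 h1 kind_of_code.
case e : (nth _ gs j) => [g a] /=; congr pair.
rewrite -[RHS](mkseq_nth 0); apply/eq_in_map => i; rewrite mem_iota => /andP[_ li].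
by rewrite field_at_code nth_gate_start // e /= nth_cat li.
Qed.

Lemma gate_code_le j : j < size gs -> gate_code w j <= 2.
Proof.
move=> lt; rewrite /gate_code w_code field_at_code -w_code.
by rewrite -[gate_start w j]addn0 nth_gate_start //=; case: (nth _ gs j).1.
Qed.

Lemma nfields_circuit : nfields w = gate_start w (size gs).
Proof.
rewrite w_code nfields_code -w_code.
have := drop_gate_start (leqnn _); rewrite drop_size /= => /(congr1 size).
rewrite size_drop /= => /eqP; rewrite subn_eq0 => le.
apply/eqP; rewrite eqn_leq le /=.
have H j : j <= size gs -> gate_start w j <= size s.
  elim: j => [|j IH] lt; first by rewrite /s /=.
  have Hj := drop_gate_start (ltnW lt); rewrite (drop_nth (GAnd, [::]) lt) /= in Hj.
  rewrite /gate_start iteriS -/(gate_start w j) w_code field_at_code -w_code.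
  have -> : nth 0 s (gate_start w j).+1 = size (nth (GAnd, [::]) gs j).2.
    by rewrite -addn1 -nth_drop Hj.
  have := congr1 size Hj; rewrite size_drop /= size_cat; have := IH (ltnW lt).
  by move: (size s) (gate_start w j) (size _) (size _) => a b c d; clear; lia.
exact: H.
Qed.
End DecodeCode.

(** Decoding succeeds on every word, so it has to be tested that the word has exactly the fields its
    arities call for. *)
Definition code_ok w :=
  [&& ~~ last false w, nfields w == gate_start w (field_at w 2) &
      all (fun j => gate_code w j <= 2) (iota 0 (field_at w 2))].

Lemma code_okP w : code_ok w <-> exists C, w = code_circuit C.
Proof.
split=> [/and3P[lw /eqP nf /allP kinds]|[C ->]].
  exists (decode w); have [s es] := code_nats_surj lw.
  have {1}-> : w = code_nats (mkseq (field_at w) (nfields w)).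
    rewrite {1}es; congr code_nats; rewrite es nfields_code.
    by rewrite -[LHS](mkseq_nth 0); apply: eq_map => j; rewrite field_at_code.
  rewrite /code_circuit; congr code_nats; rewrite nf /= size_mkseq.
  have H m : m <= field_at w 2 -> mkseq (field_at w) (gate_start w m) =
     [:: field_at w 0, field_at w 1, field_at w 2 & flatten (map gate_fields (mkseq (gate w) m))].
    elim: m => [|m IH] lt; first by [].
    rewrite mkseqS map_rcons flatten_rcons.
    rewrite /gate_start iteriS -/(gate_start w m) -/(gate_arity w m).
    rewrite {1}/mkseq iotaD map_cat -/(mkseq (field_at w) _) IH ?(ltnW lt) //= add0n.
    congr [:: _, _, _ & _ ++ _]; rewrite /gate_fields /= size_mkseq code_kind_of; last first.
      by apply: kinds; rewrite mem_iota.
    congr [:: _, _ & _].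
    have -> : iota (gate_start w m).+2 (gate_arity w m) =
      map (addn (gate_start w m + 2)) (iota 0 (gate_arity w m)) by rewrite -iotaDl addn0 addn2.
    by rewrite -map_comp; apply: eq_map => i; rewrite /gate_arg /= addnA.
  exact: H.
apply/and3P; split.
- rewrite /code_circuit; case: (_ :: _) => // n s.
  suff H s' : ~~ last false (code_nats s') by apply: H.
  elim: s' => // m s' IH; rewrite code_nats_cons last_cat /=.
  by [].
- rewrite nfields_circuit; apply/eqP; congr gate_start.
  by rewrite /code_circuit field_at_code.
- apply/allP => j; rewrite mem_iota => /andP[_ lt].
  apply: gate_code_le; move: lt.
  by rewrite {1}/code_circuit field_at_code.
Qed.

Section Propagate.
Variables (T : Type) (x0 : T) (op : gate_kind -> seq T -> T).

Definition wires (ini : seq T) gs :=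
  foldl (fun vs (g : gate_kind * seq nat) => rcons vs (op g.1 [seq nth x0 vs i | i <- g.2])) ini gs.

Lemma size_wires ini gs : size (wires ini gs) = size ini + size gs.
Proof.
by elim: gs ini => [|g gs IH] ini /=; rewrite ?addn0 // IH size_rcons addSnnS.
Qed.

Lemma wires_prefix ini gs i : i < size ini -> nth x0 (wires ini gs) i = nth x0 ini i.
Proof.
elim: gs ini => //= g gs IH ini lt; rewrite IH ?size_rcons ?ltnS 1?ltnW //.
by rewrite nth_rcons lt.
Qed.

(** A gate reads only earlier wires, and later gates do not alter these. *)
Lemma wires_gate ini gs j (g := nth (GAnd, [::]) gs j) : j < size gs ->
  all (fun i => i < size ini + j) g.2 ->
  nth x0 (wires ini gs) (size ini + j) = op g.1 [seq nth x0 (wires ini gs) i | i <- g.2].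
Proof.
move=> lt /allP H.
have e : wires ini gs = wires (wires ini (take j gs)) (g :: drop j.+1 gs).
  by rewrite /g -drop_nth // /wires -foldl_cat cat_take_drop.
have sz : size (wires ini (take j gs)) = size ini + j by rewrite size_wires size_takel // ltnW.
have pre i : i < size ini + j -> nth x0 (wires ini gs) i = nth x0 (wires ini (take j gs)) i.
  by move=> li; rewrite e wires_prefix // sz.
rewrite {1}e -sz [wires _ (_ :: _)]/= wires_prefix ?size_rcons //.
rewrite nth_rcons ltnn eqxx; congr op; apply/eq_in_map => i ig.
by rewrite pre // H.
Qed.
End Propagate.

(** * Refuting claims about wires from partial knowledge of the inputs *)

Section Net.
Variables (n N : nat) (kd ar : nat -> nat) (ag : nat -> nat -> nat).

Definition gate_sem k r (f : nat -> bool) :=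
  if k == 0 then all f (iota 0 r) else if k == 1 then has f (iota 0 r) else ~~ f 0.

(** The fuel [e] is a bound on the depth, and no gate below [u] is large; [weft1] admits one large
    gate on each path. *)
Fixpoint weft0 e u := (u < n) || (if e is e'.+1 then
  (ar u <= 2) && all (fun i => weft0 e' (ag u i)) (iota 0 (ar u)) else false).

Fixpoint weft1 e u := (u < n) || (if e is e'.+1 then
  if ar u <= 2 then all (fun i => weft1 e' (ag u i)) (iota 0 (ar u))
  else all (fun i => weft0 e' (ag u i)) (iota 0 (ar u)) else false).

Fixpoint known (kz : nat -> bool) e u := if u < n then kz u else
  if e is e'.+1 then all (fun i => known kz e' (ag u i)) (iota 0 (ar u)) else false.

Fixpoint evl (vz : nat -> bool) e u := if u < n then vz u else
  if e is e'.+1 then gate_sem (kd u) (ar u) (fun i => evl vz e' (ag u i)) else false.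

(** A choice among [g] inputs, and one subtree for either input of a small gate; below a large gate
    nothing is guessed. *)
Fixpoint guesses g e := if e is e'.+1 then g * (guesses g e' * guesses g e') else 1.

(* No local refutation, by the inputs on which [kz] holds, of the claim that
   wire [u] has value [b]. The number [G] encodes a binary tree of guesses that
   resolve the existential choices above the large gates. *)
Fixpoint unrefuted g (kz vz : nat -> bool) e u b G :=
  if u < n then kz u ==> (vz u == b) else
  if e is e'.+1 then
    let B := guesses g e' in
    let sub i b' :=
      if ar u <= 2 then
        unrefuted g kz vz e' (ag u i) b' (if i == 0 then (G %/ B) %% B else G %% B)
      else known kz e' (ag u i) ==> (evl vz e' (ag u i) == b') in
    if 2 <= kd u then sub 0 (~~ b)
    else if (kd u == 0) == b then all (fun i => sub i b) (iota 0 (ar u))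
    else (G %/ (B * B) < ar u) && sub (G %/ (B * B)) b
  else false.

Variable val : nat -> bool.
Hypothesis ag_lt : forall u i, n <= u < N -> i < ar u -> ag u i < N.
Hypothesis ar_not : forall u, n <= u < N -> 2 <= kd u -> ar u = 1.
Hypothesis val_gate : forall u, n <= u < N ->
  val u = gate_sem (kd u) (ar u) (fun i => val (ag u i)).

Lemma eq_gate_sem u f f' : n <= u < N -> (forall i, i < ar u -> f i = f' i) ->
  gate_sem (kd u) (ar u) f = gate_sem (kd u) (ar u) f'.
Proof.
move=> hu H; rewrite /gate_sem.
have HH : {in iota 0 (ar u), f =1 f'} by move=> i; rewrite mem_iota => /andP[_ /H].
case: ifP => h0; first exact: eq_in_all.
case: ifP => h1; first exact: eq_in_has.
congr negb; apply: H; rewrite ar_not //.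
by move: h0 h1; case: (kd u) => [|[|]].
Qed.

Lemma all_iotaP r (p : nat -> bool) : reflect (forall i, i < r -> p i) (all p (iota 0 r)).
Proof.
apply: (iffP allP) => H i; last by rewrite mem_iota => /andP[_ /H].
by move=> lt; apply: H; rewrite mem_iota.
Qed.

Lemma has_iotaP r (p : nat -> bool) : reflect (exists2 i, i < r & p i) (has p (iota 0 r)).
Proof.
apply: (iffP hasP) => [[i]|[i lt pi]]; first by rewrite mem_iota => /andP[_ lt] pi; exists i.
by exists i => //; rewrite mem_iota.
Qed.

Lemma evl_val e u : weft0 e u -> u < N -> evl val e u = val u.
Proof.
elim: e u => [|e IH] u /= w lt; first by move: w; rewrite orbF => ->.
case: ltnP w => //= le /andP[_ /all_iotaP w].
have hu : n <= u < N by rewrite le.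
rewrite val_gate //; apply: eq_gate_sem => // i li.
by apply: IH; [apply: w|apply: ag_lt].
Qed.

Lemma known_evl (kz vz : nat -> bool) e u : (forall z, z < n -> kz z -> vz z = val z) -> u < N ->
  known kz e u -> evl vz e u = evl val e u.
Proof.
move=> H; elim: e u => [|e IH] u lt /=; first by case: ltnP => // l1; apply: H.
case: ltnP => [l1|le]; first exact: H.
have hu : n <= u < N by rewrite le.
move/all_iotaP => kn; apply: eq_gate_sem => // i li.
by apply: IH; [apply: ag_lt|apply: kn].
Qed.

(** Fan-in at most 2 through depth [e] leaves at most [2 ^ e] inputs. *)
Lemma weft0_cover e u : weft0 e u -> u < N ->
  exists zs, [/\ size zs <= 2 ^ e, all (fun z => z < n) zs &
    forall kz : nat -> bool, all kz zs -> known kz e u].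
Proof.
elim: e u => [|e IH] u /= w lt.
  move: w; rewrite orbF => ltn_; exists [:: u]; rewrite ltn_ /= ltn_; split=> // kz.
  by rewrite andbT.
case: ltnP w => [ltn_|le] /=.
  move=> _; exists [:: u]; rewrite /= ltn_ expn_gt0; split=> // kz; by rewrite andbT.
have hu : n <= u < N by rewrite le.
move=> /andP[ar2 /all_iotaP w].
have H r : r <= ar u -> exists zs, [/\ size zs <= r * 2 ^ e, all (fun z => z < n) zs &
    forall kz : nat -> bool, all kz zs -> all (fun i => known kz e (ag u i)) (iota 0 r)].
  elim: r => [|r IHr] ler; first by exists [::].
  have [zs [s1 a1 k1]] := IHr (ltnW ler).
  have [zs' [s2 a2 k2]] := IH _ (w _ ler) (ag_lt hu ler).
  exists (zs ++ zs'); split; first by rewrite size_cat mulSn addnC leq_add.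
    by rewrite all_cat a1.
  move=> kz; rewrite all_cat => /andP[/k1 h1 /k2 h2].
  by rewrite -addn1 iotaD all_cat h1 /= h2.
have [zs [s1 a1 k1]] := H _ (leqnn _); exists zs; split=> //.
by apply: leq_trans s1 _; rewrite expnS leq_mul2r ar2 orbT.
Qed.

Lemma val_not u : n <= u < N -> 2 <= kd u -> val u = ~~ val (ag u 0).
Proof. by move=> hu; rewrite (val_gate hu) /gate_sem; case: (kd u) => [|[|]]. Qed.

Section Sound.
Variables (g q : nat) (I : Type) (kz vz : I -> nat -> bool).
Hypothesis consistent : forall i z, z < n -> kz i z -> vz i z = val z.
Hypothesis covering : forall zs : seq nat, size zs <= q -> all (fun z => z < n) zs ->
  exists i, all (kz i) zs.

Lemma unrefuted_sound e u b G : 2 ^ e <= q -> weft1 e u -> u < N ->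
  (forall i, unrefuted g (kz i) (vz i) e u b G) -> val u = b.
Proof.
have inp v b' : 1 <= q -> v < n -> (forall i, kz i v ==> (vz i v == b')) -> val v = b'.
  move=> q1 lt H; have [||i] := @covering [:: v]; rewrite /= ?lt //.
  rewrite andbT => k; have := H i; rewrite k /= => /eqP <-.
  by rewrite consistent.
elim: e u b G => [|e IH] u b G leq_ w lt Hi.
  by move: w Hi; rewrite /= orbF => ltn_; rewrite ltn_; apply: inp.
have leq' : 2 ^ e <= q.
  by apply: leq_trans leq_; rewrite leq_exp2l.
have q1 : 1 <= q by apply: leq_trans leq'; rewrite expn_gt0.
move: w Hi => /=; case: ltnP => [ltn_ _|le /= w] Hi; first exact: inp Hi.
have hu : n <= u < N by rewrite le.
set B := guesses g e in Hi.
pose sub i j b' := if ar u <= 2 then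
   unrefuted g (kz i) (vz i) e (ag u j) b' (if j == 0 then (G %/ B) %% B else G %% B)
   else known (kz i) e (ag u j) ==> (evl (vz i) e (ag u j) == b').
have Hs j b' : j < ar u -> (forall i, sub i j b') -> val (ag u j) = b'.
  move=> lj; rewrite /sub; case: ifP w => ar2 /all_iotaP w.
    by apply: IH => //; [apply: w|apply: ag_lt].
  move=> H; have la := ag_lt hu lj.
  have [zs [sz al kn]] := weft0_cover (w _ lj) la.
  have [i ci] := covering (leq_trans sz leq') al.
  have k := kn _ ci; have := H i; rewrite k /= => /eqP <-.
  rewrite (@known_evl (kz i)) // ?evl_val //; first by apply: w.
  exact: consistent.
have [i0 _] : exists i, all (kz i) [::] by apply: covering.
case k2 : (2 <= kd u).
  have Hi' i : sub i 0 (~~ b) by have := Hi i; rewrite k2.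
  have v0 : val (ag u 0) = ~~ b by apply: Hs => //; rewrite ar_not.
  by rewrite val_not // v0 negbK.
have k01 : kd u = 0 \/ kd u = 1 by move: k2; case: (kd u) => [|[|]]; auto.
case kb : ((kd u == 0) == b).
  have Hi' i : all (fun j => sub i j b) (iota 0 (ar u)) by have := Hi i; rewrite k2 kb.
  have all_b j : j < ar u -> val (ag u j) = b.
    by move=> lj; apply: Hs => // i; have /all_iotaP := Hi' i; apply.
  rewrite (val_gate hu) /gate_sem; case: k01 kb => -> /eqP kb; rewrite -kb in all_b *.
    by apply/all_iotaP.
  by apply/negbTE; apply/negP => /has_iotaP[j lj]; rewrite all_b.
have Hi' i : (G %/ (B * B) < ar u) && sub i (G %/ (B * B)) b.
  by have := Hi i; rewrite k2 kb.
have /andP[lg _] := Hi' i0.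
have vg : val (ag u (G %/ (B * B))) = b by apply: Hs => // i; have /andP[] := Hi' i.
rewrite (val_gate hu) /gate_sem; case: k01 kb => ->; case: (b) vg => vg //= _.
  by apply/negbTE; apply/negP => /all_iotaP/(_ _ lg); rewrite vg.
by apply/has_iotaP; exists (G %/ (B * B)).
Qed.
End Sound.

Lemma guesses_gt0 g e : 0 < g -> 0 < guesses g e.
Proof. by move=> g0; elim: e => //= e IH; rewrite !muln_gt0 g0 IH. Qed.

(** The choices are made from the true wire values, so the same number works for every consistent
    view. *)
Lemma unrefuted_complete g e u b : (forall v, ar v < g) -> weft1 e u -> u < N -> val u = b ->
  exists2 G, G < guesses g e & forall kz vz : nat -> bool,
    (forall z, z < n -> kz z -> vz z = val z) -> unrefuted g kz vz e u b G.
Proof.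
move=> arg; have g0 : 0 < g by apply: leq_ltn_trans (arg 0).
have inp v b' : v < n -> val v = b' -> forall kz vz : nat -> bool,
    (forall z, z < n -> kz z -> vz z = val z) -> kz v ==> (vz v == b').
  by move=> lv vb kz vz H; apply/implyP => k; rewrite H // vb.
elim: e u b => [|e IH] u b w lt vb.
  exists 0 => // kz vz H; move: w => /=; rewrite orbF => ltn_; rewrite ltn_; exact: inp.
move: w => /=; case: ltnP => [ltn_ _|le /= w].
  by exists 0 => [|kz vz H]; [rewrite !muln_gt0 g0 guesses_gt0|exact: inp].
have hu : n <= u < N by rewrite le.
set B := guesses g e; have B0 : 0 < B by apply: guesses_gt0.
pose sub (kz vz : nat -> bool) j b' X := if ar u <= 2 then unrefuted g kz vz e (ag u j) b' X
   else known kz e (ag u j) ==> (evl vz e (ag u j) == b').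
have Hs j b' : j < ar u -> val (ag u j) = b' -> exists2 X, X < B &
    forall kz vz : nat -> bool, (forall z, z < n -> kz z -> vz z = val z) -> sub kz vz j b' X.
  move=> lj vj; have la := ag_lt hu lj; rewrite /sub; case: ifP w => ar2 /all_iotaP w.
    by apply: IH => //; apply: w.
  exists 0 => // kz vz H; apply/implyP => k.
  by rewrite (known_evl H la k) evl_val ?vj //; apply: w.
pose mk x X Y := x * (B * B) + (X * B + Y).
have mkP x X Y : x < g -> X < B -> Y < B ->
  [/\ mk x X Y < g * (B * B), mk x X Y %/ (B * B) = x, (mk x X Y %/ B) %% B = X & mk x X Y %% B = Y].
  move=> lx lX lY; have lXY : X * B + Y < B * B by move: lX lY; clear; nia.
  split.
  - by rewrite /mk; move: lx lXY; move: (X * B + Y) (B * B) => c d; clear; nia.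
  - by rewrite /mk divnMDl ?muln_gt0 ?B0 // divn_small // addn0.
  - by rewrite /mk mulnA addnA -mulnDl divnMDl // divn_small // addn0 modnMDl modn_small.
  - by rewrite /mk mulnA addnA -mulnDl modnMDl modn_small.
(* When only one input is followed, its guess is put into both slots, so that it is found whichever
   slot is read. *)
have one j b' x : j < ar u -> x < g -> val (ag u j) = b' -> exists2 G, G < g * (B * B) /\ G %/ (B * B) = x &
    forall kz vz : nat -> bool, (forall z, z < n -> kz z -> vz z = val z) ->
      sub kz vz j b' (if j == 0 then (G %/ B) %% B else G %% B).
  move=> lj lx vj; have [X lX HX] := Hs j b' lj vj; have [m1 m2 m3 m4] := mkP x X X lx lX lX.
  by exists (mk x X X); rewrite ?m3 ?m4 //; case: ifP.
case: (leqP 2 (kd u)) => k2.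
  have [||G [lG _] HG] := @one 0 (~~ b) 0 _ g0; first by rewrite ar_not.
    by rewrite -vb (val_not hu k2) negbK.
  by exists G => // kz vz H; apply: (HG kz vz H).
have k01 : kd u = 0 \/ kd u = 1 by move: k2; case: (kd u) => [|[|]]; auto.
case kb : ((kd u == 0) == b).
  have all_b j : j < ar u -> val (ag u j) = b.
    move: vb kb; rewrite (val_gate hu) /gate_sem; case: k01 => -> /=.
      by move=> vb /eqP kb lj; rewrite -kb in vb *; move/all_iotaP: vb; apply.
    move=> vb /eqP kb lj; rewrite -kb in vb *; apply/negbTE/negP => vj.
    by move/negP: (negbT vb); apply; apply/has_iotaP; exists j.
  have ex j : exists2 X, X < B & j < ar u ->
      forall kz vz : nat -> bool, (forall z, z < n -> kz z -> vz z = val z) -> sub kz vz j b X.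
    case: (ltnP j (ar u)) => lj; last by exists 0.
    by have [X lX HX] := Hs j b lj (all_b _ lj); exists X.
  have [X lX HX] := ex 0; have [Y lY HY] := ex 1.
  have [m1 m2 m3 m4] := mkP 0 X Y g0 lX lY; exists (mk 0 X Y) => // kz vz H.
  apply/all_iotaP => j lj; rewrite m3 m4.
  case: j lj => [|[|j]] lj /=; [exact: HX|exact: HY|].
  (* A third input exists only at a large gate, whose inputs are checked without guesses. *)
  have ar2 : (ar u <= 2) = false by apply/negbTE; rewrite -ltnNge (leq_ltn_trans _ lj).
  have [Z _ HZ] := Hs _ _ lj (all_b _ lj); have := HZ kz vz H; rewrite /sub ar2; exact.
have [j lj vj] : exists2 j, j < ar u & val (ag u j) = b.
  move: vb kb; rewrite (val_gate hu) /gate_sem; case: k01 => -> /=; case: (b) => // vb _.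
    move/negbT: vb => /allPn[j]; rewrite mem_iota => /andP[_ lj] /negbTE vj; by exists j.
  by case/has_iotaP: vb => j lj vj; exists j.
have [G [lG Gx] HG] := one j b j lj (ltn_trans lj (arg u)) vj.
exists G => // kz vz H; rewrite Gx lj; exact: HG.
Qed.

End Net.

(** * Weighted assignments as chains of segments *)

Definition digit b s j := (s %/ b ^ j) %% b.
Definition undigits b (ds : seq nat) := foldr (fun d s => s * b + d) 0 ds.

Lemma undigits_lt b ds : all (fun d => d < b) ds -> undigits b ds < b ^ size ds.
Proof.
elim: ds => //= d ds IH /andP[ld /IH]; rewrite expnS.
by move: (undigits b ds) (b ^ size ds) => u v lu; move: ld lu; clear; nia.
Qed.

Lemma digit_undigits b ds j : all (fun d => d < b) ds ->
  j < size ds -> digit b (undigits b ds) j = nth 0 ds j.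
Proof.
elim: ds j => // d ds IH [|j] /= /andP[ld al] lj; rewrite /digit.
  by rewrite expn0 divn1 modnMDl modn_small.
rewrite expnS divnMA divnMDl ?(leq_ltn_trans _ ld) // (divn_small ld) addn0.
exact: IH.
Qed.

Section Breakpoints.
Variables (k n : nat) (y : nat -> nat).
Hypotheses (y0 : y 0 = 0) (y_last : y k.+1 = n.+1)
  (y_step : forall t, t <= k -> y t < y t.+1).

(** Inputs are shifted by one, so that the outer breakpoints 0 and [n.+1] stand for no input. *)
Definition chosen z := has (fun t => y t == z.+1) (iota 0 k.+1).

Lemma y_lt t t' : t < t' -> t' <= k.+1 -> y t < y t'.
Proof.
elim: t' => // t' IH; rewrite ltnS leq_eqVlt => /orP[/eqP ->|lt] le; first exact: y_step.
exact: ltn_trans (IH lt (ltnW le)) (y_step le).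
Qed.

Lemma y_inj t t' : t <= k.+1 -> t' <= k.+1 -> y t = y t' -> t = t'.
Proof.
move=> l1 l2 e; case: (ltngtP t t') => // lt.
  by have := y_lt lt l2; rewrite e ltnn.
by have := y_lt lt l1; rewrite e ltnn.
Qed.

Lemma y_locate x : x <= n -> exists t, [/\ t <= k, y t <= x & x < y t.+1].
Proof.
move=> lex; have H T : T <= k.+1 -> x < y T -> exists t, [/\ t <= k, y t <= x & x < y t.+1].
  elim: T => [|T IH] leT; first by rewrite y0.
  by move=> lt; case: (leqP (y T) x) => [le|]; [exists T|apply: IH; apply: ltnW].
by apply: (H k.+1) => //; rewrite y_last ltnS.
Qed.

Lemma y_pos t : 0 < t -> t <= k.+1 -> 0 < y t.
Proof. by move=> t0 le; rewrite -y0; apply: y_lt. Qed.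

Lemma count_chosen : count chosen (iota 0 n) = k.
Proof.
rewrite -size_filter; transitivity (size [seq (y t).-1 | t <- iota 1 k]); last first.
  by rewrite size_map size_iota.
apply: perm_size; apply: uniq_perm.
- by rewrite filter_uniq ?iota_uniq.
- rewrite map_inj_in_uniq ?iota_uniq // => t t'; rewrite !mem_iota !add1n !ltnS.
  move=> /andP[h1 h2] /andP[h3 h4] e; apply: y_inj; rewrite ?leqW //.
  by rewrite -(prednK (y_pos h1 (leqW h2))) e prednK // y_pos // leqW.
move=> z; rewrite mem_filter mem_iota /= add0n; apply/andP/mapP.
  move=> [/has_iotaP[t lt /eqP e] _]; exists t; last by rewrite e.
  by rewrite mem_iota add1n lt andbT; case: t e {lt}; rewrite ?y0.
move=> [t]; rewrite mem_iota add1n ltnS => /andP[t0 le] ->.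
have p := y_pos t0 (leqW le); split.
  by apply/has_iotaP; exists t; rewrite ?prednK.
by rewrite -ltnS prednK // -y_last; apply: y_lt.
Qed.
End Breakpoints.

(** * The constraint instance of a circuit *)

Section SegmentCsp.
Variables (n N out d g : nat) (kd ar : nat -> nat) (ag : nat -> nat -> nat).
Variable val : (nat -> bool) -> nat -> bool.
Hypothesis ag_lt : forall u i, n <= u < N -> i < ar u -> ag u i < N.
Hypothesis ar_not : forall u, n <= u < N -> 2 <= kd u -> ar u = 1.
Hypothesis ar_g : forall u, ar u < g.
Hypothesis val_in : forall a u, u < n -> val a u = a u.
Hypothesis val_gate : forall a u, n <= u < N ->
  val a u = gate_sem (kd u) (ar u) (fun i => val a (ag u i)).
Hypothesis out_lt : out < N.
Hypothesis out_weft : weft1 n ar ag d out.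

Definition nseg := 2 ^ d.
Definition radix := n.+2.
Definition seg s j := digit (radix * radix) s j.
Definition lo s j := seg s j %/ radix.
Definition hi s j := seg s j %% radix.
(** A segment asserts that its lower end is a true input and that all inputs strictly between its
    ends are false; the upper end belongs to the next segment. *)
Definition kz s z := has (fun j => (lo s j <= z.+1) && (z.+1 < hi s j)) (iota 0 nseg).
Definition vz s z := has (fun j => (lo s j == z.+1) && (z.+1 < hi s j)) (iota 0 nseg).

(* A variable [i] lists [nseg] segment numbers, its base-[k.+1] digits; a value
   consists of guesses for the circuit and of the end points of these segments. *)
Definition seg_rel k i i' v v' :=
  let S := (radix * radix) ^ nseg in
  [&& v %/ S == v' %/ S,
      all (fun j => all (fun j' =>
        ((digit k.+1 i j == digit k.+1 i' j') ==> (seg (v %% S) j == seg (v' %% S) j')) &&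
        ((digit k.+1 i' j' == (digit k.+1 i j).+1) ==> (hi (v %% S) j == lo (v' %% S) j')))
        (iota 0 nseg)) (iota 0 nseg),
      all (fun j => [&& lo (v %% S) j < hi (v %% S) j,
         (digit k.+1 i j == 0) ==> (lo (v %% S) j == 0) &
         (digit k.+1 i j == k) ==> (hi (v %% S) j == n.+1)]) (iota 0 nseg) &
      unrefuted n kd ar ag g (kz (v %% S)) (vz (v %% S)) d out true (v %/ S)].

Lemma q_gt0 : 0 < nseg. Proof. by rewrite expn_gt0. Qed.

Section Consistency.
Variables (k : nat) (y : nat -> nat) (s : nat).
Hypotheses (y0 : y 0 = 0) (y_step : forall t, t <= k -> y t < y t.+1).
Hypothesis segs : forall j, j < nseg -> exists t, [/\ t <= k, lo s j = y t & hi s j = y t.+1].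

(** As the breakpoints increase strictly, the only one inside a half-open segment is its lower
    end. *)
Lemma seg_consistent z : kz s z -> vz s z = chosen k y z.
Proof.
move=> /has_iotaP[j lj /andP[l1 l2]]; have [t [lt e1 e2]] := segs lj.
apply/idP/idP.
  move=> /has_iotaP[j' lj' /andP[/eqP e _]]; have [t' [lt' e1' _]] := segs lj'.
  by apply/has_iotaP; exists t' => //; rewrite -e1' e.
move=> /has_iotaP[t' lt' /eqP e]; apply/has_iotaP; exists j => //; rewrite l2 andbT.
rewrite e1 e2 -e in l1 l2 *; suff -> : t' = t by [].
case: (ltngtP t' t) => // lt2.
  by have := leq_trans (y_lt y_step lt2 (leqW lt)) l1; rewrite ltnn.
suff le : y t.+1 <= y t' by have := leq_ltn_trans le l2; rewrite ltnn.
move: lt2; rewrite leq_eqVlt => /orP[/eqP -> //|lt2].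
by apply: ltnW; apply: (y_lt y_step) => //; apply: leqW.
Qed.
End Consistency.

Lemma assignment_of_csp k :
  csp_yes (k.+1 ^ nseg) (guesses g d * (radix * radix) ^ nseg) (seg_rel k) ->
  exists a, count a (iota 0 n) = k /\ val a out.
Proof.
move=> [al [_ HR]]; set S := (radix * radix) ^ nseg in HR *.
pose s i := al i %% S; pose t_ i j := digit k.+1 i j.
(* The lowest digit of [t] is [t] itself when [t <= k], so the first segment listed by variable [t]
   can serve as the definition of segment number [t]; the constraints make all other occurrences
   agree with it. *)
pose y t := if t <= k then lo (s t) 0 else n.+1.
have q0 := q_gt0.
have tK t : t <= k -> t < k.+1 ^ nseg.
  by move=> le; apply: (@leq_trans (k.+1 ^ 1)); [rewrite expn1|rewrite leq_pexp2l].
have t0 t : t <= k -> t_ t 0 = t by move=> le; rewrite /t_ /digit expn0 divn1 modn_small.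
have tk i j : t_ i j <= k by rewrite /t_ /digit -ltnS ltn_mod.
have pair i i' j j' : i < k.+1 ^ nseg -> i' < k.+1 ^ nseg -> j < nseg -> j' < nseg ->
    ((t_ i j = t_ i' j') -> seg (s i) j = seg (s i') j') /\
    ((t_ i' j' = (t_ i j).+1) -> hi (s i) j = lo (s i') j').
  move=> li li' lj lj'; have /and4P[_ /all_iotaP/(_ j lj)/all_iotaP/(_ j' lj')/andP[h1 h2] _ _] := HR _ _ li li'.
  by split=> e; [move: h1|move: h2]; rewrite -/(t_ i j) -/(t_ i' j') e eqxx /= => /eqP.
have uni i j : i < k.+1 ^ nseg -> j < nseg -> [/\ lo (s i) j < hi (s i) j,
    t_ i j = 0 -> lo (s i) j = 0 & t_ i j = k -> hi (s i) j = n.+1].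
  move=> li lj; have /and4P[_ _ /all_iotaP/(_ j lj)/and3P[h1 h2 h3] _] := HR _ _ li li.
  by split=> // e; [move: h2|move: h3]; rewrite -/(t_ i j) e eqxx /= => /eqP.
have segs i j : i < k.+1 ^ nseg -> j < nseg ->
    [/\ t_ i j <= k, lo (s i) j = y (t_ i j) & hi (s i) j = y (t_ i j).+1].
  move=> li lj; have le := tk i j; split=> //.
    rewrite /y le; have [H _] := pair i (t_ i j) j 0 li (tK _ le) lj q0.
    by rewrite /lo H // t0.
  rewrite /y; case: ltnP => lt.
    have [_ H] := pair i (t_ i j).+1 j 0 li (tK _ lt) lj q0.
    by apply: H; rewrite t0.
  by have [_ _ ->] := uni i j li lj => //; apply/eqP; rewrite eqn_leq le.
have y0 : y 0 = 0.
  by rewrite /y; have [_ -> //] := uni 0 0 (tK 0 (leq0n k)) q0; rewrite t0.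
have ylast : y k.+1 = n.+1 by rewrite /y ltnn.
have ystep t : t <= k -> y t < y t.+1.
  move=> le; have [_ e1 e2] := segs t 0 (tK _ le) q0; have [h _ _] := uni t 0 (tK _ le) q0.
  by rewrite t0 // in e1 e2; rewrite -e1 -e2.
exists (chosen k y); split; first exact: count_chosen.
have K0 : 0 < k.+1 ^ nseg by rewrite expn_gt0.
pose I := 'I_(k.+1 ^ nseg).
apply: (@unrefuted_sound n N kd ar ag (val (chosen k y)) ag_lt ar_not (val_gate (chosen k y)) g nseg I
  (fun i => kz (s i)) (fun i => vz (s i)) _ _ d out true (al 0 %/ S)) => //.
- move=> i z lz kzz; rewrite val_in //; apply: seg_consistent kzz => // j lj.
  by exists (t_ i j); apply: segs.
(* Each given input lies in some segment; the variable with these segment numbers as digits knows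
   all of them. Unneeded digits are filled with 0. *)
- move=> zs sz al_n.
  have [ds [szd hd]] : exists ds : seq nat, size ds = size zs /\
      forall j, j < size zs -> nth 0 ds j <= k /\ y (nth 0 ds j) <= (nth 0 zs j).+1 < y (nth 0 ds j).+1.
    elim: zs al_n {sz} => [|z zs IH] /=; first by exists [::].
    move=> /andP[lz /IH[ds [szd hd]]]; have [t [h1 h2 h3]] := y_locate y0 ylast lz.
    by exists (t :: ds); split=> [|[|j]] /=; rewrite ?szd ?h1 ?h2 //; apply: hd.
  pose ds' := mkseq (nth 0 ds) nseg.
  have ald : all (fun x => x < k.+1) ds'.
    apply/allP => x /mapP[j _ ->]; have [lt|ge] := ltnP j (size zs); last by rewrite nth_default ?szd.
    by have [] := hd j lt.
  have szd' : size ds' = nseg by rewrite size_mkseq.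
  have lti : undigits k.+1 ds' < k.+1 ^ nseg by rewrite -[in X in _ < X]szd'; apply: undigits_lt.
  exists (Ordinal lti); apply/(all_nthP 0) => j lj /=.
  have ljq := leq_trans lj sz; have [h1 h2] := hd j lj.
  apply/has_iotaP; exists j => //; have [_ -> ->] := segs _ j lti ljq.
  by rewrite /t_ digit_undigits ?szd' // nth_mkseq.
(* All variables carry the guess of variable 0. *)
- move=> i; have /and4P[/eqP -> _ _ _] := HR _ _ K0 (ltn_ord i).
  by have /and4P[_ _ _] := HR _ _ (ltn_ord i) (ltn_ord i).
Qed.

Lemma csp_of_assignment k a : count a (iota 0 n) = k -> val a out ->
  csp_yes (k.+1 ^ nseg) (guesses g d * (radix * radix) ^ nseg) (seg_rel k).
Proof.
move=> ck va; pose ps := filter a (iota 0 n).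
have szp : size ps = k by rewrite size_filter.
(* The breakpoints are the true inputs, shifted by one, between the two sentinels. *)
pose ys := 0 :: rcons (map S ps) n.+1; pose y t := nth 0 ys t.
have y0 : y 0 = 0 by [].
have ylast : y k.+1 = n.+1 by rewrite /y /= nth_rcons size_map szp ltnn eqxx.
have srt : sorted ltn ys.
  rewrite /ys /= rcons_path; apply/andP; split.
    have : sorted ltn ps by apply: sorted_filter (iota_ltn_sorted 0 n) => ? ? ?; apply: ltn_trans.
    by case: (ps) => //= p ps'; rewrite path_map.
  have /allP H : all (fun x => x < n.+1) (0 :: map S ps).
    apply/allP => x; rewrite inE => /orP[/eqP -> //|/mapP[z]].
    by rewrite mem_filter mem_iota => /andP[_ lz] ->.
  by apply: H; apply: mem_last.
have szy : size ys = k.+2 by rewrite /= size_rcons size_map szp.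
have ystep t : t <= k -> y t < y t.+1.
  by move=> le; apply: (sortedP 0 srt); rewrite szy !ltnS.
have yle t : t <= k.+1 -> y t <= n.+1.
  rewrite -ylast leq_eqVlt => /orP[/eqP -> //|lt]; exact: ltnW (y_lt ystep lt (leqnn _)).
have chosenE z : z < n -> chosen k y z = a z.
  move=> lz; apply/has_iotaP/idP => [[t lt /eqP]|az].
    case: t lt => // t lt; rewrite /y /= nth_rcons size_map szp -ltnS lt (nth_map 0) ?szp // => -[e].
    by have : nth 0 ps t \in ps by [apply: mem_nth; rewrite szp]; rewrite e mem_filter => /andP[].
  have zp : z \in ps by rewrite mem_filter az mem_iota.
  have li : index z ps < k by rewrite -szp index_mem.
  exists (index z ps).+1; first by rewrite ltnS.
  by rewrite /y /= nth_rcons size_map szp li (nth_map 0) ?szp // nth_index.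
have [G lG HG] := unrefuted_complete ag_lt ar_not (val_gate a) ar_g out_weft out_lt va.
set S := (radix * radix) ^ nseg.
pose sg i := [seq y (digit k.+1 i j) * radix + y (digit k.+1 i j).+1 | j <- iota 0 nseg].
pose s i := undigits (radix * radix) (sg i).
have dk i j : digit k.+1 i j <= k by rewrite /digit -ltnS ltn_mod.
have szs i : size (sg i) = nseg by rewrite size_map size_iota.
have als i : all (fun x => x < radix * radix) (sg i).
  apply/allP => x /mapP[j _ ->].
  have := yle _ (leqW (dk i j)); have := yle (digit k.+1 i j).+1 (dk i j).
  by rewrite /radix; move: (y _) (y _) => u v; clear; nia.
have ls i : s i < S by rewrite /S -(szs i); apply: undigits_lt.
have segE i j : j < nseg -> seg (s i) j = y (digit k.+1 i j) * radix + y (digit k.+1 i j).+1.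
  by move=> lj; rewrite /seg digit_undigits ?szs // (nth_map 0) ?size_iota // nth_iota.
have ym t : t <= k -> y t.+1 < radix by move=> le; rewrite /radix ltnS; apply: yle.
have loE i j : j < nseg -> lo (s i) j = y (digit k.+1 i j).
  by move=> lj; rewrite /lo segE // divnMDl // divn_small ?addn0 // ym.
have hiE i j : j < nseg -> hi (s i) j = y (digit k.+1 i j).+1.
  by move=> lj; rewrite /hi segE // modnMDl modn_small // ym.
have S0 : 0 < S by rewrite expn_gt0 muln_gt0.
exists (fun i => G * S + s i); split=> [i _|i i' li li'].
  by have := ls i; rewrite -/S; move: (s i) (S) (guesses g d) lG => u v w; clear; nia.
have mE j : (G * S + s j) %% S = s j by rewrite modnMDl modn_small.
have dE j : (G * S + s j) %/ S = G by rewrite divnMDl // divn_small // addn0.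
rewrite /seg_rel -/S !mE !dE eqxx /=; apply/and3P; split.
- apply/all_iotaP => j lj; apply/all_iotaP => j' lj'; apply/andP; split; apply/implyP => /eqP e.
    by rewrite !segE // e.
  by rewrite hiE // loE // e.
- apply/all_iotaP => j lj; rewrite loE // hiE // ystep //=; apply/andP.
  by split; apply/implyP => /eqP ->; rewrite ?ylast ?y0.
- apply: HG => z lz kzz; rewrite val_in // -chosenE //; apply: seg_consistent kzz => // j lj.
  by exists (digit k.+1 i j); rewrite loE ?hiE.
Qed.
End SegmentCsp.

Definition ninp w := field_at w 0.
Definition nwires w := field_at w 0 + field_at w 2.
Definition wkind w u := gate_code w (u - ninp w).
Definition warity w u := gate_arity w (u - ninp w).
Definition warg w u i := gate_arg w (u - ninp w) i.

Definition wf_ok w :=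
  all (fun j =>
    [&& if 2 <= gate_code w j then gate_arity w j == 1 else 2 <= gate_arity w j,
        all (fun i => all (fun i' => (i < i') ==> (gate_arg w j i != gate_arg w j i'))
               (iota 0 (gate_arity w j))) (iota 0 (gate_arity w j)) &
        all (fun i => gate_arg w j i < ninp w + j) (iota 0 (gate_arity w j))])
    (iota 0 (field_at w 2)) && (field_at w 1 < nwires w).

Lemma uniq_mkseq (f : nat -> nat) r :
  uniq (mkseq f r) = all (fun i => all (fun i' => (i < i') ==> (f i != f i')) (iota 0 r)) (iota 0 r).
Proof.
apply/(uniqP 0)/all_iotaP => [H i li|H i j].
  apply/all_iotaP => j lj; apply/implyP => lt; apply/negP => /eqP e.
  have := H i j; rewrite !inE size_mkseq li lj !nth_mkseq // => /(_ isT isT e) eij.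
  by rewrite eij ltnn in lt.
rewrite !inE size_mkseq => li lj; rewrite !nth_mkseq // => e.
case: (ltngtP i j) => // lt.
  by have /all_iotaP/(_ j lj) := H i li; rewrite lt e eqxx.
by have /all_iotaP/(_ i li) := H j lj; rewrite lt e eqxx.
Qed.

Lemma wf_okP w : circuit_wf (decode w) <-> wf_ok w.
Proof.
have H j : j < field_at w 2 -> nth (GAnd, [::]) (c_gates (decode w)) j = gate w j.
  by move=> lt; rewrite /= nth_mkseq.
have K j : fanin_ok (gate w j) =
    if 2 <= gate_code w j then gate_arity w j == 1 else 2 <= gate_arity w j.
  by rewrite /fanin_ok /gate /= size_mkseq; case: (gate_code w j) => [|[|]].
have A j (p : pred nat) : all p (mkseq (gate_arg w j) (gate_arity w j)) =
    all (fun i => p (gate_arg w j i)) (iota 0 (gate_arity w j)) by rewrite all_map.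
rewrite /circuit_wf /= size_mkseq; split=> [[H1 H2]|/andP[/all_iotaP H1 H2]].
  apply/andP; split=> //; apply/all_iotaP => j lt.
  by have := H1 j lt; rewrite H // K /= uniq_mkseq A => -[-> -> ->].
split=> // j lt; rewrite H // K /= uniq_mkseq A.
by have /and3P[] := H1 j lt.
Qed.

(** * Decoded circuits as nets *)

Section Wires.
Variable w : word.
Hypothesis wf : wf_ok w.
Local Notation n := (ninp w).
Local Notation N := (nwires w).

Lemma wire_gate u : n <= u < N -> exists2 j, j < field_at w 2 & u = n + j.
Proof.
move=> /andP[le lt]; exists (u - n); last by rewrite subnKC.
by move: le lt; rewrite /nwires -/(ninp w); clear; lia.
Qed.

Lemma warg_lt u i : n <= u < N -> i < warity w u -> warg w u i < N.
Proof.
move=> /wire_gate[j lj ->]; rewrite /warity /warg addKn => li.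
have /andP[/all_iotaP/(_ j lj)/and3P[_ _ /all_iotaP/(_ i li) h] _] := wf.
by apply: (leq_trans h); rewrite leq_add2l ltnW.
Qed.

Lemma warity_not u : n <= u < N -> 2 <= wkind w u -> warity w u = 1.
Proof.
move=> /wire_gate[j lj ->]; rewrite /warity /wkind addKn => k2.
by have /andP[/all_iotaP/(_ j lj)/and3P[h _ _] _] := wf; move: h; rewrite k2 => /eqP.
Qed.

Lemma wires_decode (T : Type) (x0 : T) op ini u (vs := wires x0 op ini (c_gates (decode w))) :
  size ini = n -> n <= u < N ->
  nth x0 vs u = op (kind_of (wkind w u)) [seq nth x0 vs (warg w u i) | i <- iota 0 (warity w u)].
Proof.
move=> sz /wire_gate[j lj eu].
have g : nth (GAnd, [::]) (c_gates (decode w)) j = gate w j by rewrite /= nth_mkseq.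
rewrite eu -sz /vs wires_gate; last first.
- rewrite g all_map sz.
  by have /andP[/all_iotaP/(_ j lj)/and3P[_ _ h] _] := wf.
- by rewrite /= size_mkseq.
by rewrite g /= -map_comp sz /wkind /warity /warg addKn.
Qed.

Definition wval (a : nat -> bool) u :=
  nth false (wires false gate_val (mkseq a n) (c_gates (decode w))) u.

Lemma wval_in a u : u < n -> wval a u = a u.
Proof. by move=> lt; rewrite /wval wires_prefix ?size_mkseq // nth_mkseq. Qed.

Lemma wval_gate a u : n <= u < N ->
  wval a u = gate_sem (wkind w u) (warity w u) (fun i => wval a (warg w u i)).
Proof.
move=> hu; rewrite {1}/wval wires_decode ?size_mkseq // /gate_sem.
have := @warity_not _ hu; case: (wkind w u) => [|[|k]] H /=.
- by rewrite all_map.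
- by rewrite has_map.
by rewrite H.
Qed.

Lemma max_leq (ds : seq nat) c : (\max_(d <- ds) d <= c) = all (fun d => d <= c) ds.
Proof. by elim: ds => [|d ds IH]; rewrite ?big_nil // big_cons geq_max IH. Qed.

Definition wdepth u := nth 0 (wires 0 (fun _ ds => (\max_(d <- ds) d).+1) (nseq n 0) (c_gates (decode w))) u.
Definition wweft u := nth 0 (wires 0 (fun _ ds => (2 < size ds) + \max_(d <- ds) d) (nseq n 0) (c_gates (decode w))) u.

Lemma wdepth_in u : u < n -> wdepth u = 0.
Proof. by move=> lt; rewrite /wdepth wires_prefix ?size_nseq // nth_nseq lt. Qed.

Lemma wweft_in u : u < n -> wweft u = 0.
Proof. by move=> lt; rewrite /wweft wires_prefix ?size_nseq // nth_nseq lt. Qed.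

Lemma wdepth_gate u e : n <= u < N ->
  (wdepth u <= e.+1) = all (fun i => wdepth (warg w u i) <= e) (iota 0 (warity w u)).
Proof. by move=> hu; rewrite {1}/wdepth wires_decode ?size_nseq // ltnS max_leq all_map. Qed.

Lemma wdepth_gt0 u : n <= u < N -> 0 < wdepth u.
Proof. by move=> hu; rewrite /wdepth wires_decode ?size_nseq. Qed.

Lemma wweft_gate u : n <= u < N ->
  wweft u = (2 < warity w u) + \max_(d <- [seq wweft (warg w u i) | i <- iota 0 (warity w u)]) d.
Proof. by move=> hu; rewrite {1}/wweft wires_decode ?size_nseq // size_map size_iota. Qed.

(** Gates have positive depth, so both sides fail at a gate when the fuel is 0. *)
Lemma weft0E e u : u < N -> weft0 n (warity w) (warg w) e u = (wdepth u <= e) && (wweft u <= 0).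
Proof.
elim: e u => [|e IH] u lt /=; case: ltnP => [l1|le] /=.
- by rewrite wdepth_in // wweft_in.
- by rewrite leqNgt wdepth_gt0 ?le.
- by rewrite wdepth_in // wweft_in.
have hu : n <= u < N by rewrite le.
rewrite wdepth_gate // wweft_gate // leqNgt.
case: ltnP => ar2 /=; first by rewrite andbF.
rewrite add0n max_leq all_map -all_predI; apply: eq_in_all => i; rewrite mem_iota => /andP[_ li].
by rewrite IH ?warg_lt.
Qed.

Lemma weft1E e u : u < N -> weft1 n (warity w) (warg w) e u = (wdepth u <= e) && (wweft u <= 1).
Proof.
elim: e u => [|e IH] u lt /=; case: ltnP => [l1|le] /=.
- by rewrite wdepth_in // wweft_in.
- by rewrite leqNgt wdepth_gt0 ?le.
- by rewrite wdepth_in // wweft_in.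
have hu : n <= u < N by rewrite le.
rewrite wdepth_gate // wweft_gate // leqNgt.
case: ltnP => ar2 /=.
  rewrite add1n ltnS max_leq all_map -all_predI; apply: eq_in_all => i; rewrite mem_iota => /andP[_ li].
  by rewrite weft0E ?warg_lt.
rewrite add0n max_leq all_map -all_predI; apply: eq_in_all => i; rewrite mem_iota => /andP[_ li].
by rewrite IH ?warg_lt.
Qed.
End Wires.

Definition circuit_ok d w :=
  [&& code_ok w, wf_ok w & weft1 (ninp w) (warity w) (warg w) d (field_at w 1)].

Lemma weighted_circuit_satE d w k : weighted_circuit_sat 1 d w k <->
  circuit_ok d w /\ exists a, count a (iota 0 (ninp w)) = k /\ wval w a (field_at w 1).
Proof.
split.
  move=> [C [ew wfC we de [a [sz ck ev]]]].
  have eC : decode w = C by rewrite ew decode_code.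
  have okw : wf_ok w by apply/wf_okP; rewrite eC.
  have en : ninp w = c_inputs C by rewrite -eC.
  have eo : field_at w 1 = c_output C by rewrite -eC.
  split.
    rewrite /circuit_ok okw (_ : code_ok w) /=; last by apply/code_okP; exists C.
    rewrite weft1E //; last by case/andP: okw.
    by rewrite /wdepth /wweft eC en eo -/(propagate _ _ _ _); apply/andP.
  exists (nth false a); split.
    by rewrite en -sz -ck -[in RHS](mkseq_nth false a) /mkseq count_map; apply: eq_count.
  by rewrite /wval eC en eo -sz mkseq_nth.
move=> [/and3P[/code_okP[C ew] okw w1] [a [ck va]]].
have eC : decode w = C by rewrite ew decode_code.
have en : ninp w = c_inputs C by rewrite -eC.
have eo : field_at w 1 = c_output C by rewrite -eC.
move: w1; rewrite weft1E //; last by case/andP: okw.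
rewrite /wdepth /wweft eC en eo => /andP[de we].
exists C; split=> //; first by rewrite -eC; apply/wf_okP.
exists (mkseq a (ninp w)); split.
- by rewrite size_mkseq.
- by rewrite -ck count_map; apply: eq_count.
- by move: va; rewrite /wval eC eo.
Qed.

(** Independent of the circuit, which keeps the new parameter bounded in the old one. *)
Definition seg_K d (w : word) k := k.+1 ^ nseg d.
(** The arity bound is [(size w).+1] because an arity is a unary field of [w]. *)
Definition seg_D d (w : word) (k : nat) := guesses (size w).+1 d * (radix (ninp w) * radix (ninp w)) ^ nseg d.
(** Words that do not encode an admissible circuit must yield no-instances, so the test is part of
    every constraint. *)
Definition seg_R d w k i j v v' := circuit_ok d w &&
  seg_rel (ninp w) (field_at w 1) d (size w).+1 (wkind w) (warity w) (warg w) k i j v v'.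

Lemma weighted_circuit_csp d w k :
  weighted_circuit_sat 1 d w k <-> csp_yes (seg_K d w k) (seg_D d w k) (seg_R d w k).
Proof.
have arg u : warity w u < (size w).+1 by rewrite ltnS field_at_le.
rewrite weighted_circuit_satE; split.
  move=> [ok [a [ck va]]]; have /and3P[_ okw w1] := ok.
  have out_lt : field_at w 1 < nwires w by case/andP: okw.
  have [al [h1 h2]] := csp_of_assignment (warg_lt okw) (warity_not okw) arg
    (@wval_in w) (wval_gate okw) out_lt w1 ck va.
  by exists al; split=> // i j li lj; rewrite /seg_R ok h2.
move=> [al [h1 h2]].
have K0 : 0 < seg_K d w k by rewrite expn_gt0.
have /andP[ok _] := h2 _ _ K0 K0; split=> //; have /and3P[_ okw w1] := ok.
have out_lt : field_at w 1 < nwires w by case/andP: okw.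
apply: (assignment_of_csp (warg_lt okw) (warity_not okw) (@wval_in w) (wval_gate okw) out_lt w1 (g := (size w).+1)).
by exists al; split=> // i j li lj; have /andP[] := h2 _ _ li lj.
Qed.

(** * Computing the constraints of a circuit *)

Lemma PB_has_seq (C : ctx) (T : Type) (s : seq T) (p : T -> C -> bool) :
  (forall x, PB (p x)) -> PB (fun a => has (fun x => p x a) s).
Proof.
by move=> H; elim: s => [|x s IH] /=; [apply: PB_const|apply: PB_or].
Qed.

Opaque divn modn muln addn subn expn.

Lemma PF_zeros_before (C : ctx) (p : C -> nat) :
  PF p -> PF (fun a => zeros_before (cw a) (p a)).
Proof. by move=> Pp; rewrite /zeros_before; pf. Qed.

Ltac pf_user ::= lazymatch goal with
  | |- PF (fun a => zeros_before _ _) => apply: PF_zeros_before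
  end.

Lemma PF_field_at (C : ctx) (j : C -> nat) : PF j -> PF (fun a => field_at (cw a) (j a)).
Proof. by move=> Pj; rewrite /field_at; pf. Qed.

Ltac pf_user ::= lazymatch goal with
  | |- PF (fun a => zeros_before _ _) => apply: PF_zeros_before
  | |- PF (fun a => field_at _ _) => apply: PF_field_at
  end.

Lemma PF_gate_start (C : ctx) (j : C -> nat) : PF j -> PF (fun a => gate_start (cw a) (j a)).
Proof.
move=> Pj; rewrite /gate_start.
apply: (@PF_iter _ j (fun=> 3) (fun a => 3 + j a * (2 + size (cw a)))
  (fun a _ s => s + (2 + field_at (cw a) s.+1))) => //.
- exact: PF_const.
- by pf.
- by apply: PF_polyb; pf.
move=> a i le; apply: (@leq_trans (3 + i * (2 + size (cw a)))).
  elim: i {le} => [|i IH]; first by rewrite mul0n.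
  rewrite iteriS mulSn; move: IH; set v := iteri i _ 3 => IH.
  have := field_at_le (cw a) v.+1; move: (i * _) (field_at _ _) IH => x y; clear; lia.
by rewrite leq_add2l leq_mul2r le orbT.
Qed.

Section WireFunctions.
Variable C : ctx.
Implicit Types j u i : C -> nat.

Lemma PF_gate_code j : PF j -> PF (fun a => gate_code (cw a) (j a)).
Proof. by move=> Pj; have Ps := PF_gate_start Pj; rewrite /gate_code; pf. Qed.

Lemma PF_gate_arity j : PF j -> PF (fun a => gate_arity (cw a) (j a)).
Proof. by move=> Pj; have Ps := PF_gate_start Pj; rewrite /gate_arity; pf. Qed.

Lemma PF_gate_arg j i : PF j -> PF i -> PF (fun a => gate_arg (cw a) (j a) (i a)).
Proof. by move=> Pj Pi; have Ps := PF_gate_start Pj; rewrite /gate_arg; pf. Qed.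

Lemma PF_ninp : PF (fun a : C => ninp (cw a)).
Proof. by rewrite /ninp; pf. Qed.

Lemma PF_wkind u : PF u -> PF (fun a => wkind (cw a) (u a)).
Proof. by move=> Pu; apply: PF_gate_code; apply: PF_sub => //; apply: PF_ninp. Qed.

Lemma PF_warity u : PF u -> PF (fun a => warity (cw a) (u a)).
Proof. by move=> Pu; apply: PF_gate_arity; apply: PF_sub => //; apply: PF_ninp. Qed.

Lemma PF_warg u i : PF u -> PF i -> PF (fun a => warg (cw a) (u a) (i a)).
Proof. by move=> Pu Pi; apply: PF_gate_arg => //; apply: PF_sub => //; apply: PF_ninp. Qed.

Lemma PF_seg (s : C -> nat) (r : nat) : PF s -> PF (fun a => seg (ninp (cw a)) (s a) r).
Proof. by move=> Ps; have Pn := PF_ninp; rewrite /seg /digit /radix; pf. Qed.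

Lemma PF_guesses e (g : C -> nat) : PF g -> PF (fun a : C => guesses (g a) e).
Proof.
move=> Pg; elim: e => [|e IH] /=; first exact: PF_const.
by apply: PF_mul => //; apply: PF_mul.
Qed.
End WireFunctions.

Ltac pf_user ::= lazymatch goal with
  | |- PF (fun a => field_at _ _) => apply: PF_field_at
  | |- PF (fun a => zeros_before _ _) => apply: PF_zeros_before
  | |- PF (fun a => gate_start _ _) => apply: PF_gate_start
  | |- PF (fun a => gate_code _ _) => apply: PF_gate_code
  | |- PF (fun a => gate_arity _ _) => apply: PF_gate_arity
  | |- PF (fun a => gate_arg _ _ _) => apply: PF_gate_arg
  | |- PF (fun a => ninp _) => apply: PF_ninp
  | |- PF (fun a => wkind _ _) => apply: PF_wkind
  | |- PF (fun a => warity _ _) => apply: PF_warity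
  | |- PF (fun a => warg _ _ _) => apply: PF_warg
  | |- PF (fun a => guesses _ _) => apply: PF_guesses
  end.

Lemma PF_lo (C : ctx) s j : PF s -> PF (fun a : C => lo (ninp (cw a)) (s a) j).
Proof. by move=> Ps; have H := PF_seg j Ps; rewrite /lo /radix; pf. Qed.

Lemma PF_hi (C : ctx) s j : PF s -> PF (fun a : C => hi (ninp (cw a)) (s a) j).
Proof. by move=> Ps; have H := PF_seg j Ps; rewrite /hi /radix; pf. Qed.

Lemma PB_kz (C : ctx) d s z : PF s -> PF z -> PB (fun a : C => kz (ninp (cw a)) d (s a) (z a)).
Proof.
move=> Ps Pz; apply: PB_has_seq => j.
by have Pl := PF_lo j Ps; have Ph := PF_hi j Ps; pf.
Qed.

Lemma PB_vz (C : ctx) d s z : PF s -> PF z -> PB (fun a : C => vz (ninp (cw a)) d (s a) (z a)).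
Proof.
move=> Ps Pz; apply: PB_has_seq => j.
by have Pl := PF_lo j Ps; have Ph := PF_hi j Ps; pf.
Qed.

Lemma PB_weft0 e (C : ctx) u : PF u ->
  PB (fun a : C => weft0 (ninp (cw a)) (warity (cw a)) (warg (cw a)) e (u a)).
Proof.
elim: e C u => [|e IH] C u Pu; cbn [weft0]; first by pf.
have H : PB (C := ext C) (fun p => weft0 (ninp (cw p)) (warity (cw p)) (warg (cw p)) e (warg (cw p) (u p.1) p.2)).
  by apply: IH; pf.
by pf.
Qed.

Lemma PB_weft1 e (C : ctx) u : PF u ->
  PB (fun a : C => weft1 (ninp (cw a)) (warity (cw a)) (warg (cw a)) e (u a)).
Proof.
elim: e C u => [|e IH] C u Pu; cbn [weft1]; first by pf.
have H0 : PB (C := ext C) (fun p => weft0 (ninp (cw p)) (warity (cw p)) (warg (cw p)) e (warg (cw p) (u p.1) p.2)).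
  by apply: PB_weft0; pf.
have H1 : PB (C := ext C) (fun p => weft1 (ninp (cw p)) (warity (cw p)) (warg (cw p)) e (warg (cw p) (u p.1) p.2)).
  by apply: IH; pf.
by pf.
Qed.

Lemma PB_known d e (C : ctx) s u : PF s -> PF u ->
  PB (fun a : C => known (ninp (cw a)) (warity (cw a)) (warg (cw a)) (kz (ninp (cw a)) d (s a)) e (u a)).
Proof.
elim: e C s u => [|e IH] C s u Ps Pu; have Pk := PB_kz d Ps Pu; cbn [known]; first by pf.
have H : PB (C := ext C) (fun p => known (ninp (cw p)) (warity (cw p)) (warg (cw p))
    (kz (ninp (cw p)) d (s p.1)) e (warg (cw p) (u p.1) p.2)).
  by apply: (IH (ext C) (fun p => s p.1)); pf.
by pf.
Qed.

Lemma PB_evl d e (C : ctx) s u : PF s -> PF u ->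
  PB (fun a : C => evl (ninp (cw a)) (wkind (cw a)) (warity (cw a)) (warg (cw a)) (vz (ninp (cw a)) d (s a)) e (u a)).
Proof.
elim: e C s u => [|e IH] C s u Ps Pu; have Pk := PB_vz d Ps Pu; cbn [evl]; first by pf.
rewrite /gate_sem.
have H : PB (C := ext C) (fun p => evl (ninp (cw p)) (wkind (cw p)) (warity (cw p)) (warg (cw p))
    (vz (ninp (cw p)) d (s p.1)) e (warg (cw p) (u p.1) p.2)).
  by apply: (IH (ext C) (fun p => s p.1)); pf.
have H0 : PB (fun a : C => evl (ninp (cw a)) (wkind (cw a)) (warity (cw a)) (warg (cw a))
    (vz (ninp (cw a)) d (s a)) e (warg (cw a) (u a) 0)).
  by apply: IH => //; pf.
by pf.
Qed.

(** The depth is a constant of the reduction, so the recursion unfolds into an expression of fixed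
    size. *)
Lemma PB_unrefuted d e (C : ctx) g s u b G : PF g -> PF s -> PF u -> PF G ->
  PB (fun a : C => unrefuted (ninp (cw a)) (wkind (cw a)) (warity (cw a)) (warg (cw a)) (g a)
    (kz (ninp (cw a)) d (s a)) (vz (ninp (cw a)) d (s a)) e (u a) b (G a)).
Proof.
elim: e C g s u b G => [|e IH] C g s u b G Pg Ps Pu PG; have Pk := PB_kz d Ps Pu;
  have Pv := PB_vz d Ps Pu; cbn [unrefuted]; first by pf.
(* The context varies because the index of the gate input is bound by a loop in the universal case
   and computed from the guess in the existential one. *)
have sub (C' : ctx) (g' s' u' G' i : C' -> nat) b' : PF g' -> PF s' -> PF u' -> PF G' -> PF i ->
    PB (fun p => if warity (cw p) (u' p) <= 2 then
      unrefuted (ninp (cw p)) (wkind (cw p)) (warity (cw p)) (warg (cw p)) (g' p)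
        (kz (ninp (cw p)) d (s' p)) (vz (ninp (cw p)) d (s' p)) e (warg (cw p) (u' p) (i p)) b'
        (if i p == 0 then (G' p %/ guesses (g' p) e) %% guesses (g' p) e else G' p %% guesses (g' p) e)
      else known (ninp (cw p)) (warity (cw p)) (warg (cw p)) (kz (ninp (cw p)) d (s' p)) e (warg (cw p) (u' p) (i p))
       ==> (evl (ninp (cw p)) (wkind (cw p)) (warity (cw p)) (warg (cw p)) (vz (ninp (cw p)) d (s' p)) e (warg (cw p) (u' p) (i p)) == b')).
  move=> Pg' Ps' Pu' PG' Pi; apply: PB_if; first by pf.
    by apply: IH => //; pf.
  apply: PB_imp; first by apply: PB_known => //; pf.
  by apply: PB_eqb (PB_const _ _); apply: PB_evl => //; pf.
have Ps1 := PF_wk Ps; have Pg1 := PF_wk Pg; have Pu1 := PF_wk Pu; have PG1 := PF_wk PG.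
have PGB : PF (fun a : C => G a %/ (guesses (g a) e * guesses (g a) e)) by pf.
have S0 := sub C g s u G (fun=> 0) (~~ b) Pg Ps Pu PG (PF_const _ _).
have S1 := sub (ext C) _ _ _ _ _ b Pg1 Ps1 Pu1 PG1 (PF_var0 C).
have S2 := sub C g s u G _ b Pg Ps Pu PG PGB.
apply: PB_if; [by pf|by pf|].
apply: PB_if; [by pf|exact: S0|].
apply: PB_if; [by pf| |apply: PB_and; [by pf|exact: S2]].
by apply: PB_all; [pf|exact: S1].
Qed.

Lemma PB_code_ok (C : ctx) : PB (fun a : C => code_ok (cw a)).
Proof.
rewrite /code_ok /nfields.
have Pl : PB (fun a : C => last false (cw a)).
  apply: (@PB_eq _ (fun a => nth false (cw a) (size (cw a)).-1)); first by move=> a; rewrite nth_last.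
  by have Ps := PF_size C; pf.
by have Ps := PF_size C; pf.
Qed.

Lemma PB_wf_ok (C : ctx) : PB (fun a : C => wf_ok (cw a)).
Proof. by rewrite /wf_ok /nwires; pf. Qed.

Lemma PB_circuit_ok d (C : ctx) : PB (fun a : C => circuit_ok d (cw a)).
Proof.
apply: PB_and; first exact: PB_code_ok.
apply: PB_and; first exact: PB_wf_ok.
by apply: PB_weft1; pf.
Qed.

Lemma PB_seg_R d (C : ctx) (k i j v v' : C -> nat) : PF k -> PF i -> PF j -> PF v -> PF v' ->
  PB (fun a => seg_R d (cw a) (k a) (i a) (j a) (v a) (v' a)).
Proof.
move=> Pk Pi Pj Pv Pv'; apply: PB_and; first exact: PB_circuit_ok.
rewrite /seg_rel; cbv zeta.
have PS : PF (fun a : C => (radix (ninp (cw a)) * radix (ninp (cw a))) ^ nseg d) by rewrite /radix; pf.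
have Ps := PF_mod Pv PS; have Ps' := PF_mod Pv' PS.
have Pd (i0 : C -> nat) j0 : PF i0 -> PF (fun a => digit (k a).+1 (i0 a) j0).
  by move=> Pi0; rewrite /digit; pf.
have Psz := PF_size C.
have Pq := PF_div Pv PS; have Pq' := PF_div Pv' PS.
apply: PB_and; first exact: PB_eqn.
apply: PB_and.
  apply: PB_all_seq => j1; apply: PB_all_seq => j2.
  have H1 := PF_seg j1 Ps; have H2 := PF_seg j2 Ps'; have H3 := PF_hi j1 Ps; have H4 := PF_lo j2 Ps'.
  have H5 := Pd i j1 Pi; have H6 := Pd j j2 Pj.
  by pf.
apply: PB_and.
  apply: PB_all_seq => j1.
  have H3 := PF_hi j1 Ps; have H4 := PF_lo j1 Ps; have H5 := Pd i j1 Pi.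
  by pf.
by apply: PB_unrefuted => //; pf.
Qed.

Lemma PF_seg_K d (C : ctx) (k : C -> nat) : PF k -> PF (fun a => seg_K d (cw a) (k a)).
Proof. by move=> Pk; rewrite /seg_K; pf. Qed.

Lemma PF_seg_D d (C : ctx) (k : C -> nat) : PF k -> PF (fun a => seg_D d (cw a) (k a)).
Proof. by move=> Pk; rewrite /seg_D /radix; have Ps := PF_size C; pf. Qed.

Transparent divn modn muln addn subn expn.

(** * The parameterized time bound *)

Lemma polybound_le_pow c n : polybound c n <= n.+2 ^ c.+1.
Proof.
rewrite /polybound expnS; have h1 : n ^ c <= n.+2 ^ c by apply: leq_exp2; lia.
have h2 : c <= n.+2 ^ c.
  by apply: (@leq_trans (2 ^ c)); [exact: ltnW (ltn_expl _ _)|apply: leq_exp2].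
by move: (n ^ c) (n.+2 ^ c) h1 h2 => x y; clear; nia.
Qed.

(** The lengths [r] and [s] of the intermediate word and parameter may be as large as the time [T];
    a power of them still splits into a factor in the parameter and a polynomial in [n]. *)
Lemma fpt_time c e hk k n r s T :
  T <= hk * polybound c n -> r <= n + T -> s <= k + T ->
  (n + k) * 12 + T + (r + s).+2 ^ e <= (hk + k).+2 ^ (e + 3) * n.+2 ^ ((c + 4) * (e + 3)).
Proof.
move=> hT hr hs; rewrite expnM -expnMn; set H := (hk + k).+2; set X := n.+2.
(* [Y] exceeds 15 and dominates [n + k], [T] and [(r + s).+2]; the total is at most
   [13 * Y + Y ^ e], hence at most [Y ^ (e + 3)]. *)
set Y := H * X ^ (c + 4).
have P0 := polybound_le_pow c n; rewrite -/X in P0.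
have Xc : 0 < X ^ c.+1 by rewrite expn_gt0.
have eY : Y = H * (X ^ c.+1 * (X * X * X)).
  by rewrite /Y (_ : c + 4 = c.+1 + 3) ?expnD ?expnS ?expn0 ?muln1 ?mulnA //; lia.
have hT2 : T <= H * X ^ c.+1.
  by apply: leq_trans hT _; apply: leq_mul => //; rewrite /H; lia.
have Y16 : 16 <= Y.
  rewrite eY /H /X; move: (n.+2 ^ c.+1) Xc => u u0; move: (hk + k) => v; clear -u0; nia.
have hb : (r + s).+2 <= Y.
  have : (r + s).+2 <= n + k + 2 * T + 2 by move: hr hs; clear; lia.
  move=> h; apply: leq_trans h _; rewrite eY.
  apply: (@leq_trans (4 * (H * (X * X ^ c.+1)))).
    have : n + k + 2 <= 2 * (H * (X * X ^ c.+1)).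
      have h1 : n.+2 <= X * X ^ c.+1 by rewrite -/X leq_pmulr.
      by rewrite /H; move: (X * X ^ c.+1) h1 => u; clear; nia.
    have : T <= H * (X * X ^ c.+1).
      by apply: leq_trans hT2 _; rewrite leq_mul2l leq_pmull ?orbT.
    by move: (H * _) => u; clear; lia.
  rewrite mulnCA; apply: leq_mul => //.
  by rewrite /X; move: (n.+2 ^ c.+1) => u; clear; nia.
have hn : (n + k) * 12 <= 12 * Y by have := hb; move: hr hs; rewrite eY /H /X;
  move: (n.+2 ^ c.+1) Xc => u u0; clear -u0; nia.
have hTY : T <= Y.
  apply: leq_trans hT2 _; rewrite eY leq_mul2l leq_pmulr ?orbT //.
have he : (r + s).+2 ^ e <= Y ^ e by apply: leq_exp2.
rewrite expnD; have Ye : 0 < Y ^ e by rewrite expn_gt0; move: Y16; clear; lia.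
apply: (@leq_trans (13 * Y + Y ^ e)); first by move: hn hTY he; clear; lia.
rewrite !expnS expn0 muln1; move: (Y) (Y ^ e) Ye Y16 => y' z z0 y16; clear -z0 y16.
apply: (@leq_trans (z * (y' * 16))); first by nia.
by rewrite !leq_mul2l; apply/orP; right; apply/orP; right; nia.
Qed.

Theorem ml_hamiltonian_W1_hard l t : 2 <= l -> l <= t ->
  W_hard 1 (ml_subgraph_by_k Hamiltonian l t).
Proof.
move=> l2 lt P [d [r0 [s0 [iff0 [g0 cg0 hg0] [M [h [c [ch HM]]]]]]]].
have [M' [e HM']] := reduce_csp l t (PF_seg_K d) (PF_seg_D d) (PB_seg_R d) M.
exists (fun x k => code_ml (ml_of_csp (seg_K d (r0 x k) (s0 x k)) (seg_D d (r0 x k) (s0 x k))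
                              (seg_R d (r0 x k) (s0 x k)) l t)),
  (fun x k => nlev (seg_K d (r0 x k) (s0 x k))); split.
- move=> x k; rewrite iff0 weighted_circuit_csp.
  have K0 : 0 < seg_K d (r0 x k) (s0 x k) by rewrite expn_gt0.
  have D0 : 0 < seg_D d (r0 x k) (s0 x k).
    by rewrite muln_gt0 guesses_gt0 // expn_gt0 muln_gt0.
  by rewrite (ml_by_k_csp _ K0 D0 l2 lt); split=> [|[]].
(* The number of levels grows with the intermediate parameter, which is at most [g0 k]. *)
- exists (fun k => nlev ((size (unary (g0 k))).+1 ^ nseg d)).
    apply: (computable_comp (f := fun a => nlev ((size a.1).+1 ^ nseg d)) cg0).
    by rewrite /nlev; have Ps := PF_size base; pf.
  move=> x k; rewrite size_nseq /nlev leq_add2r leq_mul2l /=.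
  by apply: leq_mul; apply: leq_exp2; rewrite ltnS.
have [C HC] := polybound_pow ((c + 4) * (e + 3)).
exists M', (fun k => (size (unary (h k)) + k).+2 ^ (e + 3)), C; split.
  apply: (computable_comp (f := fun a => (size a.1 + a.2).+2 ^ (e + 3)) ch).
  have Ps := PF_size base; have Pk : PF (C := base) snd by apply: (PF_var base 0).
  by pf.
move=> x k; have cM := HM x k.
apply: computes_within_le (HM' [:: x; unary k] _ _ _ isT cM).
have hr := size_output 0 cM; have hs := size_output 1 cM; rewrite /= !size_nseq in hr hs *.
rewrite addn0; apply: leq_trans (fpt_time e (leqnn _) hr hs) _.
by rewrite leq_mul2l HC orbT.
Qed.

Theorem theorem13 (l t : nat) (hl : 2 <= l) (ht : l <= t) :
  NP_hard (ml_subgraph Hamiltonian l t) /\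
  W_hard 1 (ml_subgraph_by_k Hamiltonian l t).
Proof. by split; [apply: ml_hamiltonian_NP_hard|apply: ml_hamiltonian_W1_hard]. Qed.
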